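(* Fix $k\ge1$. For $n\ge k$ let $\mathbf{S_{n,n}}=(S_{1,n},\dots,S_{n,n})^T$ be uniformly distributed on $\mathcal{M}_n(\mathbb{R})$ and let $\mathbf{U_{k,n}}=(U_{1,n},\dots,U_{k,n})^T$ be its first $k$ symmetric canonical moments. Then $$\sqrt{4(p+1)n}\,(\mathbf{U_{k,n}}-\mathbf{U^0_k})\xrightarrow[n\to\infty]{\mathcal{D}}\mathbf{G_k},$$ where $\mathbf{U^0_k}=\tfrac12(I_p,\dots,I_p)^T$ and $\mathbf{G_k}$ consists of $k$ independent GOE matrices.
   Context: A real matrix measure on $[0,1]$: $p\times p$ matrix of signed Borel measures with $\mu(B)$ symmetric nonnegative definite, $\mu([0,1])=I_p$; moments $S_k=\int_0^1x^kd\mu$, $S_0=I_p$; $\mathcal{M}_n(\mathbb{R})\subset(\mathcal{S}_p(\mathbb{R}))^n$ is the set of moment vectors, with uniform distribution of density $\mathcal{V}(\mathcal{M}_n(\mathbb{R}))^{-1}\mathbf{1}_{\mathcal{M}_n(\mathbb{R})}$ with respect to Lebesgue measure ($dX=\prod_{i\le j}dx_{i,j}$ on each factor). With block Hankel matrices $\underline H_{2m}=(S_{i+j})_{i,j=0}^m$, $\overline H_{2m}=(S_{i+j+1}-S_{i+j+2})_{i,j=0}^{m-1}$, $\underline H_{2m+1}=(S_{i+j+1})_{i,j=0}^m$, $\overline H_{2m+1}=(S_{i+j}-S_{i+j+1})_{i,j=0}^m$ and block vectors $\underline h_{2m}=(S_{m+1},\dots,S_{2m})^T$, $\underline h_{2m-1}=(S_m,\dots,S_{2m-1})^T$,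 $\bar h_{2m}=(S_m-S_{m+1},\dots,S_{2m-1}-S_{2m})^T$, $\bar h_{2m-1}=(S_m-S_{m+1},\dots,S_{2m-2}-S_{2m-1})^T$, set $S_1^-=0_p$, $S_1^+=I_p$, $S_2^+=S_1$, $S^-_{n+1}=\underline h_n^T\underline H_{n-1}^{-1}\underline h_n$, $S^+_{n+1}=S_n-\bar h_n^T\overline H_{n-1}^{-1}\bar h_n$; on the interior, $S_k^-<S_k<S_k^+$ and the symmetric canonical moments are $U_k=(S_k^+-S_k^-)^{-1/2}(S_k-S_k^-)(S_k^+-S_k^-)^{-1/2}$. GOE: density $(2\pi)^{-p/2}\pi^{-p(p-1)/4}e^{-\frac12\operatorname{tr}X^2}$ with respect to $dX$. *)

(* Defs.v *)
From HB Require Import structures.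
From mathcomp Require Import all_boot all_order all_algebra.
From mathcomp Require Import all_classical all_reals all_analysis.
Set Implicit Arguments. Unset Strict Implicit. Unset Printing Implicit Defensive.
Import Order.TTheory GRing.Theory Num.Theory.
Import numFieldNormedType.Exports.
Local Open Scope classical_set_scope.
Local Open Scope ring_scope.

Section Defs.
Variable R : realType.
Variable p : nat.

Definition I01 : set (measurableTypeR R) := [set x : R | 0 <= x <= 1].

Definition psd (A : 'M[R]_p) : Prop :=
  A^T = A /\ forall v : 'rV[R]_p, 0 <= (v *m A *m v^T) 0 0.

Definition ent (A : 'M[R]_p) (i j : nat) : R :=
  match @insub _ (fun i => i < p)%N 'I_p i, @insub _ (fun i => i < p)%N 'I_p j with
  | Some i', Some j' => A i' j'
  | _, _ => 0
  end.

Definition bmx (N : nat) (F : nat -> nat -> 'M[R]_p) : 'M[R]_(N * p) :=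
  \matrix_(a, b) ent (F (a %/ p)%N (b %/ p)%N) (a %% p)%N (b %% p)%N.
Definition bcol (N : nat) (h : nat -> 'M[R]_p) : 'M[R]_(N * p, p) :=
  \matrix_(a, b) ent (h (a %/ p)%N) (a %% p)%N b.
Definition quad (N : nat) (h : nat -> 'M[R]_p) (F : nat -> nat -> 'M[R]_p)
  : 'M[R]_p := (bcol N h)^T *m invmx (bmx N F) *m bcol N h.

(** S^-_k and S^+_k for a moment sequence S (S 0 = I_p):
    S^-_{n+1} = underline h_n^T underline H_{n-1}^{-1} underline h_n,
    S^+_{n+1} = S_n - bar h_n^T bar H_{n-1}^{-1} bar h_n,
    with S^-_1 = 0, S^+_1 = I, S^+_2 = S_1. *)
Definition Sminus (S : nat -> 'M[R]_p) (k : nat) : 'M[R]_p :=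
  match k with
  | 0 | 1 => 0
  | n.+1 =>
    if odd n then
      let m := (n.+1)./2 in
      quad m (fun i => S (m + i)%N) (fun i j => S (i + j)%N)
    else
      let m := n./2 in
      quad m (fun i => S (m + 1 + i)%N) (fun i j => S (i + j + 1)%N)
  end.

Definition Splus (S : nat -> 'M[R]_p) (k : nat) : 'M[R]_p :=
  match k with
  | 0 | 1 => 1%:M
  | n.+1 =>
    if odd n then
      let m := (n.+1)./2 in
      S n - quad m.-1 (fun i => S (m + i)%N - S (m + i + 1)%N)
                      (fun i j => S (i + j + 1)%N - S (i + j + 2)%N)
    else
      let m := n./2 in
      S n - quad m (fun i => S (m + i)%N - S (m + i + 1)%N)
                   (fun i j => S (i + j)%N - S (i + j + 1)%N)
  end.

Definition msqrt (A : 'M[R]_p) : 'M[R]_p :=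
  xget 0 [set B | psd B /\ B *m B = A].

Definition canU (S : nat -> 'M[R]_p) (k : nat) : 'M[R]_p :=
  let D := Splus S k - Sminus S k in
  invmx (msqrt D) *m (S k - Sminus S k) *m invmx (msqrt D).

(** Matrix measures on [0,1]: each entry is a finite signed Borel measure,
    written as a difference mp i j - mn i j of two finite measures
    concentrated on [0,1]. *)
Definition mval (mp mn : 'I_p -> 'I_p -> {measure set (measurableTypeR R) -> \bar R})
  (B : set (measurableTypeR R)) : 'M[R]_p :=
  \matrix_(i, j) (fine (mp i j B) - fine (mn i j B)).

Definition is_matrix_measure
  (mp mn : 'I_p -> 'I_p -> {measure set (measurableTypeR R) -> \bar R}) : Prop :=
  [/\ (forall i j, mp i j setT < +oo /\ mn i j setT < +oo)%E,
      (forall i j, mp i j (~` I01) = 0 /\ mn i j (~` I01) = 0)%E,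
      (forall B, measurable B -> B `<=` I01 -> psd (mval mp mn B)) &
      mval mp mn I01 = 1%:M].

Definition mmoment
  (mp mn : 'I_p -> 'I_p -> {measure set (measurableTypeR R) -> \bar R}) (k : nat)
  : 'M[R]_p :=
  \matrix_(i, j) (fine (\int[mp i j]_(x in I01) (x ^+ k)%:E)%E
                - fine (\int[mn i j]_(x in I01) (x ^+ k)%:E)%E).

(** Coordinates of a vector of n symmetric matrices: x (l, i, j) for i <= j. *)
Definition coordT (n : nat) := ('I_n * 'I_p * 'I_p)%type.
Definition coords (n : nat) : seq (coordT n) :=
  seq.filter (fun c : coordT n => (nat_of_ord c.1.2 <= nat_of_ord c.2)%N)
    (enum [pred _ : coordT n | true]).

Definition symm (n : nat) (x : coordT n -> R) (l : 'I_n) : 'M[R]_p :=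
  \matrix_(i, j) (if (i <= j)%N then x (l, i, j) else x (l, j, i)).

Definition Sseq (n : nat) (x : coordT n -> R) (m : nat) : 'M[R]_p :=
  if m is m'.+1 then
    match @insub _ (fun i => i < n)%N 'I_n m' with
    | Some l => symm x l
    | None => 0
    end
  else 1%:M.

Definition moment_space (n : nat) : set (coordT n -> R) :=
  [set x | exists mp mn, is_matrix_measure mp mn /\
           forall l : 'I_n, symm x l = mmoment mp mn l.+1].

Definition upd (T : eqType) (x : T -> R) (a : T) (t : R) : T -> R :=
  fun b => if b == a then t else x b.

Fixpoint iint (T : eqType) (s : seq T) (g : (T -> R) -> R) (x : T -> R) : R :=
  match s with
  | [::] => g x
  | a :: s' => Rintegral (@lebesgue_measure R) setT
                 (fun t : measurableTypeR R => iint s' g (upd x a t))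
  end.

Definition lebint (n : nat) (g : (coordT n -> R) -> R) : R :=
  iint (coords n) g (fun _ => 0).

Definition unif_expect (k n : nat) (f : ('I_k -> 'M[R]_p) -> R) : R :=
  @lebint n (fun x : coordT n -> R => \1_(@moment_space n) x *
    f (fun l : 'I_k => Num.sqrt (4 * (p%:R + 1) * n%:R) *:
          (canU (@Sseq n x) l.+1 - (2^-1)%:M)))
  / @lebint n (fun x : coordT n -> R => \1_(@moment_space n) x).

Definition goe_density (X : 'M[R]_p) : R :=
  powR (2 * pi) (- (p%:R / 2)) * powR pi (- (p%:R * (p%:R - 1) / 4))
  * expR (- (\tr (X *m X)) / 2).

Definition goe_expect (k : nat) (f : ('I_k -> 'M[R]_p) -> R) : R :=
  lebint (fun x : coordT k -> R =>
    f (fun l => symm x l) * \prod_(l < k) goe_density (symm x l)).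

Definition bounded_continuous (k : nat) (f : ('I_k -> 'M[R]_p) -> R) : Prop :=
  (exists M : R, forall X : 'I_k -> 'M[R]_p, `|f X| <= M) /\
  (forall (X : 'I_k -> 'M[R]_p) (e : R), 0 < e -> exists2 d : R, 0 < d &
     forall Y : 'I_k -> 'M[R]_p, (forall l i j, `|Y l i j - X l i j| < d) -> `|f Y - f X| < e).

End Defs.

(* Main.v *)
Require Import Defs.
From HB Require Import structures.
From mathcomp Require Import all_boot all_order all_algebra.
From mathcomp Require Import all_classical all_reals all_analysis.
From mathcomp Require Import ring lra zify.
From mathcomp Require Import measurable_realfun.
From mathcomp Require complex.
Import Order.TTheory GRing.Theory Num.Theory.
Import numFieldNormedType.Exports.
Local Open Scope classical_set_scope.
Local Open Scope ring_scope.

(** The moments enter one level at a time. If S_1, ..., S_(l-1) are interior,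
    the admissible S_l fill the matrix interval from S_l^- to S_l^+, and the
    affine substitution S_l -> U_l has Jacobian det(D_l)^((p+1)/2), where
    D_l = S_l^+ - S_l^-. Schur complements of Hankel matrices give
    det D_(l+1) = det D_l * det U_l * det (1 - U_l), so the Jacobians telescope:
    under the uniform distribution the U_l are independent, U_l having density
    proportional to (det U * det (1 - U))^((p+1)(n-l)/2) on 0 < U < 1. Putting
    U = 1/2 + X / sqrt(4(p+1)n), the normalised density tends to exp(-tr X^2/2)
    and is bounded by a product of one-dimensional Gaussians, so dominated
    convergence applies to numerator and denominator of the expectation.

    Of the moment space one only needs that interior points belong to it
    (they are moments of finitely many atoms, obtained by diagonalising a pencil
    of Hankel matrices), and that its points satisfy the weak inequalities
    S_l^- <= S_l <= S_l^+; the boundary det (S_l - S_l^-) det (S_l^+ - S_l) = 0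
    is a polynomial zero set and does not contribute. *)

Set Implicit Arguments.
Unset Strict Implicit.
Unset Printing Implicit Defensive.

(** * Positive definite matrices *)

Section LinearAlgebra.
Variable R : realType.

(** The expectations are quotients of iterated one-variable Lebesgue integrals, and the indicator of
    the moment space is never shown to be measurable, so the uniform integrand cannot be reordered
    by Fubini. It is integrated in the order in which it is written; at each level it is exchanged,
    off the zeros of a polynomial, for a measurable bounded function of bounded support, and only
    such functions undergo a change of variables. Congruence by a Cholesky factor is triangular in
    suitably ordered coordinates, so one-variable affine substitutions suffice.

    The constant: for [U = 1/2 + r X], [det U det (1 - U)] is the product of [1/4 - (r d)^2] over
    the eigenvalues [d] of [X]. Its power [(p+1)(n-l)/2] behaves like a constant times
    [exp (-2 r^2 (p+1) n tr X^2)], and the exponent is [- tr X^2 / 2] exactly when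
    [r^2 = 1 / (4 (p+1) n)].

    Test functions see only the first [k] levels; the others factor out of numerator and denominator
    as the same nonzero number, so the limit concerns a fixed number of variables. *)

Definition qf n (A : 'M[R]_n) (v : 'rV[R]_n) : R := (v *m A *m v^T) 0 0.
Definition pd n (A : 'M[R]_n) : Prop := A^T = A /\ forall v, v != 0 -> 0 < qf A v.

Lemma mxBE m n (A B : 'M[R]_(m, n)) i j : (A - B) i j = A i j - B i j.
Proof. by rewrite !mxE. Qed.

Lemma row_sqr_ge0 n (v : 'rV[R]_n) : 0 <= (v *m v^T) 0 0.
Proof. by rewrite mxE sumr_ge0 // => i _; rewrite mxE -expr2 sqr_ge0. Qed.

Lemma row_sqr_eq0 n (v : 'rV[R]_n) : (v *m v^T) 0 0 = 0 -> v = 0.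
Proof.
rewrite mxE => /eqP; rewrite psumr_eq0 => [/allP h|i _]; last by rewrite mxE -expr2 sqr_ge0.
apply/rowP => i; have := h i (mem_index_enum i).
by rewrite /= mxE -expr2 sqrf_eq0 mxE => /eqP.
Qed.

Lemma row_sqr_gt0 n (v : 'rV[R]_n) : v != 0 -> 0 < (v *m v^T) 0 0.
Proof.
by move=> v0; rewrite lt_neqAle row_sqr_ge0 andbT eq_sym; apply: contra v0 => /eqP/row_sqr_eq0 ->.
Qed.

Lemma mx11_tr (A : 'M[R]_1) : A^T = A.
Proof. by apply/matrixP => i j; rewrite mxE !ord1. Qed.

End LinearAlgebra.

Module RealEigenvector.
Import complex.
Section RealEigenvector.
Variable R : realType.

(** An eigenvalue exists over the complex numbers. Symmetry makes it real, and then the real or the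
    imaginary part of the eigenvector, whichever is nonzero, is a real eigenvector. *)
Lemma real_symmetric_eigenvector n (A : 'M[R]_n.+1) : A^T = A ->
  exists a, exists2 v : 'rV[R]_n.+1, v != 0 & v *m A = a *: v.
Proof.
move=> sA; pose f := complex.real_complex R.
have [a /eigenvalueP [v vA v0]] := @eigenvalue_closed (complex.complex R) n.+1 (map_mx f A) isT.
pose u := map_mx (@complex.Re R) v; pose w := map_mx (@complex.Im R) v.
have Af i j : (map_mx f A) i j = complex.Complex (A i j) 0 by rewrite mxE.
have reS (I : finType) (F : I -> complex.complex R) :
    complex.Re (\sum_i F i) = \sum_i complex.Re (F i).
  by apply: (big_morph (@complex.Re R)) => // -[? ?] [].
have imS (I : finType) (F : I -> complex.complex R) :
    complex.Im (\sum_i F i) = \sum_i complex.Im (F i).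
  by apply: (big_morph (@complex.Im R)) => // -[? ?] [].
have uA : u *m A = complex.Re a *: u - complex.Im a *: w.
  apply/rowP => j; have /rowP/(_ j)/(congr1 (@complex.Re R)) := vA.
  rewrite !mxE reS; case: (a) => x y; case: (v 0 j) => p q /= <-.
  by apply: eq_bigr => i _; rewrite mxE Af; case: (v 0 i) => s t /=; ring.
have wA : w *m A = complex.Re a *: w + complex.Im a *: u.
  apply/rowP => j; have /rowP/(_ j)/(congr1 (@complex.Im R)) := vA.
  rewrite !mxE imS; case: (a) => x y; case: (v 0 j) => p q /= <-.
  by apply: eq_bigr => i _; rewrite mxE Af; case: (v 0 i) => s t /=; ring.
have uw0 : (u != 0) || (w != 0).
  rewrite -negb_and; apply: contra v0 => /andP[/eqP u0 /eqP w0].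
  apply/eqP/rowP => i; move/rowP/(_ i): u0; move/rowP/(_ i): w0; rewrite !mxE.
  by case: (v 0 i) => x y /= -> ->.
have e : u *m A *m w^T = (w *m A *m u^T).
  by rewrite -[RHS]mx11_tr !trmx_mul trmxK sA mulmxA.
(* Substituting [uA] and [wA] in [e] leaves [Im a] times the sum of the squared norms of [u] and
   [w], which is positive. *)
have ia0 : complex.Im a = 0.
  have wu : (w *m u^T) 0 0 = (u *m w^T) 0 0.
    by rewrite -[in RHS](mx11_tr (u *m w^T)) trmx_mul trmxK.
  have : complex.Im a * ((u *m u^T) 0 0 + (w *m w^T) 0 0) = 0.
    move: e wu; rewrite uA wA !mulmxDl !mulNmx -!scalemxAl.
    move: (u *m w^T) (w *m w^T) (u *m u^T) (w *m u^T) => X Y Z T /matrixP/(_ 0 0).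
    by rewrite !mxE => e wu; rewrite wu in e; lra.
  move/eqP; rewrite mulf_eq0 => /orP[/eqP //|/eqP uw].
  have := row_sqr_ge0 u; have := row_sqr_ge0 w => w_ge u_ge.
  by case/orP: uw0 => /row_sqr_gt0 h; lra.
exists (complex.Re a); case/orP: uw0 => h.
  by exists u => //; rewrite uA ia0 scale0r subr0.
by exists w => //; rewrite wA ia0 scale0r addr0.
Qed.

End RealEigenvector.
End RealEigenvector.

Section LinearAlgebra.
Variable R : realType.

(** [H] is the reflection in the hyperplane orthogonal to [v - e]; it exchanges the unit vectors [v]
    and [e]. For [v = e] this vector vanishes and the identity is taken. *)
Lemma householder n (v : 'rV[R]_n.+1) : (v *m v^T) 0 0 = 1 ->
  exists H : 'M[R]_n.+1, [/\ H^T = H, H *m H = 1%:M & delta_mx 0 0 *m H = v].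
Proof.
move=> v1; pose e : 'rV[R]_n.+1 := delta_mx 0 0.
have [->|ve] := eqVneq v e.
  by exists 1%:M; rewrite trmx1 !mulmx1.
pose w := v - e; have w0 : w != 0 by rewrite subr_eq0.
pose c := (w *m w^T) 0 0.
have c0 : c != 0 by rewrite gt_eqF // row_sqr_gt0.
have ww : w *m w^T = c%:M by rewrite [LHS]mx11_scalar.
pose H := 1%:M - (2 / c) *: (w^T *m w); exists H; split.
- by rewrite /H linearB /= linearZ /= trmx_mul trmxK trmx1.
- have WW : (w^T *m w) *m (w^T *m w) = c *: (w^T *m w).
    by rewrite mulmxA -(mulmxA w^T) ww mul_mx_scalar -scalemxAl.
  rewrite /H; move: (w^T *m w) WW => W WW.
  rewrite mulmxBl mul1mx [_ *m (_ - _)]mulmxBr mulmx1 -scalemxAl -scalemxAr WW !scalerA.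
  by rewrite opprB (_ : 2 / c * _ * c = 2 / c + 2 / c); [rewrite scalerDl addrK subrK | field].
- have ee : (e *m e^T) 0 0 = 1 by rewrite trmx_delta mul_delta_mx mxE.
  have ew : (e *m w^T) 0 0 = (v *m e^T) 0 0 - 1.
    by rewrite /w linearB /= mulmxBr mxBE ee -[e *m v^T]mx11_tr trmx_mul trmxK.
  have cE : c = 2 - 2 * (v *m e^T) 0 0.
    have ev : (e *m v^T) 0 0 = (v *m e^T) 0 0.
      by rewrite -[e *m v^T]mx11_tr trmx_mul trmxK.
    by rewrite /c /w linearB /= mulmxBr !mulmxBl !mxBE ev v1 ee; ring.
  rewrite /H mulmxBr mulmx1 -scalemxAr mulmxA [_ *m w^T]mx11_scalar -/e ew.
  rewrite mul_scalar_mx scalerA (_ : 2 / c * _ = -1).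
    by rewrite scaleN1r opprK /w addrC subrK.
  have -> : (v *m e^T) 0 0 - 1 = - (c / 2) by rewrite cE; field.
  by field.
Qed.

(** Deflation: a reflection moves a unit eigenvector to the first basis vector; the first row of the
    conjugated matrix is then [a] times that vector, and by symmetry the matrix splits into [a] and
    a smaller symmetric block. *)
Theorem real_spectral n (A : 'M[R]_n) : A^T = A ->
  exists (Q : 'M[R]_n) (d : 'rV[R]_n), Q *m Q^T = 1%:M /\ A = Q^T *m diag_mx d *m Q.
Proof.
elim: n A => [|n IH] A sA.
  by exists 1%:M, 0; split; apply/matrixP => -[].
have [a [v0 v0n0 v0A]] := RealEigenvector.real_symmetric_eigenvector sA.
pose c := (v0 *m v0^T) 0 0; have c0 : 0 < c by apply: row_sqr_gt0.
pose v := (Num.sqrt c)^-1 *: v0.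
have v1 : (v *m v^T) 0 0 = 1.
  rewrite /v linearZ /= -scalemxAl -scalemxAr scalerA mxE -/c -invfM -expr2 sqr_sqrtr ?ltW //.
  by rewrite mulVf // gt_eqF.
have vA : v *m A = a *: v by rewrite /v -scalemxAl v0A !scalerA mulrC.
have [H [sH HH eH]] := householder v1.
(* The existential hides the body of [B] and gives it a type on which block operations apply. *)
have [B BE0] : exists B : 'M[R]_(1 + n), B = H *m A *m H by exists (H *m A *m H).
have sB : B^T = B by rewrite BE0 !trmx_mul sH sA mulmxA.
have rB : delta_mx 0 0 *m B = a *: delta_mx (0 : 'I_1) 0.
  by rewrite BE0 !mulmxA eH vA -scalemxAl -eH -mulmxA HH mulmx1.
have B0 j : B 0 j = a * (j == 0)%:R.
  by move/rowP/(_ j): rB; rewrite -rowE !mxE.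
have uB : ulsubmx B = a%:M.
  apply/matrixP => i j; rewrite !mxE !ord1 (_ : lshift n 0 = 0); last exact: val_inj.
  by rewrite B0 eqxx mulr1.
have urB : ursubmx B = 0.
  apply/matrixP => i j; rewrite !mxE !ord1 (_ : lshift n 0 = 0); last exact: val_inj.
  by rewrite B0 mulr0.
have dlB : dlsubmx B = 0 by rewrite -[B]sB -trmx_ursub urB trmx0.
have sD : (drsubmx B)^T = drsubmx B by rewrite trmx_drsub sB.
have [Q [d [QQ BE]]] := IH _ sD.
pose P : 'M[R]_(1 + n) := block_mx 1%:M 0 0 Q.
have PP : P *m P^T = 1%:M.
  rewrite /P tr_block_mx mulmx_block.
  by rewrite !trmx0 !trmx1 !mul0mx !mulmx0 !addr0 !add0r mulmx1 QQ -scalar_mx_block.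
have PB : B = P^T *m diag_mx (row_mx a%:M d) *m P.
  rewrite -[LHS]submxK uB urB dlB BE /P tr_block_mx diag_mx_row !mulmx_block.
  rewrite !trmx0 !trmx1 !mul0mx !mulmx0 !addr0 !add0r !mulmx1 !mul1mx !mul0mx.
  by congr (block_mx _ 0 0 _); apply/matrixP => i j; rewrite !mxE !ord1 eqxx !mulr1n.
exists (P *m H), (row_mx a%:M d); split.
  by rewrite trmx_mul sH mulmxA -(mulmxA P) HH mulmx1; exact: PP.
have -> : A = H *m B *m H by rewrite BE0 !mulmxA HH mul1mx -mulmxA HH mulmx1.
by rewrite PB trmx_mul sH !mulmxA.
Qed.

Lemma qf_diag n (d : 'rV[R]_n) (v : 'rV[R]_n) : qf (diag_mx d) v = \sum_i d 0 i * v 0 i ^+ 2.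
Proof. by rewrite /qf mxE; apply: eq_bigr => i _; rewrite mul_mx_diag !mxE mulrAC mulrC expr2. Qed.

Lemma qf_congr n m (A : 'M[R]_n) (M : 'M[R]_(m, n)) v : qf (M *m A *m M^T) v = qf A (v *m M).
Proof. by rewrite /qf trmx_mul !mulmxA. Qed.

Lemma qf_congrT n m (A : 'M[R]_n) (M : 'M[R]_(n, m)) v : qf (M^T *m A *m M) v = qf A (v *m M^T).
Proof. by rewrite -{2}[M]trmxK qf_congr. Qed.

Lemma qfD n (A B : 'M[R]_n) v : qf (A + B) v = qf A v + qf B v.
Proof. by rewrite /qf mulmxDr mulmxDl mxE. Qed.

Lemma psd_congr n m (A : 'M[R]_n) (M : 'M[R]_(m, n)) : psd A -> psd (M *m A *m M^T).
Proof.
move=> [sA pA]; split; first by rewrite !trmx_mul trmxK sA mulmxA.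
by move=> v; rewrite -/(qf _ _) qf_congr; exact: pA.
Qed.

Lemma pd_congr n m (A : 'M[R]_n) (M : 'M[R]_(m, n)) : pd A -> row_free M -> pd (M *m A *m M^T).
Proof.
move=> [sA pA] fM; split; first by rewrite !trmx_mul trmxK sA mulmxA.
move=> v v0; rewrite qf_congr; apply: pA; apply: contra v0.
by rewrite mulmx_free_eq0.
Qed.

Lemma psd_congrT n m (A : 'M[R]_n) (M : 'M[R]_(n, m)) : psd A -> psd (M^T *m A *m M).
Proof. by rewrite -{2}[M]trmxK; exact: psd_congr. Qed.

Lemma pd_psd n (A : 'M[R]_n) : pd A -> psd A.
Proof.
move=> [sA pA]; split=> // v; have [->|/pA /ltW //] := eqVneq v 0.
by rewrite !mul0mx mxE.
Qed.

Lemma pd_unit n (A : 'M[R]_n) : pd A -> A \in unitmx.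
Proof.
move=> [_ pA]; rewrite -row_free_unit -kermx_eq0; apply/eqP/row_matrixP => i.
rewrite row0; apply/eqP; apply: contraT => /pA; rewrite /qf.
by have /sub_kermxP -> := row_sub i (kermx A); rewrite mul0mx mxE ltxx.
Qed.

Lemma psd_sqrt n (A : 'M[R]_n) : psd A -> exists B, psd B /\ B *m B = A.
Proof.
move=> [sA pA]; have [Q [d [QQ AE]]] := real_spectral sA.
have QQ' : Q^T *m Q = 1%:M by apply: mulmx1C.
have d0 i : 0 <= d 0 i.
  have := pA (delta_mx 0 i *m Q); rewrite -/(qf _ _) AE qf_congrT.
  rewrite -mulmxA QQ mulmx1 qf_diag (bigD1 i) //= big1 => [|j ji].
    by rewrite mxE !eqxx expr1n mulr1 addr0.
  by rewrite mxE eqxx (negPf ji) expr0n mulr0.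
pose B := Q^T *m diag_mx (\row_i Num.sqrt (d 0 i)) *m Q; exists B; split.
  apply: psd_congrT; split.
    by rewrite tr_diag_mx.
  move=> v; rewrite -/(qf _ _) qf_diag sumr_ge0 // => i _.
  by rewrite mulr_ge0 ?sqr_ge0 // mxE sqrtr_ge0.
rewrite /B AE !mulmxA -(mulmxA _ Q) QQ mulmx1 -(mulmxA Q^T) mulmx_diag.
by congr (_ *m diag_mx _ *m _); apply/rowP => i; rewrite !mxE -expr2 sqr_sqrtr.
Qed.

(** With [B] a square root of [A], the form at [v] is the squared norm of [v *m B]; its vanishing
    would give [v *m A = 0]. *)
Lemma psd_unit_pd n (A : 'M[R]_n) : psd A -> A \in unitmx -> pd A.
Proof.
move=> pA uA; split; first by case: pA.
have [B [[sB _] AE]] := psd_sqrt pA.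
move=> v v0; rewrite /qf -AE -{2}sB !mulmxA -mulmxA -trmx_mul row_sqr_gt0 //.
apply: contra v0 => /eqP vB; rewrite -(mulmxK uA v) -AE mulmxA vB.
by rewrite !mul0mx.
Qed.

Lemma psd_det_ge0 n (A : 'M[R]_n) : psd A -> 0 <= \det A.
Proof. by move=> /psd_sqrt [B [_ <-]]; rewrite det_mulmx -expr2 sqr_ge0. Qed.

Lemma pd_det n (A : 'M[R]_n) : pd A -> 0 < \det A.
Proof.
move=> pA; rewrite lt_neqAle psd_det_ge0 ?andbT; last exact: pd_psd.
by have := pd_unit pA; rewrite unitmxE unitfE eq_sym.
Qed.

Lemma psd_det_pd n (A : 'M[R]_n) : psd A -> \det A != 0 -> pd A.
Proof. by move=> pA dA; apply: psd_unit_pd => //; rewrite unitmxE unitfE. Qed.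

Lemma pdD n (A B : 'M[R]_n) : pd A -> psd B -> pd (A + B).
Proof.
move=> [sA pA] [sB pB]; split; first by rewrite linearD /= sA sB.
by move=> v v0; rewrite qfD ltr_wpDr ?pB ?pA.
Qed.

Lemma pd1 n : pd (1%:M : 'M[R]_n).
Proof. by split; [rewrite trmx1|move=> v v0; rewrite /qf mulmx1 row_sqr_gt0]. Qed.

Lemma pdZ n (c : R) (A : 'M[R]_n) : 0 < c -> pd A -> pd (c *: A).
Proof.
move=> c0 [sA pA]; split; first by rewrite linearZ /= sA.
by move=> v v0; rewrite /qf -scalemxAr -scalemxAl mxE mulr_gt0 // pA.
Qed.

(** * Schur complements *)

Section Schur.
Variables (n m : nat) (A : 'M[R]_n) (h : 'M[R]_(n, m)) (S : 'M[R]_m).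
Hypothesis uA : A \in unitmx.
Hypothesis sA : A^T = A.
Let T := S - h^T *m invmx A *m h.
Let U : 'M[R]_(n + m) := block_mx 1%:M 0 (h^T *m invmx A) 1%:M.

(** Block elimination by the unipotent [U]: determinant, semidefiniteness and definiteness of the
    block matrix are all read off from [A] and [T]. *)
Lemma schur_decomp : block_mx A h h^T S = U *m block_mx A 0 0 T *m U^T.
Proof.
rewrite /U /T tr_block_mx !mulmx_block !trmx0 !trmx1 !mul0mx !mulmx0 !mul1mx !mulmx1.
rewrite !addr0 !add0r trmx_mul trmxK trmx_inv sA !mulmxA mulmxKV // mulmxV // mul1mx.
by rewrite addrC subrK.
Qed.

Lemma schur_unit : U \in unitmx.
Proof. by rewrite unitmxE det_lblock !det1 mul1r unitr1. Qed.

Lemma det_schur : \det (block_mx A h h^T S) = \det A * \det T.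
Proof. by rewrite schur_decomp !det_mulmx det_tr !det_lblock !det1 !mul1r mulr1. Qed.

Lemma qf_block0 (B : 'M[R]_n) (C : 'M[R]_m) (v : 'rV[R]_(n + m)) :
  qf (block_mx B 0 0 C) v = qf B (lsubmx v) + qf C (rsubmx v).
Proof.
rewrite /qf -{1 2}[v]hsubmxK mul_row_block !mulmx0 addr0 add0r tr_row_mx mul_row_col.
by rewrite mxE.
Qed.

Lemma psd_schur : psd (block_mx A h h^T S) -> psd T.
Proof.
move=> pB; have : psd (block_mx A 0 0 T).
  have -> : block_mx A 0 0 T = invmx U *m block_mx A h h^T S *m (invmx U)^T.
    rewrite schur_decomp !mulmxA mulVmx ?schur_unit // mul1mx -!mulmxA -trmx_mul.
    by rewrite mulVmx ?schur_unit // trmx1 mulmx1.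
  exact: psd_congr.
move=> [+ pT]; rewrite tr_block_mx !trmx0 => /eq_block_mx [_ _ _ sT]; split=> // v.
have := pT (row_mx 0 v); rewrite -!/(qf _ _) qf_block0 row_mxKl row_mxKr.
by rewrite {1}/qf !mul0mx mxE add0r.
Qed.

Lemma pd_schurP : pd A -> pd T -> pd (block_mx A h h^T S).
Proof.
move=> pA pT; rewrite schur_decomp; apply: pd_congr; last by rewrite row_free_unit schur_unit.
split; first by rewrite tr_block_mx !trmx0 sA pT.1.
move=> v v0; rewrite qf_block0.
have [l0|/pA.2 l0] := eqVneq (lsubmx v) 0.
  have r0 : rsubmx v != 0.
    apply: contra v0 => /eqP r0; rewrite -[v]hsubmxK l0 r0.
    by apply/eqP; rewrite row_mx0.
  by rewrite l0 {1}/qf !mul0mx mxE add0r pT.2.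
have [->|/pT.2 /ltW r0] := eqVneq (rsubmx v) 0.
  by rewrite {2}/qf !mul0mx mxE addr0.
by rewrite ltr_wpDr.
Qed.

End Schur.

(** Induction on the Schur complement of the top left entry: it is [psd], and its determinant is
    nonzero because it divides that of the whole matrix, so it is [pd]. *)
Lemma cholesky n (A : 'M[R]_n) : pd A ->
  exists2 L : 'M[R]_n, is_trig_mx L & A = L *m L^T.
Proof.
elim: n A => [|n IH] A pA.
  by exists 1%:M; [apply/is_trig_mxP => -[]|apply/matrixP => -[]].
pose B : 'M[R]_(1 + n) := A.
have sB : B^T = B := pA.1.
have a0 : 0 < B 0 0.
  have := pA.2 (delta_mx 0 0); rewrite /qf -rowE trmx_delta -colE !mxE; apply.
  by apply/eqP => /rowP/(_ 0)/eqP; rewrite !mxE eqxx oner_eq0.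
set a := B 0 0 in a0.
have ulB : ulsubmx B = a%:M.
  by apply/matrixP => i j; rewrite !mxE !ord1 (_ : lshift n 0 = 0) //; exact: val_inj.
have dlB : dlsubmx B = (ursubmx B)^T by rewrite trmx_ursub sB.
have uA : (a%:M : 'M[R]_1) \in unitmx by rewrite unitmxE det_scalar expr1 unitfE gt_eqF.
set h := ursubmx B in dlB *.
pose r := Num.sqrt a; have r0 : r != 0 by rewrite gt_eqF // sqrtr_gt0.
have BE : B = block_mx a%:M h h^T (drsubmx B) by rewrite -[LHS]submxK ulB dlB.
set D := drsubmx B in BE.
have pD : pd (D - h^T *m invmx (a%:M) *m h).
  apply: psd_det_pd.
    apply: psd_schur => //; first by rewrite tr_scalar_mx.
    by rewrite -BE; exact: pd_psd.
  have : 0 < \det B := pd_det pA.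
  rewrite BE det_schur ?tr_scalar_mx //.
  by move=> /gt_eqF/negbT; rewrite mulf_eq0 negb_or => /andP[].
have [L Lt LE] := IH _ pD.
exists (block_mx r%:M 0 (r^-1 *: h^T) L : 'M[R]_(1 + n)).
  have ut (i j : 'I_(1 + n)) : (i < j)%N -> block_mx r%:M 0 (r^-1 *: h^T) L i j = 0.
    case: (split_ordP i) => i' ->; case: (split_ordP j) => j' ->; rewrite ?ord1 //=.
    - by move=> _; rewrite block_mxEur mxE.
    - by rewrite !add1n ltnS => ij; rewrite block_mxEdr (is_trig_mxP Lt).
  by apply/is_trig_mxP => i j; exact: ut.
suff : B = block_mx r%:M 0 (r^-1 *: h^T) L *m (block_mx r%:M 0 (r^-1 *: h^T) L)^T by [].
rewrite BE tr_block_mx mulmx_block !trmx0 !mul0mx !mulmx0 !addr0 -LE.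
rewrite !linearZ /= trmxK tr_scalar_mx -scalar_mxM -expr2 sqr_sqrtr ?ltW //.
rewrite invmx_scalar !mul_scalar_mx !mul_mx_scalar -!scalemxAl !scalerA mulVf // mulfV // !scale1r.
by rewrite -invfM -expr2 sqr_sqrtr ?ltW // addrC subrK.
Qed.

End LinearAlgebra.

(** * Hankel matrices and the gaps between extremal moments *)

Section AbstractHankel.
Variable R : realType.

Lemma pd_block_swap n m (A : 'M[R]_n) (X : 'M[R]_(n, m)) (B : 'M[R]_m) :
  pd (block_mx A X X^T B) ->
  pd (block_mx B X^T X A) /\ \det (block_mx B X^T X A) = \det (block_mx A X X^T B).
Proof.
move=> pM; pose U : 'M[R]_(m + n, n + m) := block_mx 0 1%:M 1%:M 0.
have E : block_mx B X^T X A = U *m block_mx A X X^T B *m U^T.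
  rewrite /U tr_block_mx !mulmx_block !trmx0 !trmx1 !mul0mx !mulmx0 !mul1mx !mulmx1.
  by rewrite !addr0 !add0r.
split.
  rewrite E; apply: pd_congr => //; apply/row_freeP; exists U^T.
  rewrite /U tr_block_mx mulmx_block !trmx0 !trmx1 !mulmx1 !mulmx0 !addr0 !add0r.
  by rewrite -scalar_mx_block.
have uM := pd_unit pM.
have [uA pA] : A \in unitmx /\ pd A.
  have pA : pd A.
    split; first by have := pM.1; rewrite tr_block_mx => /eq_block_mx [].
    move=> v v0; have := pM.2 (row_mx v 0); rewrite /qf mul_row_block !mul0mx !addr0.
    rewrite tr_row_mx mul_row_col trmx0 mulmx0 addr0; apply.
    by apply: contra v0 => /eqP; rewrite -row_mx0 => /eq_row_mx [->].
  by split=> //; exact: pd_unit.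
pose V : 'M[R]_(n + m) := block_mx 1%:M 0 (- (X^T *m invmx A)) 1%:M.
pose V' : 'M[R]_(m + n) := block_mx 1%:M (- (X^T *m invmx A)) 0 1%:M.
have dV : \det V = 1 by rewrite det_lblock !det1 mulr1.
have dV' : \det V' = 1 by rewrite det_ublock !det1 mulr1.
have -> : \det (block_mx B X^T X A) = \det (V' *m block_mx B X^T X A).
  by rewrite det_mulmx dV' mul1r.
have -> : \det (block_mx A X X^T B) = \det (V *m block_mx A X X^T B).
  by rewrite det_mulmx dV mul1r.
rewrite /V /V' !mulmx_block !mul0mx !mul1mx !addr0 !add0r !mulNmx -!mulmxA mulVmx // mulmx1.
by rewrite addNr subrr det_lblock det_ublock mulrC addrC.
Qed.

(** The block matrix with rows [A, W^T] and [W, B'^-1] has two Schur complements: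
    [A - W^T B' W = A - B], and [B'^-1 - W A^-1 W^T], which the shift relation [A P1 = B P0] turns
    into [B'^-1 C B'^-1]. Equating the two values of its determinant gives the identity. *)
Lemma hankel_gap_odd N q (A B : 'M[R]_(N + q)) (B' C : 'M[R]_N) (Z : 'M[R]_(N, q))
    (P1 : 'M[R]_(N + q, N)) (W := row_mx 1%:M Z) (P0 := col_mx 1%:M 0) :
  pd A -> pd B' -> pd C -> B = W^T *m B' *m W -> A *m P1 = B *m P0 ->
  C = P0^T *m B *m (P0 - P1) ->
  pd (A - B) /\ \det (A - B) * \det B' = \det A * \det C.
Proof.
move=> pA pB' pC BE AP CE.
have uA := pd_unit pA; have uB' := pd_unit pB'.
have WP : W *m P0 = 1%:M by rewrite /W /P0 mul_row_col mulmx0 addr0 mulmx1.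
have BP0 : B *m P0 = W^T *m B' by rewrite BE -mulmxA WP mulmx1.
have P0B : P0^T *m B = B' *m W by rewrite BE !mulmxA -trmx_mul WP trmx1 mul1mx.
have P1E : invmx A *m W^T = P1 *m invmx B'.
  by rewrite -[LHS](mulmxK uB') -(mulmxA _ _ B') -BP0 -AP mulKmx.
pose I := invmx B'.
have uI : I \in unitmx by rewrite unitmx_inv.
have sI : I^T = I by rewrite /I trmx_inv pB'.1.
have TE : I - W *m invmx A *m W^T = I *m C *m I.
  rewrite -mulmxA P1E CE P0B mulmxBr -(mulmxA B') WP mulmx1 -!(mulmxA B') mulmxBr.
  by rewrite mulVmx // mulKmx // mulmxBl mul1mx mulmxA.
have pM : pd (block_mx A W^T W I).
  rewrite -{2}[W]trmxK; apply: pd_schurP; rewrite ?pA.1 // trmxK TE -{2}sI.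
  by apply: pd_congr => //; rewrite row_free_unit.
have pM2 : pd (block_mx A W^T W^T^T I) by rewrite trmxK.
have [pM' dM'] := pd_block_swap pM2.
rewrite trmxK in pM' dM'.
have Ik : invmx I = B' by rewrite invmxK.
have dAB : \det I * \det (A - B) = \det A * \det (I *m C *m I).
  have := @det_schur R _ _ A W^T I uA pA.1; rewrite trmxK TE -dM' => <-.
  by rewrite det_schur // Ik BE.
have dB'0 : \det B' != 0 by rewrite -unitfE -unitmxE.
have dE : \det (A - B) * \det B' = \det A * \det C.
  move: dAB; rewrite !det_mulmx /I det_inv => /(congr1 (fun x => x * \det B' ^+ 2)).
  have -> : (\det B')^-1 * \det (A - B) * \det B' ^+ 2 = \det (A - B) * \det B' by field.
  by move=> ->; field.
split=> //; apply: psd_det_pd.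
  have := @psd_schur R _ _ I W A uI sI; rewrite Ik -BE; apply.
  exact: pd_psd.
apply/eqP => d0; move: dE; rewrite d0 mul0r => /esym/eqP.
by rewrite gt_eqF // mulr_gt0 // pd_det.
Qed.

(** [C = B A^-1 (A - B)] gives the determinant. For positivity, [C] is the Schur complement of [A]
    in the block matrix with rows [A, B] and [B, B], which is congruent to the block diagonal of
    [A - B] and [B]. *)
Lemma hankel_gap_even N (A B : 'M[R]_N) (C := B - B *m invmx A *m B) :
  pd A -> pd B -> pd (A - B) -> pd C /\ \det C * \det A = \det B * \det (A - B).
Proof.
move=> pA pB pF; have uA := pd_unit pA.
have CE : C = B *m invmx A *m (A - B) by rewrite mulmxBr mulmxKV.
have dA0 : \det A != 0 by rewrite -unitfE -unitmxE.
have dE : \det C * \det A = \det B * \det (A - B).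
  by rewrite CE !det_mulmx det_inv; field.
split=> //; apply: psd_det_pd.
  have := @psd_schur R _ _ A B B uA pA.1; rewrite pB.1; apply.
  pose U : 'M[R]_(N + N) := block_mx 1%:M 1%:M 0 1%:M.
  have -> : block_mx A B B B = U *m block_mx (A - B) 0 0 B *m U^T.
    rewrite /U tr_block_mx !mulmx_block !trmx0 !trmx1 !mul0mx !mulmx0 !mul1mx !mulmx1.
    by rewrite !addr0 !add0r subrK.
  apply: psd_congr; apply: pd_psd; rewrite -{2}[0]trmx0.
  have -> : B = B - (0 : 'M[R]_N)^T *m invmx (A - B) *m 0 by rewrite mulmx0 subr0.
  rewrite mulmx0 subr0; apply: pd_schurP; rewrite ?pF.1 ?pd_unit //.
  by rewrite mulmx0 subr0.
apply/eqP => d0; move: dE; rewrite d0 mul0r => /esym/eqP.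
by rewrite gt_eqF // mulr_gt0 // pd_det.
Qed.

End AbstractHankel.

Section Hankel.
Variables (R : realType) (p : nat).
Hypothesis p0 : (0 < p)%N.
Implicit Types G S : nat -> 'M[R]_p.

(** The size counts scalar rows, not blocks, so that [N * p + p] fits block decompositions while
    [mulSnr] converts it to [N.+1 * p]. *)
Definition hk (n : nat) G : 'M[R]_n :=
  \matrix_(a, b) ent (G (a %/ p + b %/ p)%N) (a %% p)%N (b %% p)%N.
Definition hcol (N : nat) G : 'M[R]_(N * p, p) := bcol N (fun i => G (N + i)%N).
Definition schurH (N : nat) G : 'M[R]_p :=
  G (N + N)%N - quad N (fun i => G (N + i)%N) (fun i j => G (i + j)%N).

Lemma entE (A : 'M[R]_p) (i j : 'I_p) : ent A i j = A i j.
Proof. by rewrite /ent !valK. Qed.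

Lemma ent_tr (A : 'M[R]_p) i j : ent A^T i j = ent A j i.
Proof.
rewrite /ent; case: (@insub nat (fun i => (i < p)%N) 'I_p i) => [i'|]; case: (@insub nat (fun i => (i < p)%N) 'I_p j) => [j'|] //.
by rewrite mxE.
Qed.

Lemma entB (A B : 'M[R]_p) i j : ent (A - B) i j = ent A i j - ent B i j.
Proof.
rewrite /ent; case: (@insub nat (fun i => (i < p)%N) 'I_p i) => [i'|]; case: (@insub nat (fun i => (i < p)%N) 'I_p j) => [j'|]; rewrite ?subr0 //.
by rewrite !mxE.
Qed.

Lemma bmx_hk N G : bmx N (fun i j => G (i + j)%N) = hk (N * p) G.
Proof. by []. Qed.

Lemma schurHE N G : schurH N G = G (N + N)%N - (hcol N G)^T *m invmx (hk (N * p) G) *m hcol N G.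
Proof. by []. Qed.

Lemma hk_sym n G : (forall k, (G k)^T = G k) -> (hk n G)^T = hk n G.
Proof.
by move=> sG; apply/matrixP => a b; rewrite !mxE -ent_tr sG addnC.
Qed.

Lemma hkB n G G' : hk n (fun k => G k - G' k) = hk n G - hk n G'.
Proof. by apply/matrixP => a b; rewrite !mxE entB. Qed.

Lemma eq_hk n G G' : (forall a b : 'I_n, G (a %/ p + b %/ p)%N = G' (a %/ p + b %/ p)%N) ->
  hk n G = hk n G'.
Proof. by move=> e; apply/matrixP => a b; rewrite !mxE e. Qed.

Lemma eq_hkS N G G' : (forall k, (k <= N + N)%N -> G k = G' k) ->
  hk (N * p + p) G = hk (N * p + p) G'.
Proof.
move=> e; apply: eq_hk => a b; apply: e.
have lt (c : 'I_(N * p + p)) : (c %/ p <= N)%N.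
  by rewrite -ltnS ltn_divLR // mulSnr.
exact: leq_add.
Qed.

Lemma hk_block N G : (forall k, (G k)^T = G k) ->
  hk (N * p + p) G = block_mx (hk (N * p) G) (hcol N G) (hcol N G)^T (G (N + N)%N).
Proof.
have rd (i : 'I_p) : ((N * p + i) %/ p = N)%N by rewrite divnMDl // divn_small ?addn0.
have rm (i : 'I_p) : ((N * p + i) %% p = i)%N by rewrite modnMDl modn_small.
move=> sG; apply/matrixP => a b.
case: (split_ordP a) => i ->; case: (split_ordP b) => j ->;
  rewrite ?block_mxEul ?block_mxEur ?block_mxEdl ?block_mxEdr !mxE //= ?rd ?rm.
- by rewrite addnC.
- by rewrite -ent_tr sG.
- by rewrite entE.
Qed.

Lemma hk_pd_schur N G : (forall k, (G k)^T = G k) -> pd (hk (N * p) G) ->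
  pd (schurH N G) -> pd (hk (N.+1 * p) G).
Proof.
move=> sG pH pS; rewrite mulSnr hk_block //; apply: pd_schurP => //.
  exact: pd_unit.
exact: hk_sym.
Qed.

Lemma hk_det_schur N G : (forall k, (G k)^T = G k) -> pd (hk (N * p) G) ->
  \det (hk (N.+1 * p) G) = \det (hk (N * p) G) * \det (schurH N G).
Proof. by move=> sG pH; rewrite mulSnr hk_block // det_schur //; [exact: pd_unit | exact: hk_sym]. Qed.

Lemma hk_psd_schur N G : (forall k, (G k)^T = G k) -> pd (hk (N * p) G) ->
  psd (hk (N.+1 * p) G) -> psd (schurH N G).
Proof. by move=> sG pH; rewrite mulSnr hk_block //; apply: psd_schur; [exact: pd_unit | exact: hk_sym]. Qed.

Lemma pd_schurH N G : (forall k, (G k)^T = G k) -> pd (hk (N * p) G) ->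
  pd (hk (N.+1 * p) G) -> pd (schurH N G).
Proof.
move=> sG pH pH'; apply: psd_det_pd; first exact/hk_psd_schur/pd_psd.
have := pd_det pH'; rewrite hk_det_schur // => /gt_eqF/negbT.
by rewrite mulf_eq0 negb_or => /andP[].
Qed.

Lemma pd_hk0 G : pd (hk (0 * p) G).
Proof.
split; first by apply/matrixP => -[].
by move=> v /eqP []; apply/rowP => -[].
Qed.

(** If [S] is the moment sequence of a measure [mu], these three are the moment sequences of [x mu],
    [(1 - x) mu] and [x (1 - x) mu]. *)
Definition shS S k := S k.+1.
Definition dfS S k := S k - S k.+1.
Definition dshS S k := S k.+1 - S k.+2.

Lemma quad0 (h : nat -> 'M[R]_p) F : quad 0 h F = 0.
Proof.
by rewrite /quad; apply/matrixP => i j; rewrite !mxE big1 // => -[].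
Qed.

Lemma eq_quad N (h h' : nat -> 'M[R]_p) F F' :
  (forall i, (i < N)%N -> h i = h' i) -> (forall i j, (i < N)%N -> (j < N)%N -> F i j = F' i j) ->
  quad N h F = quad N h' F'.
Proof.
move=> eh eF; have lt (a : 'I_(N * p)) : (a %/ p < N)%N by rewrite ltn_divLR.
rewrite /quad; have -> : bcol N h = bcol N h' by apply/matrixP => a b; rewrite !mxE eh.
by have -> : bmx N F = bmx N F' by apply/matrixP => a b; rewrite !mxE eF.
Qed.

Lemma SminusE S k : Sminus S k.+2 = if odd k.+1 then
    quad k./2.+1 (fun i => S (k./2.+1 + i)%N) (fun i j => S (i + j)%N)
  else quad k.+1./2 (fun i => S (k.+1./2 + 1 + i)%N) (fun i j => S (i + j + 1)%N).
Proof. by []. Qed.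

Lemma SplusE S k : Splus S k.+2 = if odd k.+1 then
    S k.+1 - quad k./2 (fun i => S (k./2.+1 + i)%N - S (k./2.+1 + i + 1)%N)
                       (fun i j => S (i + j + 1)%N - S (i + j + 2)%N)
  else S k.+1 - quad k.+1./2 (fun i => S (k.+1./2 + i)%N - S (k.+1./2 + i + 1)%N)
                       (fun i j => S (i + j)%N - S (i + j + 1)%N).
Proof. by []. Qed.

(** This and the next three lemmas give the distances from a moment to its two bounds a common form:
    Schur complements in the Hankel matrices of [S] and [dshS S] at even levels, of [shS S] and
    [dfS S] at odd ones. The special values at the lowest levels come from a quadratic term of size
    zero. *)
Lemma sminus_even S m : S m.+1.*2 - Sminus S m.+1.*2 = schurH m.+1 S.
Proof.
by rewrite /schurH addnn doubleS SminusE /= odd_double doubleK.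
Qed.

Lemma sminus_odd S m : S m.*2.+1 - Sminus S m.*2.+1 = schurH m (shS S).
Proof.
case: m => [|m]; first by rewrite /schurH quad0 /Sminus /= !subr0.
rewrite /schurH addnn doubleS SminusE (_ : odd _ = false); last by lia.
rewrite (_ : m.*2.+2./2 = m.+1) /shS; last by lia.
congr (_ - _); apply: eq_quad => [i _|i j _ _]; congr (S _); lia.
Qed.

Lemma splus_even S m : Splus S m.+1.*2 - S m.+1.*2 = schurH m (dshS S).
Proof.
rewrite /schurH addnn doubleS SplusE /= odd_double /= doubleK /dshS.
rewrite addrAC; congr (_ - _); apply: eq_quad => [i _|i j _ _]; congr (S _ - S _); lia.
Qed.

Lemma splus_odd S m : S 0%N = 1%:M -> Splus S m.*2.+1 - S m.*2.+1 = schurH m (dfS S).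
Proof.
case: m => [|m] S0; first by rewrite /schurH quad0 subr0 /= /dfS S0.
rewrite /schurH addnn doubleS SplusE (_ : odd _ = false); last by lia.
rewrite (_ : m.*2.+2./2 = m.+1) /dfS; last by lia.
rewrite addrAC; congr (_ - _); apply: eq_quad => [i _|i j _ _]; congr (S _ - S _); lia.
Qed.

Definition inside (n : nat) S : Prop := forall k, (0 < k <= n)%N ->
  pd (S k - Sminus S k) /\ pd (Splus S k - S k).

End Hankel.

Section HankelGaps.
Variables (R : realType) (p : nat).
Hypothesis p0 : (0 < p)%N.
Implicit Types G S : nat -> 'M[R]_p.

Lemma eq_Sminus S S' n : (forall k, (k < n)%N -> S k = S' k) -> Sminus S n = Sminus S' n.
Proof.
case: n => [|[|n]] // e; rewrite !SminusE; case: ifP => od.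
- by apply: eq_quad => // [i il|i j il jl]; apply: e; lia.
- by apply: eq_quad => // [i il|i j il jl]; apply: e; lia.
Qed.

Lemma eq_Splus S S' n : (forall k, (k < n)%N -> S k = S' k) -> Splus S n = Splus S' n.
Proof.
case: n => [|[|n]] // e; rewrite !SplusE; case: ifP => od; congr (_ - _); try by apply: e.
- by apply: eq_quad => // [i il|i j il jl]; congr (_ - _); apply: e; lia.
- by apply: eq_quad => // [i il|i j il jl]; congr (_ - _); apply: e; lia.
Qed.

Lemma quad_sym N (G : nat -> 'M[R]_p) : (forall k, (G k)^T = G k) ->
  (quad N (fun i => G (N + i)%N) (fun i j => G (i + j)%N))^T =
  quad N (fun i => G (N + i)%N) (fun i j => G (i + j)%N).
Proof. by move=> sG; rewrite /quad !trmx_mul trmxK trmx_inv bmx_hk hk_sym // mulmxA. Qed.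

Lemma schurH_sym N G : (forall k, (G k)^T = G k) -> (schurH N G)^T = schurH N G.
Proof. by move=> sG; rewrite /schurH linearB /= sG quad_sym. Qed.

Lemma sym_shS S : (forall k, (S k)^T = S k) -> forall k, (shS S k)^T = shS S k.
Proof. by move=> sS k; exact: sS. Qed.
Lemma sym_dfS S : (forall k, (S k)^T = S k) -> forall k, (dfS S k)^T = dfS S k.
Proof. by move=> sS k; rewrite /dfS linearB /= !sS. Qed.
Lemma sym_dshS S : (forall k, (S k)^T = S k) -> forall k, (dshS S k)^T = dshS S k.
Proof. by move=> sS k; rewrite /dshS linearB /= !sS. Qed.

Lemma Sminus_sym S n : (forall k, (S k)^T = S k) -> (Sminus S n)^T = Sminus S n.
Proof.
move=> sS; suff : (S n - Sminus S n)^T = S n - Sminus S n.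
  by rewrite linearB /= sS => /addrI/oppr_inj.
rewrite -[n]odd_double_half; case: (odd n); rewrite ?add1n ?add0n.
  by rewrite sminus_odd // schurH_sym //; exact: sym_shS.
case: n./2 => [|m]; first by rewrite /= subr0 sS.
by rewrite sminus_even // schurH_sym.
Qed.

Lemma eq_hkN N G G' : (forall k, (k.+2 <= N + N)%N -> G k = G' k) ->
  hk (N * p) G = hk (N * p) G'.
Proof.
move=> e; apply: eq_hk => a b; apply: e.
have lt (c : 'I_(N * p)) : (c %/ p < N)%N by rewrite ltn_divLR.
by have := lt a; have := lt b; lia.
Qed.

(** [P0] selects the first [N] blocks and [P1] the last [N]. For a Hankel matrix, selecting columns
    one block further is the same as shifting the sequence, which is [hk_P1]. *)
Definition colS N (b : 'I_(N * p)) : 'I_(N * p + p) :=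
  @Ordinal (N * p + p) (b + p) (etrans (ltn_add2r p b (N * p)) (ltn_ord b)).
Definition P1 N : 'M[R]_(N * p + p, N * p) := \matrix_(a, b) (a == colS b)%:R.
Definition P0 N : 'M[R]_(N * p + p, N * p) := col_mx 1%:M 0.

Lemma mulP1E N n (X : 'M[R]_(n, N * p + p)) i b : (X *m P1 N) i b = X i (colS b).
Proof.
rewrite mxE (bigD1 (colS b)) //= mxE eqxx mulr1 big1 ?addr0 // => j jb.
by rewrite mxE (negPf jb) mulr0.
Qed.

Lemma mulP0 N n (X : 'M[R]_(n, N * p + p)) : X *m P0 N = lsubmx X.
Proof. by rewrite -{1}[X]hsubmxK mul_row_col mulmx1 mulmx0 addr0. Qed.

Lemma tP0mul N n (X : 'M[R]_(N * p + p, n)) : (P0 N)^T *m X = usubmx X.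
Proof. by rewrite /P0 tr_col_mx trmx1 trmx0 -{1}[X]vsubmxK mul_row_col mul1mx mul0mx addr0. Qed.

Lemma hk_P1 N G : hk (N * p + p) G *m P1 N = hk (N * p + p) (shS G) *m P0 N.
Proof.
apply/matrixP => i b; rewrite mulP1E mulP0 !mxE /= /shS modnDr.
by rewrite divnDr // divnn p0 addn1 addnS.
Qed.

Lemma tP0_hk_P0 N G : (P0 N)^T *m hk (N * p + p) G *m P0 N = hk (N * p) G.
Proof. by rewrite tP0mul mulP0; apply/matrixP => a b; rewrite !mxE. Qed.

Lemma tP0_hk_P1 N G : (P0 N)^T *m hk (N * p + p) G *m P1 N = hk (N * p) (shS G).
Proof. by rewrite -mulmxA hk_P1 mulmxA tP0_hk_P0. Qed.

Lemma tP1_hk_P1 N G : (forall k, (G k)^T = G k) ->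
  (P1 N)^T *m hk (N * p + p) G *m P1 N = hk (N * p) (shS (shS G)).
Proof.
move=> sG; rewrite -mulmxA hk_P1 mulmxA.
have -> : (P1 N)^T *m hk (N * p + p) (shS G) = (hk (N * p + p) (shS G) *m P1 N)^T.
  by rewrite trmx_mul (hk_sym _ (sym_shS sG)).
by rewrite hk_P1 trmx_mul (hk_sym _ (sym_shS (sym_shS sG))) tP0_hk_P0.
Qed.

(** A vanishing Schur complement makes the larger Hankel matrix factor through the smaller one; at
    the lower extremal moment this provides the factorisations that the gap identities rest on. *)
Lemma hk_schur0 N G (Z := invmx (hk (N * p) G) *m hcol N G) : (forall k, (G k)^T = G k) ->
  pd (hk (N * p) G) -> schurH N G = 0 ->
  hk (N * p + p) G = (row_mx 1%:M Z)^T *m hk (N * p) G *m row_mx 1%:M Z.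
Proof.
move=> sG pH /eqP; rewrite schurHE subr_eq0 => /eqP e; have uH := pd_unit pH.
rewrite hk_block // e tr_row_mx trmx1 /Z trmx_mul trmx_inv hk_sym //.
rewrite mul_col_mx mul1mx mulmxKV // mul_col_row !mulmx1 mulKVmx //.
by rewrite mulmxA.
Qed.

Section Interior.
Variables (S : nat -> 'M[R]_p).
Hypothesis sS : forall k, (S k)^T = S k.
Hypothesis S0 : S 0%N = 1%:M.
Variable n : nat.
Hypothesis iS : inside n S.

Lemma interior_hk m : (m.*2 <= n)%N -> pd (hk (m.+1 * p) S).
Proof.
elim: m => [_|m IH mn].
  apply: hk_pd_schur => //; first exact: pd_hk0.
  by rewrite /schurH quad0 subr0 S0; exact: pd1.
apply: hk_pd_schur => //; first by apply: IH; lia.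
by rewrite -sminus_even //; apply: (iS _).1; lia.
Qed.

Lemma interior_hk_shS m : (m.*2 <= n.+1)%N -> pd (hk (m * p) (shS S)).
Proof.
elim: m => [_|m IH mn]; first exact: pd_hk0.
apply: hk_pd_schur => //; first by apply: sym_shS.
  by apply: IH; lia.
by rewrite -sminus_odd //; apply: (iS _).1; lia.
Qed.

Lemma interior_hk_dfS m : (m.*2 <= n.+1)%N -> pd (hk (m * p) (dfS S)).
Proof.
elim: m => [_|m IH mn]; first exact: pd_hk0.
apply: hk_pd_schur => //; first by apply: sym_dfS.
  by apply: IH; lia.
by rewrite -splus_odd //; apply: (iS _).2; lia.
Qed.

Lemma interior_hk_dshS m : (m.*2 <= n)%N -> pd (hk (m * p) (dshS S)).
Proof.
elim: m => [_|m IH mn]; first exact: pd_hk0.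
apply: hk_pd_schur => //; first by apply: sym_dshS.
  by apply: IH; lia.
by rewrite -splus_even //; apply: (iS _).2; lia.
Qed.

End Interior.

Definition gap S n := Splus S n - Sminus S n.

Section Gap.
Variables (S : nat -> 'M[R]_p).
Hypothesis sS : forall k, (S k)^T = S k.
Hypothesis S0 : S 0%N = 1%:M.

(* Moving the last moment to its lower bound makes the lower Hankel matrix
   degenerate, and the gap becomes the Schur complement of the upper one. *)
Definition lowest n k := if k == n then Sminus S n else S k.

Lemma lowest_sym n k : (lowest n k)^T = lowest n k.
Proof. by rewrite /lowest; case: ifP => // _; rewrite Sminus_sym. Qed.

Lemma lowest_lt n k : (k < n)%N -> lowest n k = S k.
Proof. by rewrite /lowest; case: eqVneq => // ->; rewrite ltnn. Qed.

Lemma lowest_Sminus n : Sminus (lowest n) n = Sminus S n.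
Proof. by apply: eq_Sminus => k kn; rewrite lowest_lt. Qed.

Lemma lowest_Splus n : Splus (lowest n) n = Splus S n.
Proof. by apply: eq_Splus => k kn; rewrite lowest_lt. Qed.

(** [hankel_gap_odd] is applied to [S'] with [A] the Hankel matrix of [S'] and [B] that of [shS S'].
    Then [A - B] is the Hankel matrix of [dfS S'], whose last Schur complement is the gap; all
    smaller matrices agree with those of [S]. *)
Lemma gap_odd m : inside m.*2 S ->
  pd (gap S m.*2.+1) /\
  \det (gap S m.*2.+1) * (\det (hk (m * p) (shS S)) * \det (hk (m * p) (dfS S))) =
  \det (hk (m.+1 * p) S) * \det (hk (m * p) (dshS S)).
Proof.
move=> iS; set n := m.*2.+1; pose S' := lowest n.
have sS' := lowest_sym n.
have S'0 : S' 0%N = 1%:M by rewrite /S' lowest_lt.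
have eA : hk (m * p + p) S' = hk (m * p + p) S.
  by apply: eq_hkS => // k km; rewrite /S' lowest_lt // /n; lia.
have eB' : hk (m * p) (shS S') = hk (m * p) (shS S).
  by apply: eq_hkN => // k km; rewrite /shS /S' lowest_lt // /n; lia.
have eC : hk (m * p) (dshS S') = hk (m * p) (dshS S).
  by apply: eq_hkN => // k km; rewrite /dshS /S' !lowest_lt // /n; lia.
have eF : hk (m * p) (dfS S') = hk (m * p) (dfS S).
  by apply: eq_hkN => // k km; rewrite /dfS /S' !lowest_lt // /n; lia.
have pA : pd (hk (m * p + p) S') by rewrite eA -mulSnr; exact: interior_hk iS _ _.
have pB' : pd (hk (m * p) (shS S')) by rewrite eB'; apply: interior_hk_shS iS _ _.
have pC : pd (hk (m * p) (dshS S')) by rewrite eC; apply: interior_hk_dshS iS _ _.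
have pF : pd (hk (m * p) (dfS S')) by rewrite eF; apply: interior_hk_dfS iS _ _.
have sch0 : schurH m (shS S') = 0.
  by rewrite -sminus_odd // lowest_Sminus /S' /lowest eqxx subrr.
have schD : schurH m (dfS S') = gap S n.
  by rewrite -splus_odd // lowest_Splus /S' /lowest eqxx.
have CE : hk (m * p) (dshS S') =
    (P0 m)^T *m hk (m * p + p) (shS S') *m (P0 m - P1 m).
  by rewrite mulmxBr tP0_hk_P0 tP0_hk_P1 -hkB.
have [] := hankel_gap_odd pA pB' pC (hk_schur0 (sym_shS sS') pB' sch0) (hk_P1 _ _) CE.
rewrite -hkB -/(dfS S') => pAB dAB; split.
  by rewrite -schD; apply: pd_schurH => //; [exact: sym_dfS|rewrite mulSnr].
rewrite -eB' -eF -eC [in RHS]mulSnr -eA -dAB -schD.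
have := hk_det_schur p0 (sym_dfS sS') pF; rewrite mulSnr => ->; ring.
Qed.

(** Here [S'] degenerates the Hankel matrix of [S'] itself, of [m.+2] blocks. Its lower right part,
    the matrix of the doubly shifted sequence, becomes [B A^-1 B], so that of [dshS S'] is
    [B - B A^-1 B], as in [hankel_gap_even]. *)
Lemma gap_even m : inside m.*2.+1 S ->
  pd (gap S m.*2.+2) /\
  \det (gap S m.*2.+2) * (\det (hk (m.+1 * p) S) * \det (hk (m * p) (dshS S))) =
  \det (hk (m.+1 * p) (shS S)) * \det (hk (m.+1 * p) (dfS S)).
Proof.
move=> iS; set n := m.*2.+2; pose S' := lowest n.
have sS' := lowest_sym n.
have S'0 : S' 0%N = 1%:M by rewrite /S' lowest_lt.
have eA : hk (m.+1 * p) S' = hk (m.+1 * p) S.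
  by apply: eq_hkN => // k km; rewrite /S' lowest_lt // /n; lia.
have eB : hk (m.+1 * p) (shS S') = hk (m.+1 * p) (shS S).
  by apply: eq_hkN => // k km; rewrite /shS /S' lowest_lt // /n; lia.
have eC : hk (m * p) (dshS S') = hk (m * p) (dshS S).
  by apply: eq_hkN => // k km; rewrite /dshS /S' !lowest_lt // /n; lia.
have eF : hk (m.+1 * p) (dfS S') = hk (m.+1 * p) (dfS S).
  by apply: eq_hkN => // k km; rewrite /dfS /S' !lowest_lt // /n; lia.
have pA : pd (hk (m.+1 * p) S') by rewrite eA; apply: interior_hk iS _ _ => //; lia.
have pB : pd (hk (m.+1 * p) (shS S')) by rewrite eB; apply: interior_hk_shS iS _ _.
have pC : pd (hk (m * p) (dshS S')) by rewrite eC; apply: interior_hk_dshS iS _ _ => //; lia.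
have pF : pd (hk (m.+1 * p) S' - hk (m.+1 * p) (shS S')).
  by rewrite -hkB -/(dfS S') eF; apply: interior_hk_dfS iS _ _.
have sch0 : schurH m.+1 S' = 0.
  by rewrite -sminus_even // doubleS lowest_Sminus /S' /lowest eqxx subrr.
have schD : schurH m (dshS S') = gap S n.
  by rewrite -splus_even // doubleS lowest_Splus /S' /lowest eqxx.
have := hk_schur0 sS' pA sch0; set W := row_mx _ _ => WE.
have uA := pd_unit pA.
have WP : W *m P0 m.+1 = 1%:M by rewrite mulP0 row_mxKl.
have BE : hk (m.+1 * p) (shS S') = hk (m.+1 * p) S' *m W *m P1 m.+1.
  by rewrite -tP0_hk_P1 WE !mulmxA -trmx_mul WP trmx1 mul1mx.
have CE : hk (m.+1 * p) (dshS S') = hk (m.+1 * p) (shS S') -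
    hk (m.+1 * p) (shS S') *m invmx (hk (m.+1 * p) S') *m hk (m.+1 * p) (shS S').
  rewrite hkB; congr (_ - _); rewrite -[LHS]tP1_hk_P1 // WE.
  rewrite -{1}(hk_sym _ (sym_shS sS')) BE !trmx_mul hk_sym //.
  by rewrite -!mulmxA mulKmx // !mulmxA mulmxKV.
have [] := hankel_gap_even pA pB pF; rewrite -CE => pC' dC'; split.
  by rewrite -schD; apply: pd_schurH => //; exact: sym_dshS.
have eFB : hk (m.+1 * p) (dfS S') = hk (m.+1 * p) S' - hk (m.+1 * p) (shS S') by exact: hkB.
rewrite -eA -eB -eF -eC eFB -dC' -schD (hk_det_schur p0 (sym_dshS sS') pC); ring.
Qed.

Lemma gap_pd n : inside n S -> pd (gap S n.+1).
Proof.
rewrite -[n]odd_double_half; case: (odd n) => iS.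
  by have [] := gap_even iS.
by have [] := gap_odd iS.
Qed.

(** The formulas of [gap_odd] and [gap_even] at consecutive levels share their Hankel determinants;
    after these cancel, only the last Schur complements remain. *)
Lemma det_gapS n : inside n.+1 S ->
  \det (gap S n.+2) * \det (gap S n.+1) =
  \det (S n.+1 - Sminus S n.+1) * \det (Splus S n.+1 - S n.+1).
Proof.
move=> iS; have iS' : inside n S by move=> k kn; apply: iS; lia.
(* [d1] and [d2] are the determinants of consecutive gaps, [s] and [t] those of the two Hankel
   matrices to be cancelled, [x] and [y] those of the Schur complements extending them, and [u] the
   other product common to both levels. *)
have alg (x y u d1 d2 s t : R) : d2 * u = (s * x) * (t * y) -> d1 * (s * t) = u ->
    0 < s -> 0 < t -> d2 * d1 = x * y.
  move=> e e1 s0 t0; apply: (mulIf (lt0r_neq0 (mulr_gt0 s0 t0))).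
  by rewrite -mulrA e1 e; ring.
have pA m : (m.*2 <= n.+1)%N -> pd (hk (m.+1 * p) S) by exact: interior_hk.
have pC m : (m.*2 <= n.+1)%N -> pd (hk (m * p) (dshS S)) by exact: interior_hk_dshS.
have pB m : (m.*2 <= n.+2)%N -> pd (hk (m * p) (shS S)) by exact: interior_hk_shS.
have pF m : (m.*2 <= n.+2)%N -> pd (hk (m * p) (dfS S)) by exact: interior_hk_dfS.
move: iS iS' pA pB pC pF; rewrite -[n]odd_double_half; case: (odd n);
  rewrite ?add1n ?add0n; move: n./2 => m iS iS' pA pB pC pF.
  have iS2 : inside m.+1.*2 S by rewrite doubleS.
  have [_] := gap_odd iS2; have [_] := gap_even iS'; rewrite doubleS => e1 e2.
  rewrite -doubleS sminus_even // splus_even // doubleS.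
  rewrite (hk_det_schur p0 sS (pA m _)) in e2; last by lia.
  rewrite (hk_det_schur p0 (sym_dshS sS) (pC m _)) in e2; last by lia.
  by apply: alg e2 e1 _ _; apply: pd_det; [apply: pA|apply: pC]; lia.
have [_] := gap_even iS; have [_ e1] := gap_odd iS'.
rewrite sminus_odd // splus_odd // (hk_det_schur p0 (sym_shS sS) (pB m _)); last by lia.
rewrite (hk_det_schur p0 (sym_dfS sS) (pF m _)); last by lia.
move=> e2; apply: alg e2 e1 _ _; apply: pd_det; [apply: pB|apply: pF]; lia.
Qed.

End Gap.
End HankelGaps.

(** * The truncated moment problem on [0,1] *)

Section PolynomialIntegrals.
Variable R : realType.

Lemma poly_lipschitz01 (P : {poly R}) : exists2 L, 0 <= L & forall s t, 0 <= s <= 1 -> 0 <= t <= 1 ->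
  `|P.[s]| <= L /\ `|P.[s] - P.[t]| <= L * `|s - t|.
Proof.
elim/poly_ind: P => [|P c [L L0 IH]].
  by exists 0 => // s t _ _; rewrite !horner0 subrr normr0 mul0r.
exists (2 * L + `|c|) => [|s t s01 t01]; first by rewrite addr_ge0 ?mulr_ge0.
have [Ps Pst] := IH s t s01 t01; have [Pt _] := IH t s t01 s01.
have {s01} s1 : `|s| <= 1 by case/andP: s01 => s0 s1; rewrite ger0_norm.
rewrite !hornerMXaddC; split.
  rewrite (le_trans (ler_normD _ _)) // lerD2r normrM.
  by rewrite (le_trans (ler_pM _ _ Ps s1)) // mulr1; lra.
rewrite (_ : _ - _ = (P.[s] - P.[t]) * s + P.[t] * (s - t)); last by ring.
rewrite (le_trans (ler_normD _ _)) // !normrM mulrDl mulrDl ler_wpDr ?mulr_ge0 //.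
rewrite mul1r mulrDl lerD //; last by rewrite ler_wpM2r.
by rewrite (le_trans (ler_wpM2l _ s1)) // mulr1.
Qed.

Lemma measurable_I01 : measurable (@I01 R).
Proof.
have -> : @I01 R = `[0, 1]%classic by apply/seteqP; split => x /=; rewrite /I01 /= in_itv.
exact: measurable_itv.
Qed.
Hint Resolve measurable_I01 : core.

Section FiniteMeasure.
Variable mu : {measure set (measurableTypeR R) -> \bar R}.
Hypothesis muT : (mu setT < +oo)%E.

Lemma mu_fin (A : set (measurableTypeR R)) : measurable A -> (mu A < +oo)%E.
Proof. by move=> mA; apply: le_lt_trans muT; apply: le_measure; rewrite ?inE. Qed.

Lemma integrable_bnd01 (f : measurableTypeR R -> R) L : measurable_fun (@I01 R) f ->
  (forall t, 0 <= t <= 1 -> `|f t| <= L) -> mu.-integrable (@I01 R) (EFin \o f).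
Proof.
move=> mf fL; apply: measurable_bounded_integrable => //; first exact: mu_fin.
exists L; split; first exact: num_real.
by move=> M LM t /fL h; apply: (le_trans h); exact: ltW.
Qed.

Lemma integrable_horner (P : {poly R}) :
  mu.-integrable (@I01 R) (EFin \o (horner P : measurableTypeR R -> R)).
Proof.
have [L L0 PL] := poly_lipschitz01 P; apply: (@integrable_bnd01 _ L).
  exact: measurable_poly.
by move=> t t01; exact: (PL t t t01 t01).1.
Qed.

(** For [N > 0] the indices [r = 0, ..., N] partition [I01]; the cell of index [N] is the single
    point 1, hence the sums over [N.+1] cells below. *)
Definition cell (N r : nat) : set (measurableTypeR R) :=
  @I01 R `&` [set t : R | r%:R <= N%:R * t < r.+1%:R].

Lemma measurable_cell N r : measurable (cell N r).
Proof.
apply: measurableI => //.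
have -> : [set t : R | r%:R <= N%:R * t < r.+1%:R] =
    (fun t : measurableTypeR R => N%:R * t : measurableTypeR R) @^-1` `[r%:R, r.+1%:R[%classic.
  by apply/seteqP; split => t /=; rewrite in_itv.
have mf : measurable_fun setT (fun t : measurableTypeR R => N%:R * t : measurableTypeR R).
  exact: mulrl_measurable.
by rewrite -[X in measurable X]setTI; apply: mf.
Qed.
Hint Resolve measurable_cell : core.

Lemma Rintegral_step n (c : nat -> R) (B : nat -> set (measurableTypeR R)) :
  (forall r, measurable (B r)) -> (forall r, B r `<=` @I01 R) ->
  mu.-integrable (@I01 R) (EFin \o (fun t => \sum_(r < n) c r * \1_(B r) t)) /\
  Rintegral mu (@I01 R) (fun t => \sum_(r < n) c r * \1_(B r) t) = \sum_(r < n) c r * fine (mu (B r)).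
Proof.
move=> mB sB; elim: n => [|n [IHi IH]].
  have e : (fun t : measurableTypeR R => \sum_(r < 0) c r * \1_(B r) t) = cst 0.
    by apply/funext => t; rewrite big_ord0.
  rewrite e big_ord0; split; first exact: integrable0.
  by rewrite Rintegral_cst // mul0r.
have iB : mu.-integrable (@I01 R) (EFin \o (\1_(B n) : measurableTypeR R -> R)).
  apply: (@integrable_bnd01 _ 1) => [|t _]; first exact: measurable_indic.
  by rewrite indicE; case: (_ \in _); rewrite ?normr1 ?normr0.
have iBc : mu.-integrable (@I01 R) (EFin \o (fun t => c n * \1_(B n) t)).
  rewrite (_ : EFin \o _ = (fun t => (c n)%:E * (EFin \o \1_(B n)) t)%E); last first.
    by apply/funext => t; rewrite /= EFinM.
  exact: integrableZl.
have e : (fun t : measurableTypeR R => \sum_(r < n.+1) c r * \1_(B r) t) =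
    (fun t => \sum_(r < n) c r * \1_(B r) t + c n * \1_(B n) t).
  by apply/funext => t; rewrite big_ord_recr.
rewrite e big_ord_recr /=; split.
  by have := integrableD measurable_I01 IHi iBc.
rewrite RintegralD // IH RintegralZl //; congr (_ + _ * fine _).
by rewrite integral_indic // setIidl.
Qed.

(** On a cell the polynomial differs from its value at the left end by at most its Lipschitz
    constant over [N], so [K] is that constant times the total mass. *)
Lemma Rintegral_horner_step (P : {poly R}) : exists K, forall N, (0 < N)%N ->
  `|Rintegral mu (@I01 R) (horner P) - \sum_(r < N.+1) P.[r%:R / N%:R] * fine (mu (cell N r))|
    <= K / N%:R.
Proof.
have [L L0 PL] := poly_lipschitz01 P; exists (L * fine (mu (@I01 R))) => N N0.
have cI r : cell N r `<=` @I01 R by move=> t [].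
have [ih <-] := Rintegral_step N.+1 (fun r => P.[r%:R / N%:R]) (measurable_cell N) cI.
have iP := integrable_horner P.
have N0' : (0 : R) < N%:R by rewrite ltr0n.
rewrite -RintegralB //; set h := fun t => _ - _.
have ih' : mu.-integrable (@I01 R) (EFin \o h).
  by have := integrableB measurable_I01 iP ih.
rewrite (le_trans (le_normr_Rintegral _ _)) //.
have -> : L * fine (mu (@I01 R)) / N%:R = Rintegral mu (@I01 R) (cst (L / N%:R)).
  by rewrite Rintegral_cst // mulrAC.
apply: le_Rintegral => //.
- by have := integrable_abse ih'.
- by apply: (@integrable_bnd01 _ (`|L / N%:R|)).
move=> t t01; rewrite /h /=; case/andP: (t01) => t0 t1.
pose r := Num.truncn (N%:R * t).
have /andP[r1 r2] : r%:R <= N%:R * t < r.+1%:R.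
  by apply: truncn_itv; rewrite mulr_ge0 // ltW.
have rN : (r < N.+1)%N.
  rewrite ltnS -(ler_nat R) (le_trans r1) // -{2}[N%:R]mulr1 ler_wpM2l // ltW //.
rewrite (bigD1 (Ordinal rN)) //= big1 => [|s sr]; last first.
  rewrite indicE (_ : (_ \in _) = false) ?mulr0 //; apply/negbTE; rewrite notin_setE => -[_ /= /andP[s1 s2]].
  case/eqP: sr; apply/val_inj => /=; apply/eqP; rewrite eqn_leq -ltnS -[X in _ && X]ltnS -!(ltr_nat R).
  by rewrite (le_lt_trans s1) // (le_lt_trans r1).
rewrite indicE (_ : (_ \in _) = true) ?mulr1 ?addr0; last first.
  by apply: mem_set; split => //=; rewrite r1 r2.
have rN01 : 0 <= (r%:R / N%:R : R) <= 1.
  apply/andP; split; first by apply: divr_ge0.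
  by rewrite ler_pdivrMr // mul1r ler_nat -ltnS.
have [_ h2] := PL t (r%:R / N%:R) t01 rN01.
rewrite (le_trans h2) // ler_wpM2l // ger0_norm; last first.
  by rewrite subr_ge0 ler_pdivrMr // mulrC.
by rewrite lerBlDl -[X in _ + X]mul1r -mulrDl ler_pdivlMr // mulrC natr1 ltW.
Qed.

End FiniteMeasure.
End PolynomialIntegrals.

(** * Positivity of the Hankel matrices of a matrix measure *)

Section MomentNecessity.
Variables (R : realType) (p : nat).
Hypothesis p0 : (0 < p)%N.
Variables mp mn : 'I_p -> 'I_p -> {measure set (measurableTypeR R) -> \bar R}.
Hypothesis mmP : is_matrix_measure mp mn.

Definition polyint i j (P : {poly R}) : R :=
  Rintegral (mp i j) (@I01 R) (horner P) - Rintegral (mn i j) (@I01 R) (horner P).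
Definition polymx P : 'M[R]_p := \matrix_(i, j) polyint i j P.

Let mpT i j : (mp i j setT < +oo)%E.
Proof. by case: mmP => /(_ i j)[]. Qed.
Let mnT i j : (mn i j setT < +oo)%E.
Proof. by case: mmP => /(_ i j)[]. Qed.

Lemma polyintB i j P Q : polyint i j (P - Q) = polyint i j P - polyint i j Q.
Proof.
have e : horner (P - Q) = fun t => P.[t] - Q.[t] by apply/funext => t; rewrite !hornerE.
rewrite /polyint e !RintegralB //; try exact: measurable_I01; try exact: integrable_horner.
by ring.
Qed.

Lemma polyintZ i j c P : polyint i j (c *: P) = c * polyint i j P.
Proof.
have e : horner (c *: P) = fun t => c * P.[t] by apply/funext => t; rewrite !hornerE.
rewrite /polyint e !RintegralZl //; try exact: measurable_I01; try exact: integrable_horner.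
by ring.
Qed.

Lemma polymxB P Q : polymx (P - Q) = polymx P - polymx Q.
Proof. by apply/matrixP => i j; rewrite !mxE polyintB. Qed.

Lemma polymxXn k : polymx 'X^k = mmoment mp mn k.
Proof.
have e : horner ('X^k : {poly R}) = fun t => t ^+ k by apply/funext => t; rewrite hornerXn.
by apply/matrixP => i j; rewrite !mxE /polyint e.
Qed.

Lemma polyint_step i j P : exists K, forall N, (0 < N)%N ->
  `|polyint i j P - \sum_(r < N.+1) P.[r%:R / N%:R] * mval mp mn (cell N r) i j| <= K / N%:R.
Proof.
have [K1 h1] := Rintegral_horner_step (mpT i j) P.
have [K2 h2] := Rintegral_horner_step (mnT i j) P.
exists (K1 + K2) => N N0; have {}h1 := h1 N N0; have {}h2 := h2 N N0.
have e : \sum_(r < N.+1) P.[r%:R / N%:R] * mval mp mn (cell N r) i j =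
    \sum_(r < N.+1) P.[r%:R / N%:R] * fine (mp i j (cell N r)) -
    \sum_(r < N.+1) P.[r%:R / N%:R] * fine (mn i j (cell N r)).
  by rewrite -sumrB; apply: eq_bigr => r _; rewrite mxE mulrBr.
rewrite e /polyint; set a := Rintegral _ _ _ in h1 *; set b := Rintegral _ _ _ in h2 *.
set c := \sum_(r < _) _ in h1 *; set d := \sum_(r < _) _ in h2 *.
rewrite (_ : _ - _ = (a - c) - (b - d)); last by ring.
by rewrite (le_trans (ler_normB _ _)) // mulrDl lerD.
Qed.

Lemma cell_psd N r : psd (mval mp mn (cell N r)).
Proof. by case: mmP => _ _ h _; apply: h; [exact: measurable_cell | move=> t []]. Qed.

(* The integrals are limits of Riemann sums over the cells, whose matrix masses are [psd]. *)
Lemma polyint_pos (I : finType) (f g : I -> 'I_p) (P : I -> {poly R}) :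
  (forall t, 0 <= t <= 1 -> forall B, psd B -> 0 <= \sum_c (P c).[t] * B (f c) (g c)) ->
  0 <= \sum_c polyint (f c) (g c) (P c).
Proof.
move=> h.
have /choice [K hK] : forall c, exists K, forall N, (0 < N)%N ->
    `|polyint (f c) (g c) (P c) -
      \sum_(r < N.+1) (P c).[r%:R / N%:R] * mval mp mn (cell N r) (f c) (g c)| <= K / N%:R.
  by move=> c; exact: polyint_step.
have main N : (0 < N)%N -> - (\sum_c K c) / N%:R <= \sum_c polyint (f c) (g c) (P c).
  move=> N0; have N0' : (0 : R) < N%:R by rewrite ltr0n.
  apply: (@le_trans _ _ (\sum_c (\sum_(r < N.+1) (P c).[r%:R / N%:R] *
      mval mp mn (cell N r) (f c) (g c) - K c / N%:R))).
    rewrite sumrB exchange_big /= mulNr mulr_suml lerBrDr addNr.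
    apply: sumr_ge0 => r _; apply: h (cell_psd _ _).
    rewrite divr_ge0 //= ler_pdivrMr // mul1r ler_nat -ltnS; exact: ltn_ord.
  apply: ler_sum => c _; rewrite lerBlDr -lerBlDl.
  by rewrite (le_trans _ (hK c N N0)) // distrC ler_norm.
rewrite leNgt; apply/negP => neg.
set s := \sum_c _ in neg main; set K' := \sum_c K c in main.
pose N := (Num.truncn (K' / - s)).+1.
have := main N isT; have N0' : (0 : R) < N%:R by rewrite ltr0n.
have : K' / - s < N%:R by exact: truncnS_gt.
rewrite ltr_pdivrMr ?oppr_gt0 // ler_pdivrMr // mulrN; lra.
Qed.

Let im (a : nat) : 'I_p := Ordinal (ltn_pmod a p0).

(** The quadratic form of the Hankel matrix at [v] is the integral of [c(t)] times the quadratic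
    form of the measure at the row [v *m E], where [E] stacks the blocks [t^i] times the
    identity. *)
Lemma psd_hk_polymx n (c : {poly R}) (G : nat -> 'M[R]_p) :
  (forall t, 0 <= t <= 1 -> 0 <= c.[t]) -> (forall k, (G k)^T = G k) ->
  (forall a b : 'I_n, G (a %/ p + b %/ p)%N = polymx (c * 'X^(a %/ p + b %/ p))) ->
  psd (hk n G).
Proof.
move=> c0 sG GE; split; first exact: hk_sym.
move=> v; have entim (M : 'M[R]_p) a b : ent M (a %% p)%N (b %% p)%N = M (im a) (im b).
  by rewrite -entE.
have -> : (v *m hk n G *m v^T) 0 0 = \sum_(z : 'I_n * 'I_n)
    polyint (im z.1) (im z.2) ((v 0 z.1 * v 0 z.2) *: (c * 'X^(z.1 %/ p + z.2 %/ p))).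
  rewrite mxE (eq_bigr (fun b : 'I_n => \sum_(a < n) polyint (im a) (im b)
      ((v 0 a * v 0 b) *: (c * 'X^(a %/ p + b %/ p))))).
    by rewrite exchange_big pair_big.
  move=> b _; rewrite mxE mulr_suml; apply: eq_bigr => a _.
  by rewrite !mxE entim GE mxE polyintZ; ring.
apply: polyint_pos => t t01 B pB.
pose E : 'M[R]_(n, p) := \matrix_(a, i) ((i == im a)%:R * t ^+ (a %/ p)).
have EBE a b : (E *m B *m E^T) a b = t ^+ (a %/ p) * B (im a) (im b) * t ^+ (b %/ p).
  rewrite mxE (bigD1 (im b)) //= big1 ?addr0 => [|i ib]; last first.
    by rewrite !mxE (negPf ib) mul0r mulr0.
  rewrite !mxE eqxx mul1r; congr (_ * _).
  rewrite (bigD1 (im a)) //= big1 ?addr0 => [|i ib]; last first.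
    by rewrite !mxE (negPf ib) !mul0r.
  by rewrite !mxE eqxx mul1r.
have := (psd_congr E pB).2 v; rewrite mxE => vE.
suff -> : \sum_c0 ((v 0 c0.1 * v 0 c0.2) *: (c * 'X^(c0.1 %/ p + c0.2 %/ p))).[t] *
    B (im c0.1) (im c0.2) = c.[t] * \sum_j (v *m (E *m B *m E^T)) 0 j * v^T j 0.
  by rewrite mulr_ge0 ?c0.
rewrite mulr_sumr [RHS](eq_bigr (fun b : 'I_n => \sum_(a < n) ((v 0 a * v 0 b) *:
    (c * 'X^(a %/ p + b %/ p))).[t] * B (im a) (im b))).
  by rewrite exchange_big pair_big.
move=> b _; rewrite mxE mulr_suml mulr_sumr; apply: eq_bigr => a _.
by rewrite !hornerE EBE !mxE exprD /=; ring.
Qed.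

End MomentNecessity.

Section MomentSpace.
Variables (R : realType) (p : nat).
Hypothesis p0 : (0 < p)%N.

Lemma Sseq_sym n (x : coordT p n -> R) k : (Sseq x k)^T = Sseq x k.
Proof.
case: k => [|k] /=; first by rewrite trmx1.
case: insubP => [l _ _|_]; last by rewrite trmx0.
apply/matrixP => i j; rewrite !mxE; case: (ltngtP i j) => // ij.
by rewrite (val_inj ij).
Qed.

Lemma mmoment0 mp mn : @is_matrix_measure R p mp mn -> mmoment mp mn 0 = 1%:M.
Proof.
case=> _ _ _ <-; apply/matrixP => i j; rewrite !mxE.
by congr (fine _ - fine _); rewrite -[RHS]mul1e -integral_cst //; exact: measurable_I01.
Qed.

Section Psd.
Variables (n : nat) (x : coordT p n -> R).
Hypothesis xM : moment_space x.
Let S := Sseq x.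

Lemma moment_space_psd m :
  [/\ (m.*2 <= n)%N -> psd (hk (m.+1 * p) S),
      (m.*2.+1 <= n)%N -> psd (hk (m.+1 * p) (shS S)),
      (m.*2.+1 <= n)%N -> psd (hk (m.+1 * p) (dfS S)) &
      (m.*2.+2 <= n)%N -> psd (hk (m.+1 * p) (dshS S))].
Proof.
have [mp [mn [mmP xE]]] := xM.
have SE k : (k <= n)%N -> S k = polymx mp mn 'X^k.
  rewrite polymxXn; case: k => [_|k kn]; first by rewrite mmoment0.
  by rewrite /S /Sseq (insubT (fun i => (i < n)%N) kn) xE.
have lt (c : 'I_(m.+1 * p)) : (c %/ p <= m)%N by rewrite -ltnS ltn_divLR.
have sS := Sseq_sym x.
split=> mn'.
- apply: (psd_hk_polymx p0 mmP (c := 1)) => // [t _|a b]; first by rewrite hornerE.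
  by rewrite mul1r SE //; have := lt a; have := lt b; lia.
- apply: (psd_hk_polymx p0 mmP (c := 'X)) => [t /andP[]|k|a b]; first by rewrite hornerE.
    exact: sym_shS.
  by rewrite -exprS /shS SE //; have := lt a; have := lt b; lia.
- apply: (psd_hk_polymx p0 mmP (c := 1 - 'X)) => [t /andP[_ t1]|k|a b].
  + by rewrite !hornerE subr_ge0.
  + exact: sym_dfS.
  + rewrite mulrBl mul1r -exprS polymxB // /dfS -!SE //; have := lt a; have := lt b; lia.
- apply: (psd_hk_polymx p0 mmP (c := 'X - 'X^2)) => [t /andP[t0 t1]|k|a b].
  + by rewrite !hornerE expr2 subr_ge0 ler_piMr.
  + exact: sym_dshS.
  + rewrite mulrBl -exprS -exprD add2n polymxB // /dshS -!SE //; have := lt a; have := lt b; lia.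
Qed.

(** Being [inside] up to [l] makes the smaller Hankel matrix invertible, so semidefiniteness of the
    larger one passes to its Schur complement. *)
Lemma moment_space_next l : (l < n)%N -> inside l S ->
  psd (S l.+1 - Sminus S l.+1) /\ psd (Splus S l.+1 - S l.+1).
Proof.
have sS := Sseq_sym x; have S0 : S 0%N = 1%:M by [].
rewrite -[l]odd_double_half; case: (odd l); rewrite ?add1n ?add0n;
  move: l./2 => m ln iS.
  rewrite -doubleS sminus_even // splus_even //; split.
    apply: hk_psd_schur => //; first by apply: (interior_hk p0 sS S0 iS); lia.
    by have [h _ _ _] := moment_space_psd m.+1; apply: h; lia.
  apply: hk_psd_schur => //; first exact: sym_dshS.
    by apply: (interior_hk_dshS p0 sS iS); lia.
  by have [_ _ _ h] := moment_space_psd m; apply: h; lia.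
rewrite sminus_odd // splus_odd //; split.
  apply: hk_psd_schur => //; first exact: sym_shS.
    by apply: (interior_hk_shS p0 sS iS); lia.
  by have [_ h _ _] := moment_space_psd m; apply: h; lia.
apply: hk_psd_schur => //; first exact: sym_dfS.
  by apply: (interior_hk_dfS p0 sS S0 iS); lia.
by have [_ _ h _] := moment_space_psd m; apply: h; lia.
Qed.

End Psd.
End MomentSpace.

(** * Atomic measures representing interior points *)

Section MomentSufficiency.
Variables (R : realType) (p : nat).
Hypothesis p0 : (0 < p)%N.

(** Write [A^(-1/2) B A^(-1/2) = Q^T diag(d) Q] and [v = Q A^(1/2)]; then [v^T v = A] and
    [v^T diag(d) v = B]. The atoms are the [d r], which lie in [[0,1]] because [0 <= B <= A], and
    the rows of the first block of [v] give their rank-one weights. *)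
Lemma hankel_atoms (S : nat -> 'M[R]_p) m : (forall k, (S k)^T = S k) ->
  pd (hk (m.+1 * p) S) -> psd (hk (m.+1 * p) (shS S)) -> psd (hk (m.+1 * p) (dfS S)) ->
  exists n (d : 'I_n -> R) (v : 'M[R]_(n, p)), (forall r, 0 <= d r <= 1) /\
  forall k, (k <= m.*2.+1)%N -> forall i j, S k i j = \sum_r d r ^+ k * (v r i * v r j).
Proof.
move=> sS; set n := (m.+1 * p)%N; set A := hk n S; set B := hk n (shS S) => pA pB.
rewrite hkB -/A -/B => pAB.
have uA := pd_unit pA; have [M [[sM _] MM]] := psd_sqrt (pd_psd pA).
have uM : M \in unitmx.
  by move: uA; rewrite -MM !unitmxE det_mulmx unitrM => /andP[].
have sI : (invmx M)^T = invmx M by rewrite trmx_inv sM.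
pose T := invmx M *m B *m invmx M.
have sT : T^T = T by rewrite /T !trmx_mul sI pB.1 mulmxA.
have [Q [d [QQ TE]]] := real_spectral sT.
have dE : diag_mx d = Q *m T *m Q^T.
  by rewrite TE !mulmxA QQ mul1mx -mulmxA QQ mulmx1.
have [v vdef] : exists v, v = Q *m M by exists (Q *m M).
have vv : v^T *m v = A.
  by rewrite vdef trmx_mul sM -mulmxA (mulmxA Q^T) (mulmx1C QQ) mul1mx MM.
have vdv : v^T *m diag_mx d *m v = B.
  rewrite dE vdef trmx_mul sM -!mulmxA !(mulmxA Q^T) (mulmx1C QQ) !mul1mx /T.
  by rewrite !mulmxA mulmxV // mul1mx mulmxKV.
have [Nx NE] : exists N, A *m N = B by exists (invmx A *m B); rewrite mulKVmx.
have uv : v \in unitmx by rewrite vdef unitmx_mul uM (mulmx1_unit QQ).1.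
have vN : v *m Nx = diag_mx d *m v.
  have uv' : v^T \in unitmx by rewrite unitmx_tr.
  by apply: (can_inj (mulKmx uv')); rewrite !mulmxA vdv vv NE.
have diag01 r : 0 <= d 0 r <= 1.
  have e (X : 'rV[R]_n) : qf (diag_mx X) (delta_mx 0 r) = X 0 r.
    rewrite qf_diag (bigD1 r) //= big1 => [|j jr]; first by rewrite mxE !eqxx expr1n mulr1 addr0.
    by rewrite mxE eqxx (negPf jr) expr0n mulr0.
  have h1 : psd (diag_mx d).
    rewrite dE; apply: psd_congr; rewrite /T -{2}sI; exact: psd_congr.
  have h2 : psd (diag_mx (const_mx 1 - d)).
    rewrite linearB /= diag_const_mx dE.
    have -> : 1%:M - Q *m T *m Q^T = Q *m (1%:M - T) *m Q^T by rewrite mulmxBr mulmx1 mulmxBl QQ.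
    apply: psd_congr; have -> : 1%:M - T = invmx M *m (A - B) *m (invmx M)^T.
      by rewrite sI mulmxBr mulmxBl -/T -MM mulKmx // mulmxV.
    exact: psd_congr.
  have := h1.2 (delta_mx 0 r); have := h2.2 (delta_mx 0 r).
  by rewrite -!/(qf _ _) !e !mxE subr_ge0 => -> ->.
pose E (k : nat) : 'M[R]_(n, p) := \matrix_(a, j) (a == (k * p + j)%N :> nat)%:R.
have ixP k : (k <= m)%N -> exists f : 'I_p -> 'I_n, forall j, f j = (k * p + j)%N :> nat.
  move=> km; have lt (j : 'I_p) : (k * p + j < n)%N.
    apply: (@leq_trans (k.+1 * p)); first by rewrite mulSnr ltn_add2l.
    by rewrite leq_mul2r ltnS km orbT.
  by exists (fun j => Ordinal (lt j)).
have mulE k (f : 'I_p -> 'I_n) n' (X : 'M[R]_(n', n)) : (forall j, f j = (k * p + j)%N :> nat) ->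
    forall a j, (X *m E k) a j = X a (f j).
  move=> fE a j; rewrite mxE (bigD1 (f j)) //= mxE fE eqxx mulr1 big1 ?addr0 // => b bf.
  rewrite mxE (_ : (_ == _) = false) ?mulr0 //.
  by apply/negbTE; apply: contra bf => /eqP bE; apply/eqP/val_inj; rewrite /= bE fE.
have ix_div k (f : 'I_p -> 'I_n) : (forall j, f j = (k * p + j)%N :> nat) -> forall j, (f j %/ p = k)%N.
  by move=> fE j; rewrite fE divnMDl // divn_small ?addn0.
have ix_mod k (f : 'I_p -> 'I_n) : (forall j, f j = (k * p + j)%N :> nat) -> forall j, (f j %% p = j)%N.
  by move=> fE j; rewrite fE modnMDl modn_small.
(* The Hankel shift: block column [k.+1] of [A] is block column [k] of [B]. Hence [A^-1 B] moves
   blocks forward, and since [v] diagonalises it, block [k] of [v] is [d^k] times block 0. *)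
have AE k : (k < m)%N -> A *m E k.+1 = B *m E k.
  move=> km; have [f fE] := ixP k.+1 km; have [g gE] := ixP k (ltnW km).
  apply/matrixP => a j; rewrite (mulE _ _ _ _ fE) (mulE _ _ _ _ gE) !mxE.
  by rewrite (ix_div _ _ fE) (ix_div _ _ gE) (ix_mod _ _ fE) (ix_mod _ _ gE) addnS.
have vE k : (k <= m)%N -> forall r j, (v *m E k) r j = d 0 r ^+ k * (v *m E 0%N) r j.
  elim: k => [_ r j|k IH km r j]; first by rewrite mul1r.
  have -> : v *m E k.+1 = diag_mx d *m (v *m E k).
    rewrite mulmxA -vN -mulmxA; congr (_ *m _).
    by apply: (can_inj (mulKmx uA)); rewrite AE // mulmxA NE.
  by rewrite mul_diag_mx mxE IH ?(ltnW km) // exprS mulrA.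
have hkE G i j : (forall k, (G k)^T = G k) -> (i <= m)%N -> (j <= m)%N ->
    (E i)^T *m hk n G *m E j = G (i + j)%N.
  move=> sG im jm; have [f fE] := ixP i im; have [g gE] := ixP j jm.
  have -> : (E i)^T *m hk n G = (hk n G *m E i)^T by rewrite trmx_mul hk_sym.
  apply/matrixP => a b; rewrite (mulE _ _ _ _ gE) mxE (mulE _ _ _ _ fE) !mxE.
  rewrite (ix_div _ _ fE) (ix_div _ _ gE) (ix_mod _ _ fE) (ix_mod _ _ gE).
  by rewrite entE addnC -{1}sG mxE.
exists n, (fun r => d 0 r), (v *m E 0%N); split=> // k km i j.
(* Up to order [2m] a moment is a block of [A], reached by splitting [k] into halves of size at most
   [m]; order [2m + 1] is the last block of [B]. *)
have [k2|k2] := leqP k m.*2.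
  have kE : k = (k - k./2 + k./2)%N by lia.
  rewrite [in LHS]kE -(hkE S (k - k./2)%N k./2) //; try lia.
  rewrite -/A -vv mulmxA -trmx_mul -mulmxA mxE; apply: eq_bigr => r _.
  rewrite [in RHS]kE exprD mxE (vE (k - k./2)%N); last by lia.
  by rewrite (vE k./2); [ring|lia].
have -> : k = (m + m).+1 by lia.
rewrite -[S _]/(shS S (m + m)%N) -(hkE (shS S)) //; last exact: sym_shS.
rewrite -/B -vdv !mulmxA -trmx_mul -!mulmxA mxE; apply: eq_bigr => r _.
have -> : ((v *m E m)^T) i r = (v *m E m) r i by rewrite mxE.
have -> : (diag_mx d *m (v *m E m)) r j = d 0 r * (v *m E m) r j by rewrite mul_diag_mx mxE.
rewrite !(vE m (leqnn m)) exprS exprD; ring.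
Qed.

Section Atoms.
Variables (n : nat) (d : 'I_n -> R).
Hypothesis d01 : forall r, 0 <= d r <= 1.

(** [msum] adds measures indexed by [nat], so weights and points are extended by 0 beyond [n]; the
    absolute value makes every weight nonnegative by construction. *)
Let wt (c : 'I_n -> R) (r : nat) : {nonneg R} :=
  NngNum (normr_ge0 (if @insub _ (fun i => i < n)%N 'I_n r is Some r' then c r' else 0)).
Let pt (r : nat) : measurableTypeR R :=
  if @insub _ (fun i => i < n)%N 'I_n r is Some r' then d r' else 0.

Let atom (c : 'I_n -> R) (r : nat) : {measure set (measurableTypeR R) -> \bar R} :=
  mscale (wt c r) (dirac (pt r)).

Definition atoms (c : 'I_n -> R) : {measure set (measurableTypeR R) -> \bar R} :=
  msum (atom c) n.

Lemma atomsE c A : atoms c A = (\sum_r `|c r| * (d r \in A)%:R)%:E.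
Proof.
rewrite /atoms /msum -sumEFin; apply: eq_bigr => r _.
by rewrite /atom /= /wt /pt valK /= /mscale /= diracE EFinM.
Qed.

Lemma integral_atoms c k :
  (\int[atoms c]_(x in @I01 R) (x ^+ k)%:E)%E = (\sum_r `|c r| * d r ^+ k)%:E.
Proof.
have mX : measurable_fun (@I01 R) (fun x : measurableTypeR R => (x ^+ k)%:E).
  by apply/measurable_EFinP; exact: exprn_measurable.
have X0 (x : measurableTypeR R) : @I01 R x -> (0 <= (x ^+ k)%:E)%E.
  by move=> /andP[x0 _]; rewrite lee_fin exprn_ge0.
rewrite /atoms ge0_integral_measure_sum //; last exact: measurable_I01.
rewrite -sumEFin; apply: eq_bigr => r _.
rewrite ge0_integral_mscale //; last exact: measurable_I01.
rewrite integral_dirac //; last exact: measurable_I01.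
by rewrite /= /wt /pt valK /= diracE mem_set ?mul1e //; exact: d01.
Qed.

Variable v : 'M[R]_(n, p).
Hypothesis v1 : forall i j, \sum_r v r i * v r j = (i == j)%:R.

(* [`|c| + c >= 0], so the atoms of weight [`| `|c| + c|] minus those of weight [`|c|] have net weight [c]. *)
Let c i j r := v r i * v r j.
Let ap i j := atoms (fun r => `|c i j r| + c i j r).
Let an i j := atoms (c i j).

Let net i j r (y : R) : `| `|c i j r| + c i j r| * y - `|c i j r| * y = c i j r * y.
Proof.
have h : 0 <= `|c i j r| + c i j r by have := ler_norm (- c i j r); rewrite normrN; lra.
by rewrite (ger0_norm h) mulrDl addrAC subrr add0r.
Qed.

Lemma atoms_measure : exists mp mn, @is_matrix_measure R p mp mn /\
    forall k i j, mmoment mp mn k i j = \sum_r d r ^+ k * (v r i * v r j).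
Proof.
exists ap, an; have mvE A i j : mval ap an A i j = \sum_r c i j r * (d r \in A)%:R.
  by rewrite mxE !atomsE /= -sumrB; apply: eq_bigr => r _; rewrite net.
split; last first.
  move=> k i j; rewrite mxE !integral_atoms /= -sumrB; apply: eq_bigr => r _.
  by rewrite net mulrC.
split.
- by move=> i j; rewrite !atomsE !ltry.
- move=> i j; rewrite !atomsE; split; rewrite big1 // => r _;
  by rewrite memNset ?mulr0 //= => h; apply: h; exact: d01.
- move=> A mA _; pose D := diag_mx (\row_r ((d r \in A)%:R : R)).
  have -> : mval ap an A = v^T *m D *m v.
    apply/matrixP => i j; rewrite mvE mul_mx_diag mxE; apply: eq_bigr => r _.
    by rewrite !mxE /c; ring.
  apply: psd_congrT; split; first by rewrite tr_diag_mx.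
  move=> w; rewrite -/(qf _ _) qf_diag sumr_ge0 // => r _.
  by rewrite mxE mulr_ge0 ?sqr_ge0.
- apply/matrixP => i j; rewrite mvE mxE -v1; apply: eq_bigr => r _.
  by rewrite mem_set ?mulr1 //; exact: d01.
Qed.

End Atoms.

Lemma SseqE n (x : coordT p n -> R) k (h : (k < n)%N) : Sseq x k.+1 = symm x (Ordinal h).
Proof. by rewrite /Sseq insubT. Qed.

Lemma moment_space_odd m (x : coordT p m.*2.+1 -> R) : inside m.*2.+1 (Sseq x) -> moment_space x.
Proof.
move=> iS; have sS := Sseq_sym x; have S0 : Sseq x 0 = 1%:M by [].
have [n [d [v [d01 vE]]]] := hankel_atoms sS
  (interior_hk p0 sS S0 iS (leqnSn _))
  (pd_psd (interior_hk_shS p0 sS iS (m := m.+1) (leqnn _)))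
  (pd_psd (interior_hk_dfS p0 sS S0 iS (m := m.+1) (leqnn _))).
have v1 i j : \sum_r v r i * v r j = (i == j)%:R.
  have := vE 0%N isT i j; rewrite S0 mxE => ->.
  by apply: eq_bigr => r _; rewrite mul1r.
have [mp [mn [mm mE]]] := atoms_measure d01 v1.
exists mp, mn; split=> // l; apply/matrixP => i j; rewrite mE -vE; last exact: ltn_ord.
by rewrite /Sseq valK.
Qed.

(** The atoms reproduce an odd number of moments. For even [n] one more moment is appended, the
    midpoint of its admissible interval, which keeps the sequence interior. *)
Lemma moment_space_inside n (x : coordT p n -> R) : inside n (Sseq x) -> moment_space x.
Proof.
move=> iS; have sS := Sseq_sym x; have S0 : Sseq x 0 = 1%:M by [].
have [m nE] : exists m, n = m.*2.+1 \/ n = m.*2.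
  by exists n./2; have := odd_double_half n; case: odd; lia.
case: nE => nE; subst n; first exact: moment_space_odd.
pose g := gap (Sseq x) m.*2.+1; have pg : pd g by apply: gap_pd.
pose M := Sminus (Sseq x) m.*2.+1 + 2^-1 *: g.
pose y (c : coordT p m.*2.+1) : R := M c.1.2 c.2.
pose x' (c : coordT p m.*2.+1) : R :=
  if @insub _ (fun i => i < m.*2)%N 'I_m.*2 c.1.1 is Some l then x (l, c.1.2, c.2) else y c.
have sM : M^T = M.
  have tE (A B : 'M[R]_p) : (A + 2^-1 *: B)^T = A^T + 2^-1 *: B^T.
    by apply/matrixP => i j; rewrite !mxE.
  by rewrite /M tE pg.1 Sminus_sym.
have eS k : (k < m.*2.+1)%N -> Sseq x' k = Sseq x k.
  case: k => [|k] // km; have k1 : (k < m.*2)%N by lia.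
  have k2 : (k < m.*2.+1)%N by lia.
  rewrite (SseqE x' k2) (SseqE x k1); apply/matrixP => i j; rewrite !mxE /x' /=.
  by rewrite (insubT (fun i => i < m.*2)%N k1).
have eM : Sseq x' m.*2.+1 = M.
  rewrite (SseqE x' (ltnSn _)); apply/matrixP => i j.
  rewrite mxE /x' /= insubF ?ltnn // /y /=; case: ifP => // _.
  by have := congr1 (fun A : 'M[R]_p => A i j) sM; rewrite mxE.
have iS' : inside m.*2.+1 (Sseq x').
  move=> k /andP[k0 km].
  have eSm : Sminus (Sseq x') k = Sminus (Sseq x) k.
    by apply: eq_Sminus => // j jk; apply: eS; lia.
  have eSp : Splus (Sseq x') k = Splus (Sseq x) k.
    by apply: eq_Splus => // j jk; apply: eS; lia.
  rewrite eSm eSp; move: km; rewrite leq_eqVlt => /predU1P[kE|km]; last first.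
    by rewrite eS //; apply: iS; lia.
  rewrite kE eM; split.
    by rewrite /M addrAC subrr add0r; apply: pdZ => //; lra.
  rewrite /M opprD addrA -/(gap _ _) -/g -{1}[g]scale1r -scalerBl.
  by apply: pdZ => //; lra.
have [mp [mn [mm mE]]] := moment_space_odd iS'.
exists mp, mn; split=> // l.
have lt : (l < m.*2.+1)%N by have := ltn_ord l; lia.
rewrite -(mE (Ordinal lt)); have := eS l.+1 (ltn_ord l).
by rewrite /Sseq valK (insubT (fun i => i < m.*2.+1)%N lt) /= => ->.
Qed.

End MomentSufficiency.

(** * Iterated Lebesgue integrals *)

Section OneDimensional.
Variable R : realType.
Local Notation RM := (measurableTypeR R).
Local Notation leb := (@lebesgue_measure R).

Import HBNNSimple.

(** [F] and [G] need not be measurable: the integral is still a difference of suprema over simple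
    functions, and cutting a simple function to zero on [N] leaves its integral unchanged. *)
Lemma integral_eq_off_null (F G : RM -> \bar R) (N : set RM) :
  measurable N -> leb N = 0%E -> (forall t, ~ N t -> F t = G t) ->
  (\int[leb]_t F t = \int[leb]_t G t)%E.
Proof.
move=> mN N0; have half (f g : RM -> \bar R) : (forall t, ~ N t -> f t = g t) ->
    (forall t, (0 <= g t)%E) ->
    (ereal_sup [set sintegral leb h | h in [set h : {nnsfun RM >-> R} | forall x, (h x)%:E <= f x]] <=
     ereal_sup [set sintegral leb h | h in [set h : {nnsfun RM >-> R} | forall x, (h x)%:E <= g x]])%E.
  move=> fg g0; apply: ge_ereal_sup => _ [h /= hf <-].
  have mC := measurableC mN; pose h' := proj_nnsfun h mC.
  have h'E t : h' t = h t * \1_(~` N) t by [].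
  apply: ereal_sup_ubound; exists h'.
    move=> t; rewrite h'E indicE; have [Nt|Nt] := pselect (N t).
      by rewrite memNset ?mulr0 //=; apply.
    by rewrite mem_set // mulr1 -fg.
  rewrite -!integralT_nnsfun; apply: (ge0_ae_eq_integral measurableT).
  - exact/measurable_EFinP/measurable_funPT.
  - exact/measurable_EFinP/measurable_funPT.
  - by move=> t _; rewrite lee_fin.
  - by move=> t _; rewrite lee_fin.
  exists N; split => // t /= h1; apply: contrapT => Nt; apply: h1 => _.
  by rewrite -[LHS]/((h' t)%:E) h'E indicE mem_set // mulr1.
have nn (f g : RM -> \bar R) : (forall t, ~ N t -> f t = g t) ->
    (forall t, (0 <= f t)%E) -> (forall t, (0 <= g t)%E) ->
    (ereal_sup [set sintegral leb h | h in [set h : {nnsfun RM >-> R} | forall x, (h x)%:E <= f x]] =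
     ereal_sup [set sintegral leb h | h in [set h : {nnsfun RM >-> R} | forall x, (h x)%:E <= g x]])%E.
  move=> fg f0 g0; apply/eqP; rewrite eq_le !half // => t Nt.
  by rewrite fg.
move=> FG; rewrite /integral !patch_setT.
congr (_ - _)%E; apply: nn => [t Nt|t|t]; rewrite ?funepos_ge0 ?funeneg_ge0 //.
  by rewrite !funeposE FG.
by rewrite !funenegE FG.
Qed.

Lemma Rintegral_eq_off_null (F G : RM -> R) (N : set RM) :
  measurable N -> leb N = 0%E -> (forall t, ~ N t -> F t = G t) ->
  Rintegral leb setT F = Rintegral leb setT G.
Proof.
move=> mN N0 FG; congr fine; apply: (integral_eq_off_null mN N0) => t Nt.
by rewrite FG.
Qed.

Lemma Rintegral_eq_off_finite (F G : RM -> R) (s : seq R) :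
  (forall t, t \notin s -> F t = G t) -> Rintegral leb setT F = Rintegral leb setT G.
Proof.
move=> FG; pose N : set RM := [set` s].
have cN : countable N by apply: finite_set_countable; exact: finite_seq.
apply: (@Rintegral_eq_off_null _ _ N).
- exact: countable_measurable.
- exact: countable_lebesgue_measure0.
- by move=> t /= /negP; exact: FG.
Qed.

Section Affine.
Variables (c d : R).
Hypothesis c0 : c != 0.
Let th (t : RM) : RM := c * t + d.

Let mth : measurable_fun setT th.
Proof. by apply: measurable_funD => //; exact: mulrl_measurable. Qed.

Let pf : {measure set RM -> \bar R}.
Proof. by refine (pushforward leb th); exact: mth. Defined.

Let nu : {measure set RM -> \bar R} := mscale (NngNum (normr_ge0 c)) pf.

(** The pushforward under [th], scaled by [|c|], agrees with Lebesgue measure on half-open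
    intervals; uniqueness does the rest. For negative [c] the preimage of such an interval is open
    at the other end. *)
Let lebE (A : set RM) : measurable A -> leb A = (`|c|%:E * leb (th @^-1` A))%E.
Proof.
move=> mA; transitivity (nu A); last by rewrite /nu /= /mscale.
apply: lebesgue_measure_unique => //= X [[a b] _ <-] /=.
rewrite /mscale /= /pushforward /=.
have c0' : 0 < `|c| by rewrite normr_gt0.
have [cp|cn] := ltrP 0 c.
  have -> : th @^-1` `]a, b]%classic = `](a - d) / c, (b - d) / c]%classic.
    apply/seteqP; split => t /=; rewrite !in_itv /= /th ltr_pdivrMr // ler_pdivlMr //;
    by rewrite ltrBlDr lerBrDr [t * c]mulrC.
  rewrite !lebesgue_measure_itv /= !lte_fin ltr_pM2r ?invr_gt0 // ltrD2r.
  case: ifP => // _; last by rewrite mule0.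
  rewrite -!EFinB -EFinM gtr0_norm //; congr (_%:E); field.
  by rewrite gt_eqF.
have {}cn : c < 0 by rewrite lt_neqAle c0.
have -> : th @^-1` `]a, b]%classic = `[(b - d) / c, (a - d) / c[%classic.
  apply/seteqP; split => t /=; rewrite !in_itv /= /th ler_ndivrMr // ltr_ndivlMr //;
  by rewrite ltrBlDr lerBrDr [t * c]mulrC andbC.
rewrite !lebesgue_measure_itv /= !lte_fin ltr_nM2r ?invr_lt0 // ltrD2r.
case: ifP => // _; last by rewrite mule0.
rewrite -!EFinB -EFinM ltr0_norm //; congr (_%:E); field.
by rewrite lt_eqF.
Qed.

(** Integrability is not assumed. Infinite positive or negative parts stay infinite under the
    positive factor, so even their difference scales. *)
Lemma integral_affine (F : RM -> \bar R) : measurable_fun setT F ->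
  (\int[leb]_t F (c * t + d)%R = (`|c|^-1)%:E * \int[leb]_t F t)%E.
Proof.
have c0' : 0 < `|c| by rewrite normr_gt0.
have ge0E (f : RM -> \bar R) : measurable_fun setT f -> (forall t, (0 <= f t)%E) ->
    (\int[leb]_t f (c * t + d)%R = (`|c|^-1)%:E * \int[leb]_t f t)%E.
  move=> mf f0; have -> : (\int[leb]_t f t)%E = (\int[nu]_t f t)%E.
    by apply: eq_measure_integral => A mA _; rewrite [LHS](lebE mA).
  rewrite /nu ge0_integral_mscale //= muleA -EFinM mulVf ?gt_eqF // mul1e.
  by rewrite (ge0_integral_pushforward mth).
move=> mF; rewrite [LHS]integralE [X in (_ * X)%E]integralE.
have e1 : (fun t : RM => F (c * t + d)%R)^\+%E = (fun t : RM => F^\+ (c * t + d)%R)%E := funepos_comp F th.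
have e2 : (fun t : RM => F (c * t + d)%R)^\-%E = (fun t : RM => F^\- (c * t + d)%R)%E := funeneg_comp F th.
rewrite e1 e2 !ge0E; [|exact: measurable_funeneg| by [] |exact: measurable_funepos| by []].
have k0 : 0 < `|c|^-1 by rewrite invr_gt0.
case: (\int[leb]_t F^\+ t)%E => [x| |]; case: (\int[leb]_t F^\- t)%E => [y| |] //=;
  rewrite ?gt0_muley ?gt0_muleNy ?lte_fin //=.
- by congr (_%:E); rewrite mulrBr.
Qed.

Lemma Rintegral_affine (F : RM -> R) : measurable_fun setT F ->
  Rintegral leb setT (fun t => F (c * t + d)) = `|c|^-1 * Rintegral leb setT F.
Proof.
move=> mF; rewrite /Rintegral (@integral_affine (EFin \o F)); last exact/measurable_EFinP.
have k0 : 0 < `|c|^-1 by rewrite invr_gt0 normr_gt0.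
case: (integral _ _ _) => [x| |] //=; rewrite ?gt0_muley ?gt0_muleNy ?lte_fin //= mulr0 //.
Qed.

End Affine.
End OneDimensional.

Lemma poly_roots_seq (F : fieldType) (P : {poly F}) : P != 0 -> exists rs : seq F, forall t, root P t -> t \in rs.
Proof.
have [n] := ubnP (size P); elim: n P => // n IH P sP P0.
have [[t rt]|no] := pselect (exists t, root P t); last first.
  by exists [::] => t rt; case: no; exists t.
have /factor_theorem [Q PE] := rt.
have Q0 : Q != 0 by apply: contra P0 => /eqP Q0; rewrite PE Q0 mul0r.
have [|//|rs rsP] := IH Q; first by move: sP; rewrite PE size_Mmonic ?monicXsubC // size_XsubC addn2.
exists (t :: rs) => u; rewrite PE rootM root_XsubC inE => /orP[/rsP ->|->] //.
by rewrite orbT.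
Qed.

(** * Measurability and null sets for iterated integrals *)

Section Cylinder.
Variables (R : realType).
Local Notation RM := (measurableTypeR R).
Local Notation leb := (@lebesgue_measure R).

(* [T] may be infinite: the integrals below only ever involve finitely many coordinates. *)
Definition cyl (T : Type) : set (set (T -> R)) :=
  [set A | exists a (B : set RM), measurable B /\ A = (fun x => x a) @^-1` B].
Definition Xtype (T : Type) := g_sigma_algebraType (@cyl T).

Lemma measurable_coord (T : Type) (a : T) : measurable_fun setT (fun x : Xtype T => x a : RM).
Proof.
move=> _ B mB; rewrite setTI; apply: sub_sigma_algebra.
by exists a, B.
Qed.

Lemma measurable_to_Xtype d (S : measurableType d) (T : Type) (F : S -> Xtype T) :
  (forall a, measurable_fun setT (fun s => F s a : RM)) -> measurable_fun setT F.
Proof.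
move=> mF; apply: (@measurability _ _ _ _ setT F (@cyl T)) => //.
move=> _ [_ [a [B [mB ->]]] <-]; rewrite setTI.
by have := mF a measurableT B mB; rewrite setTI.
Qed.

Section Iint.
Variable T : eqType.
Implicit Types (s : seq T) (g : (T -> R) -> R) (x y : T -> R).

Lemma updE x a t b : upd x a t b = if b == a then t else x b.
Proof. by []. Qed.

Lemma upd_eq x a t : upd x a t a = t.
Proof. by rewrite updE eqxx. Qed.

Lemma upd_neq x a t b : b != a -> upd x a t b = x b.
Proof. by rewrite updE => /negPf ->. Qed.

Lemma updC x a b t u : a != b -> upd (upd x a t) b u = upd (upd x b u) a t.
Proof.
move=> ab; apply/funext => c; rewrite !updE.
by case: (eqVneq c b) => // ->; rewrite eq_sym (negPf ab).
Qed.

Definition meas g := measurable_fun setT (g : Xtype T -> RM).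

Lemma measurable_upd a :
  measurable_fun setT (fun z : Xtype T * RM => upd z.1 a z.2 : Xtype T).
Proof.
apply: measurable_to_Xtype => b; rewrite /upd.
case: (eqVneq b a) => _; first exact: measurable_snd.
by apply: (measurableT_comp (measurable_coord b)); exact: measurable_fst.
Qed.

Lemma measurable_upd1 x a : measurable_fun setT (fun t : RM => upd x a t : Xtype T).
Proof.
apply: measurable_to_Xtype => b; rewrite /upd.
by case: (eqVneq b a) => _; [exact: measurable_id | exact: measurable_cst].
Qed.

Lemma iint_cat s1 s2 g x : iint (s1 ++ s2) g x = iint s1 (iint s2 g) x.
Proof. by elim: s1 x => //= a s1 IH x; apply: eq_Rintegral => t _; rewrite IH. Qed.

Lemma eq_iint s g g' x : (forall y, (forall b, b \notin s -> y b = x b) -> g y = g' y) ->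
  iint s g x = iint s g' x.
Proof.
elim: s x => [|a s IH] x e /=; first by apply: e.
apply: eq_Rintegral => t _; apply: IH => y yE; apply: e => b.
by rewrite inE negb_or => /andP[ba bs]; rewrite yE // upd_neq.
Qed.

Lemma iint_local s g x y : (forall b, b \notin s -> x b = y b) -> iint s g x = iint s g y.
Proof.
elim: s x y => [|a s IH] x y e /=.
  by congr g; apply/funext => b; apply: e.
apply: eq_Rintegral => t _; apply: IH => b bs; rewrite !updE.
by case: eqVneq => // ba; apply: e; rewrite inE negb_or ba.
Qed.

(** Tonelli makes the integrals of the positive and of the negative part measurable in the remaining
    variables; their difference followed by [fine] stays measurable even where both are infinite. *)
Lemma meas_iint s g : meas g -> meas (iint s g).
Proof.
elim: s => //= a s IH /IH {IH}; move: (iint s g) => {s} {}g mg.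
pose f (z : Xtype T * RM) := (g (upd z.1 a z.2))%:E.
have mf : measurable_fun setT f.
  by apply/measurable_EFinP; exact: (measurableT_comp mg (measurable_upd a)).
have -> : (fun x => Rintegral leb setT (fun t : RM => g (upd x a t))) =
    fun x : Xtype T => fine (\int[leb]_t (f^\+ (x, t)) - \int[leb]_t (f^\- (x, t)))%E.
  apply/funext => x; rewrite /Rintegral -[fun t => _]/(f \o pair x) integralE.
  by rewrite funepos_comp funeneg_comp.
apply: measurableT_comp; first exact: fine_measurable.
apply: emeasurable_funB.
  apply: (measurable_fun_fubini_tonelli_F (m2 := leb)) => //; exact: measurable_funepos.
apply: (measurable_fun_fubini_tonelli_F (m2 := leb)) => //; exact: measurable_funeneg.
Qed.

(* A polynomial that is not identically zero vanishes at finitely many points of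
   almost every line, so neither [g1] nor [g2] needs to be measurable. *)
Lemma iint_off_null s g1 g2 (q : (T -> R) -> R) x :
  (forall y a, exists P : {poly R}, forall t, q (upd y a t) = P.[t]) ->
  (exists2 y, (forall b, b \notin s -> y b = x b) & q y != 0) ->
  (forall y, (forall b, b \notin s -> y b = x b) -> q y != 0 -> g1 y = g2 y) ->
  iint s g1 x = iint s g2 x.
Proof.
move=> qP; elim: s x => [|a s IH] x [y yx qy] e /=.
  have <- : y = x by apply/funext => b; exact: yx.
  exact: e.
have [P PE] := qP y a.
have P0 : P != 0.
  apply: contraNneq qy => P0; have := PE (y a); rewrite P0 horner0 => <-.
  by apply/eqP; congr q; apply/funext => b; rewrite updE; case: eqVneq => [->|].
have [r rP] := poly_roots_seq P0.
apply: (Rintegral_eq_off_finite (s := r)) => t tr; apply: IH; last first.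
  move=> z zE; apply: e => b; rewrite inE negb_or => /andP[ba bs].
  by rewrite zE // upd_neq.
exists (upd y a t).
  move=> b bs; rewrite !updE; case: eqVneq => // ba; apply: yx.
  by rewrite inE negb_or ba.
by rewrite PE; apply: contra tr => r0; apply: rP.
Qed.

End Iint.
End Cylinder.

(** * Dominated iterated integrals *)

Section Dominated.
Variables (R : realType) (T : eqType).
Local Notation RM := (measurableTypeR R).
Local Notation leb := (@lebesgue_measure R).
Implicit Types (s : seq T) (g : (T -> R) -> R) (x y : T -> R).

Variable phi : RM -> R.
Hypothesis mphi : measurable_fun setT phi.
Hypothesis phi0 : forall t, 0 <= phi t.
Hypothesis iphi : leb.-integrable setT (EFin \o phi).
Let K := Rintegral leb setT phi.

Lemma integrable_scale (k : R) (F : RM -> R) : leb.-integrable setT (EFin \o F) ->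
  leb.-integrable setT (EFin \o (fun t => k * F t)).
Proof.
move=> iF; rewrite (_ : EFin \o _ = (fun t => k%:E * (EFin \o F) t)%E).
  exact: integrableZl.
by apply/funext => t; rewrite /= EFinM.
Qed.

(* Domination by a product of one-dimensional envelopes passes to each partial
   integral, so Fubini and dominated convergence are only ever used in one variable. *)
Definition env s x := \prod_(a <- s) phi (x a).
Definition dom s (C : (T -> R) -> R) g :=
  [/\ forall x, `|g x| <= C x * env s x, forall x, 0 <= C x &
      forall a x t, a \in s -> C (upd x a t) = C x].

Lemma dom_env_cons a s x : env (a :: s) x = phi (x a) * env s x.
Proof. by rewrite /env big_cons. Qed.

(** The envelope factor of the outer variable is absorbed into [C]; this is why [C] is a function,
    constant only along the variables still to be integrated. *)
Lemma dom_tail a s C g : a \notin s -> dom (a :: s) C g -> dom s (fun x => C x * phi (x a)) g.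
Proof.
move=> as_ [gC C0 Cs]; split=> [x|x|b x t bs].
- by rewrite -mulrA -dom_env_cons.
- by rewrite mulr_ge0.
- rewrite Cs ?inE ?bs ?orbT // upd_neq //.
  by apply: contraNneq as_ => ->.
Qed.

Lemma K_ge0 : 0 <= K.
Proof. by apply: Rintegral_ge0 => t _. Qed.

Lemma integrable_le_phi (F : RM -> R) c : measurable_fun setT F ->
  (forall t, `|F t| <= c * phi t) ->
  leb.-integrable setT (EFin \o F) /\ `|Rintegral leb setT F| <= c * K.
Proof.
move=> mF Fc.
have icp : leb.-integrable setT (EFin \o (fun t => c * phi t)).
  exact: integrable_scale.
have iF : leb.-integrable setT (EFin \o F).
  apply: (le_integrable _ _ _ icp) => //; first exact/measurable_EFinP.
  by move=> t _; rewrite /= lee_fin (le_trans (Fc t)) // ler_norm.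
split=> //; rewrite (le_trans (le_normr_Rintegral _ iF)) // /K -RintegralZl //.
apply: le_Rintegral => //.
by have := integrable_abse iF.
Qed.

Lemma meas_upd1 g x a : meas g -> measurable_fun setT (fun t : RM => g (upd x a t) : RM).
Proof. by move=> mg; exact: (measurableT_comp mg (measurable_upd1 x a)). Qed.

Lemma iint_bound s C g x : uniq s -> meas g -> dom s C g -> `|iint s g x| <= C x * K ^+ size s.
Proof.
elim: s C x => [|a s IH] C x /=; first by move=> _ _ [gC _ _]; have := gC x; rewrite /env big_nil.
move=> /andP[as_ us] mg dg; have dt := dom_tail as_ dg.
have [_ _ Cs] := dg.
have mi : measurable_fun setT (fun t : RM => iint s g (upd x a t) : RM).
  exact: (meas_upd1 _ _ (meas_iint s mg)).
have [|_] := @integrable_le_phi _ (C x * K ^+ size s) mi.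
  move=> t; rewrite (le_trans (IH _ _ us mg dt)) // upd_eq Cs ?inE ?eqxx //.
  by rewrite mulrAC.
by rewrite exprSr mulrA.
Qed.

Lemma iint_integrable a s C g x : uniq (a :: s) -> meas g -> dom (a :: s) C g ->
  leb.-integrable setT (EFin \o (fun t : RM => iint s g (upd x a t))).
Proof.
move=> /= /andP[as_ us] mg dg; have dt := dom_tail as_ dg.
have [_ _ Cs] := dg.
have mi : measurable_fun setT (fun t : RM => iint s g (upd x a t) : RM).
  exact: (meas_upd1 _ _ (meas_iint s mg)).
have [|//] := @integrable_le_phi _ (C x * K ^+ size s) mi.
move=> t; rewrite (le_trans (iint_bound _ us mg dt)) // upd_eq Cs ?inE ?eqxx //.
by rewrite mulrAC.
Qed.

Lemma iintM s C g h x : uniq s -> meas g -> dom s C g ->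
  (forall a y t, a \in s -> h (upd y a t) = h y) ->
  iint s (fun y => h y * g y) x = h x * iint s g x.
Proof.
elim: s C x => [//|a s IH] C x us mg dg hs /=.
have ig := iint_integrable x us mg dg.
rewrite -RintegralZl //; apply: eq_Rintegral => t _.
move: us => /= /andP[as_ us]; rewrite (IH _ _ us mg (dom_tail as_ dg)).
  by rewrite hs ?inE ?eqxx.
by move=> b y u bs; apply: hs; rewrite inE bs orbT.
Qed.

Lemma iint_ge0 s g x : (forall y, 0 <= g y) -> 0 <= iint s g x.
Proof. by move=> g0; elim: s x => //= a s IH x; apply: Rintegral_ge0. Qed.

(** Each variable is restricted to an interval of length [e] to the right of [z a], where [g] is at
    least [c]. *)
Lemma iint_gt0 s C g x z (e c : R) : uniq s -> meas g -> dom s C g -> (forall y, 0 <= g y) ->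
  0 < e -> 0 < c ->
  (forall y, (forall b, b \notin s -> y b = x b) -> (forall a, a \in s -> `|y a - z a| < e) -> c <= g y) ->
  c * e ^+ size s <= iint s g x.
Proof.
move=> + mg + g0 e0 c0; elim: s C x => [|a s IH] C x us dg h /=.
  by rewrite mulr1; apply: h.
have ig := iint_integrable x us mg dg.
have /= /andP[as_ us'] := us.
set k := c * e ^+ size s.
have k0 : 0 <= k by rewrite mulr_ge0 ?exprn_ge0 // ltW.
have me : measurable `[z a, z a + e[%classic by exact: measurable_itv.
have lee : leb `[z a, z a + e[%classic = e%:E.
  by rewrite lebesgue_measure_itv /= lte_fin ltrDl e0 -EFinB addrAC subrr add0r.
have i1 : leb.-integrable setT (EFin \o (\1_(`[z a, z a + e[%classic) : RM -> R)).
  exact: integrable_indic_itv.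
have -> : c * e ^+ (size s).+1 = Rintegral leb setT (fun t => k * \1_(`[z a, z a + e[%classic) t).
  rewrite RintegralZl // (_ : Rintegral _ _ _ = e) ?exprSr ?mulrA //.
  by rewrite /Rintegral integral_indic // setIT; exact: (congr1 fine lee).
apply: le_Rintegral => //.
  exact: integrable_scale.
move=> t _; rewrite indicE; have [|_] := boolP (t \in _); last first.
  by rewrite mulr0; exact: iint_ge0.
rewrite inE /= in_itv /= => /andP[t1 t2]; rewrite mulr1.
apply: IH us' (dom_tail as_ dg) _ => y yx yz; apply: h.
  move=> b; rewrite inE negb_or => /andP[ba bs].
  by rewrite yx // upd_neq.
move=> b; rewrite inE => /orP[/eqP ->|]; last exact: yz.
rewrite yx // upd_eq ger0_norm ?subr_ge0 //; lra.
Qed.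

Lemma iint_cvg s C (g_ : nat -> (T -> R) -> R) g x : uniq s -> (forall n, meas (g_ n)) -> meas g ->
  (forall n, dom s C (g_ n)) -> (forall y, g_ n y @[n --> \oo] --> g y) ->
  iint s (g_ n) x @[n --> \oo] --> iint s g x.
Proof.
elim: s C x => [|a s IH] C x us mg_ mg dg gg /=; first exact: gg.
have /= /andP[as_ us'] := us.
have dt n := dom_tail as_ (dg n).
have [_ C0 Cs] := dg 0%N.
have icp : leb.-integrable setT (EFin \o (fun t => C x * K ^+ size s * phi t)).
  exact: integrable_scale.
have m1 h : meas h -> measurable_fun setT (EFin \o (fun t : RM => iint s h (upd x a t))).
  by move=> mh; apply/measurable_EFinP; exact: (meas_upd1 _ _ (meas_iint s mh)).
pose F n (t : RM) := (iint s (g_ n) (upd x a t))%:E.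
pose G (t : RM) := (iint s g (upd x a t))%:E.
have FG : {ae leb, forall t, setT t -> F ^~ t @ \oo --> G t}.
  apply: aeW => t _; apply: cvg_EFin; first exact: nearW.
  exact: (IH _ (upd x a t) us' mg_ mg dt gg).
pose B (t : RM) : \bar R := (C x * K ^+ size s * phi t)%:E.
have Fb : {ae leb, forall t n, setT t -> (`|F n t| <= B t)%E}.
  apply: aeW => t n _; rewrite /F /B /= lee_fin.
  rewrite (le_trans (iint_bound _ us' (mg_ n) (dt n))) // upd_eq Cs ?inE ?eqxx //.
  by rewrite mulrAC.
have [iG _ cv] := dominated_convergence measurableT (fun n => m1 _ (mg_ n)) (m1 _ mg) FG icp Fb.
have fG : (\int[leb]_t G t)%E = (fine (\int[leb]_t G t)%E)%:E.
  by rewrite fineK //; exact: (integrable_fin_num measurableT iG).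
by rewrite /G in fG; rewrite fG in cv; exact: (fine_cvg cv).
Qed.

Lemma dom_cvg s C (g_ : nat -> (T -> R) -> R) g : (forall n, dom s C (g_ n)) ->
  (forall y, g_ n y @[n --> \oo] --> g y) -> dom s C g.
Proof.
move=> dg gg; have [_ C0 Cs] := dg 0%N; split=> // y.
have cn : `|g_ n y| @[n --> \oo] --> `|g y| by apply: cvg_norm; exact: gg.
rewrite -(cvg_lim (@Rhausdorff R) cn); apply: limr_le; first by apply/cvg_ex; exists `|g y|.
by apply: nearW => n; have [h _ _] := dg n.
Qed.

(** After the inner integrals the integrand is bounded by a constant times [phi t * phi u], hence
    integrable on the plane, and Fubini applies to the two outer variables. *)
Lemma iint_swap a b s C g x : uniq [:: a, b & s] -> meas g -> dom [:: a, b & s] C g ->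
  iint [:: a, b & s] g x = iint [:: b, a & s] g x.
Proof.
move=> /= /and3P[]; rewrite inE negb_or => /andP[ab as_] bs us mg dg.
have [gC C0 Cs] := dg.
pose f (z : RM * RM) := (iint s g (upd (upd x a z.1) b z.2))%:E.
pose c := C x * K ^+ size s.
have c0 : 0 <= c by rewrite mulr_ge0 ?exprn_ge0 ?K_ge0.
have mf : measurable_fun setT f.
  apply/measurable_EFinP; apply: (measurableT_comp (meas_iint s mg)).
  apply: measurable_to_Xtype => d; rewrite /upd.
  case: (eqVneq d b) => _; first exact: measurable_snd.
  by case: (eqVneq d a) => _; [exact: measurable_fst | exact: measurable_cst].
have dt : dom s (fun y => C y * phi (y a) * phi (y b)) g.
  by apply: dom_tail => //; apply: dom_tail => //; rewrite inE negb_or ab as_.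
have fb t u : `|iint s g (upd (upd x a t) b u)| <= c * phi t * phi u.
  rewrite (le_trans (iint_bound _ us mg dt)) // upd_eq upd_neq // upd_eq.
  rewrite !Cs ?inE ?eqxx ?orbT // /c le_eqVlt; apply/orP; left; apply/eqP; ring.
have If t : leb.-integrable setT (fun u => f (t, u)) /\
    `|Rintegral leb setT (fun u => iint s g (upd (upd x a t) b u))| <= c * phi t * K.
  exact: (integrable_le_phi (meas_upd1 (upd x a t) b (meas_iint s mg)) (fb t)).
have If' u : leb.-integrable setT (fun t => f (t, u)).
  have mu' : measurable_fun setT (fun t : RM => iint s g (upd (upd x a t) b u) : RM).
    under eq_fun do rewrite updC //.
    exact: (meas_upd1 _ _ (meas_iint s mg)).
  have bu t : `|iint s g (upd (upd x a t) b u)| <= c * phi u * phi t by rewrite mulrAC.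
  exact: (integrable_le_phi mu' bu).1.
have iprod : (leb \x leb)%E.-integrable setT f.
  apply/(integrable12ltyP _ _ mf).
  apply: (@le_lt_trans _ _ (\int[leb]_t (c * K * phi t)%:E)%E).
    apply: ge0_le_integral => //.
    - by move=> t _; exact: integral_ge0.
    - apply: (measurable_fun_fubini_tonelli_F (m2 := leb) (abse \o f)) => //.
        exact: measurableT_comp.
      by move=> z; exact: abse_ge0.
    - apply/measurable_EFinP; apply: measurable_funM => //.
    move=> t _; have iphi' : leb.-integrable setT (EFin \o (fun u => c * phi t * phi u)).
      exact: integrable_scale.
    apply: (@le_trans _ _ (\int[leb]_u (c * phi t * phi u)%:E)%E).
      apply: ge0_le_integral => //.
      - by apply: measurableT_comp => //; case/integrableP: (If t).1.
      - by case/integrableP: iphi'.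
      by move=> u _; rewrite lee_fin fb.
    rewrite -[X in (X <= _)%E]fineK; last exact: (integrable_fin_num measurableT iphi').
    by rewrite lee_fin -/(Rintegral _ _ _) RintegralZl // mulrAC.
  have iphi' : leb.-integrable setT (EFin \o (fun u => c * K * phi u)).
    exact: integrable_scale.
  rewrite -[X in (X < _)%E]fineK ?ltry //; exact: (integrable_fin_num measurableT iphi').
have := Fubini iprod; rewrite /=.
have -> : (fun t => \int[leb]_u f (t, u))%E =
    EFin \o (fun t => Rintegral leb setT (fun u => iint s g (upd (upd x a t) b u))).
  apply/funext => t; rewrite /= fineK //; exact: (integrable_fin_num measurableT (If t).1).
have -> : (fun u => \int[leb]_t f (t, u))%E =
    EFin \o (fun u => Rintegral leb setT (fun t => iint s g (upd (upd x b u) a t))).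
  apply/funext => u; rewrite /= /Rintegral fineK.
    by apply: eq_integral => t _; rewrite updC // eq_sym.
  have := integrable_fin_num measurableT (If' u).
  rewrite (_ : integral _ _ _ = (\int[leb]_t (iint s g (upd (upd x b u) a t))%:E)%E) //.
  by apply: eq_integral => t _; rewrite /f updC // eq_sym.
by move=> e; rewrite /Rintegral e.
Qed.

Lemma iint_prod s (psi : T -> RM -> R) x (c : T -> R) : uniq s ->
  (forall a, measurable_fun setT (psi a)) -> (forall a t, `|psi a t| <= c a * phi t) ->
  iint s (fun y => \prod_(a <- s) psi a (y a)) x = \prod_(a <- s) Rintegral leb setT (psi a).
Proof.
move=> + mpsi psic; elim: s x => [|a s IH] x /=; first by rewrite !big_nil.
move=> /andP[as_ us].
have mP : meas (fun y => \prod_(a <- s) psi a (y a)).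
  elim: s {IH as_ us} => [|b s IHs]; first by under eq_fun do rewrite big_nil; exact: measurable_cst.
  under eq_fun do rewrite big_cons; apply: measurable_funM => //.
  exact: (measurableT_comp (mpsi b) (measurable_coord b)).
have dP : dom s (cst (\prod_(a <- s) `|c a|)) (fun y => \prod_(a <- s) psi a (y a)).
  split=> [y|y|//]; last by rewrite prodr_ge0.
  rewrite normr_prod /env -big_split /=; apply: ler_prod => b _.
  by rewrite normr_ge0 (le_trans (psic _ _)) // ler_wpM2r // ler_norm.
rewrite big_cons mulrC -RintegralZl //; last first.
  exact: (integrable_le_phi (mpsi a) (psic a)).1.
apply: eq_Rintegral => t _.
rewrite (eq_iint (g' := fun y => psi a (y a) * \prod_(b <- s) psi b (y b))); last first.
  by move=> y _; rewrite big_cons.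
rewrite (@iintM s _ _ (fun y => psi a (y a)) _ us mP dP); last first.
  move=> b y u bs; rewrite upd_neq //; apply: contraNneq as_ => ->; exact: bs.
by rewrite upd_eq IH // mulrC.
Qed.

(** On the box that carries [g], each factor [phi] is at least [m], so [B / m ^+ size s] times the
    envelope dominates; elsewhere [g] vanishes. *)
Lemma dom_box s g (B L : R) : (forall L, exists2 m, 0 < m & forall t, `|t| <= L -> m <= phi t) ->
  (forall x, `|g x| <= B) -> (forall x, g x != 0 -> forall a, a \in s -> `|x a| <= L) ->
  exists C : R, dom s (cst C) g.
Proof.
move=> phiL gB gL; have [m m0 mL] := phiL L.
have B0 : 0 <= B by apply: le_trans (gB (cst 0)).
exists (B / m ^+ size s); split=> // [x|x]; last by rewrite divr_ge0 // exprn_ge0 // ltW.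
have [->|gx] := eqVneq (g x) 0.
  rewrite normr0; apply: mulr_ge0; last exact: prodr_ge0.
  by rewrite /= divr_ge0 // exprn_ge0 // ltW.
rewrite /= mulrAC -mulrA; apply: (le_trans (gB x)); rewrite ler_peMr //.
rewrite ler_pdivlMr ?exprn_gt0 // mul1r /env.
have /allP : all (fun a => m <= phi (x a)) s by apply/allP => a /(gL x gx); exact: mL.
elim: s {gL gx} => [|a s IH] h; first by rewrite big_nil.
rewrite big_cons exprS ler_pM //; [exact: ltW|exact/exprn_ge0/ltW| |].
  by apply: h; rewrite inE eqxx.
by apply: IH => b bs; apply: h; rewrite inE bs orbT.
Qed.

End Dominated.

Lemma iint_map (R : realType) (T T' : eqType) (f : T' -> T) (s : seq T') (g : (T' -> R) -> R) (y : T -> R) :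
  injective f -> iint (map f s) (fun y => g (y \o f)) y = iint s g (y \o f).
Proof.
move=> inj; elim: s y => //= a s IH y; apply: eq_Rintegral => t _; rewrite IH.
by congr iint; apply/funext => b; rewrite /= /upd inj_eq.
Qed.

Section OpenMeasurable.
Variables (R : realType) (F : finType).
Implicit Types (x y : F -> R).
Local Notation RM := (measurableTypeR R).

(** The sigma-algebra is generated by coordinates, so openness must be turned into countably many
    coordinate conditions: [U] is the union of the grid cubes [C (m, z)], of side [1 / (m+1)], that
    it contains. *)
Lemma open_meas (U : set (F -> R)) :
  (forall x, U x -> exists2 e, 0 < e & forall y, (forall a, `|y a - x a| < e) -> U y) ->
  measurable (U : set (Xtype R F)).
Proof.
move=> oU; pose C (mz : nat * {ffun F -> int}) : set (Xtype R F) :=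
  [set x | forall a, Num.floor (x a * mz.1.+1%:R) = mz.2 a].
have mC mz : measurable (C mz).
  have -> : C mz = \big[setI/setT]_(a <- enum F)
      ((fun x : Xtype R F => x a : RM) @^-1` [set t : RM | Num.floor (t * mz.1.+1%:R) = mz.2 a]).
    apply/seteqP; split => [x Cx|x]; rewrite -bigcap_seq; first by move=> a _; exact: Cx.
    by move=> h a; apply: h; rewrite /= mem_enum.
  apply: bigsetI_measurable => a _; rewrite -[X in measurable X]setTI.
  apply: measurable_coord => //.
  have -> : [set t : RM | Num.floor (t * mz.1.+1%:R) = mz.2 a] =
      `[(mz.2 a)%:~R / mz.1.+1%:R, (mz.2 a + 1)%:~R / mz.1.+1%:R[%classic.
    apply/seteqP; split => t /=; rewrite in_itv /= ler_pdivrMr ?ltr0n // ltr_pdivlMr ?ltr0n //.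
      by move=> <-; rewrite floor_le_tmp /= ?floor_itv //; have /andP[] := floor_itv (t * mz.1.+1%:R).
    by move=> h; apply: floor_def.
  exact: measurable_itv.
have -> : U = \bigcup_mz (if `[< C mz `<=` U >] then C mz else set0).
  apply/seteqP; split => [x Ux|x [mz _]]; last by case: asboolP => // h /h.
  have [e e0 he] := oU x Ux; pose m := Num.truncn e^-1.
  have me : 1 < e * m.+1%:R :> R.
    by rewrite mulrC -ltr_pdivrMr // div1r; exact: truncnS_gt.
  exists (m, [ffun a => Num.floor (x a * m.+1%:R)]) => //.
  case: asboolP => [_|h]; first by move=> a /=; rewrite ffunE.
  case: h => y /= Cy; apply: he => a; have := Cy a; rewrite ffunE /= => fE.
  have /andP[y1 y2] := floor_itv (y a * m.+1%:R).
  have /andP[x1 x2] := floor_itv (x a * m.+1%:R).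
  rewrite fE in y1 y2; rewrite intrD in x2 y2.
  have m0 : (0 : R) < m.+1%:R by rewrite ltr0n.
  rewrite -(ltr_pM2r m0) -[X in _ * X < _]gtr0_norm // -normrM mulrBl.
  by rewrite (le_lt_trans _ me) //; rewrite ler_norml; apply/andP; split; lra.
apply: countable_bigcupT_measurable => // mz.
by case: asboolP => _; [exact: mC | exact: measurable0].
Qed.

Lemma continuous_meas (f : (F -> R) -> R) :
  (forall x e, 0 < e -> exists2 d, 0 < d & forall y, (forall a, `|y a - x a| < d) -> `|f y - f x| < e) ->
  meas f.
Proof.
rewrite /meas => cf; apply: (@measurability _ _ (Xtype R F) RM setT f _ (RGenOInfty.measurableE R)).
move=> _ [_ [c ->] <-]; rewrite setTI; apply: open_meas => x /=.
rewrite in_itv /= andbT => cx; have [|d d0 hd] := cf x (f x - c); first by rewrite subr_gt0.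
exists d => // y /hd; rewrite in_itv /= andbT ltr_norml => /andP[h _]; lra.
Qed.
End OpenMeasurable.

Section Permute.
Variables (R : realType) (T : eqType).
Local Notation RM := (measurableTypeR R).
Local Notation leb := (@lebesgue_measure R).
Variable phi : RM -> R.
Hypothesis mphi : measurable_fun setT phi.
Hypothesis phi0 : forall t, 0 <= phi t.
Hypothesis iphi : leb.-integrable setT (EFin \o phi).
Implicit Types (s : seq T) (g : (T -> R) -> R) (x y : T -> R).

Lemma dom_perm s s' C g : perm_eq s s' -> dom phi s C g -> dom phi s' C g.
Proof.
move=> pe [h1 h2 h3]; split=> // [y|c y u cs]; first by rewrite /env -(perm_big _ pe).
by apply: h3; rewrite (perm_mem pe).
Qed.

Lemma iint_front s1 a s2 C g x : uniq (s1 ++ a :: s2) -> meas g -> dom phi (s1 ++ a :: s2) C g ->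
  iint (s1 ++ a :: s2) g x = iint (a :: s1 ++ s2) g x.
Proof.
elim: s1 C x => [//|b s1 IH] C x us mg dg.
have pe : perm_eq (b :: s1 ++ a :: s2) [:: b, a & s1 ++ s2].
  by rewrite perm_cons -cat1s perm_catCA.
have pe' : perm_eq [:: b, a & s1 ++ s2] [:: a, b & s1 ++ s2] by rewrite (perm_catCA [:: b] [:: a]).
have us' : uniq [:: b, a & s1 ++ s2] by rewrite -(perm_uniq pe).
have us2 : uniq [:: a, b & s1 ++ s2] by rewrite -(perm_uniq pe').
have dg2 := dom_perm pe' (dom_perm pe dg).
rewrite [RHS](iint_swap mphi phi0 iphi x us2 mg dg2) /=.
apply: eq_Rintegral => t _; move: us => /= /andP[bs us].
by rewrite (IH _ (upd x b t) us mg (dom_tail phi0 bs dg)).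
Qed.

Lemma iint_perm s s' C g x : perm_eq s s' -> uniq s -> meas g -> dom phi s C g ->
  iint s g x = iint s' g x.
Proof.
elim: s s' C x => [|a s IH] s' C x pe us mg dg.
  by move: pe; rewrite perm_sym => /perm_nilP ->.
have as' : a \in s' by rewrite -(perm_mem pe) inE eqxx.
case/splitPr: as' pe => s1 s2 pe.
have us' : uniq (s1 ++ a :: s2) by rewrite -(perm_uniq pe).
rewrite (iint_front x us' mg (dom_perm pe dg)) /=.
have pe' : perm_eq s (s1 ++ s2).
  by move: pe; rewrite perm_sym (perm_catCA s1 [:: a] s2) /= perm_cons perm_sym.
apply: eq_Rintegral => t _; move: us => /= /andP[as_ us].
exact: IH pe' us mg (dom_tail phi0 as_ dg).
Qed.

End Permute.

Lemma Rintegral_scale (R : realType) (k : R) (F : measurableTypeR R -> R) : 0 < k ->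
  measurable_fun setT F ->
  Rintegral (@lebesgue_measure R) setT (fun t => k * F t) = k * Rintegral (@lebesgue_measure R) setT F.
Proof.
move=> k0 mF; rewrite /Rintegral [X in fine X = _]integralE [X in _ = _ * fine X]integralE.
have mE : measurable_fun setT (EFin \o F) by exact/measurable_EFinP.
have -> : (fun t => (k * F t)%:E)^\+%E = (fun t => k%:E * (EFin \o F)^\+ t)%E.
  by rewrite -ge0_funeposM ?ltW.
have -> : (fun t => (k * F t)%:E)^\-%E = (fun t => k%:E * (EFin \o F)^\- t)%E.
  by rewrite -ge0_funenegM ?ltW.
rewrite !ge0_integralZl_EFin ?ltW //; [|exact: measurable_funeneg|exact: measurable_funepos].
case: (integral _ _ _) => [x| |]; case: (integral _ _ _) => [y| |];
  rewrite ?gt0_muley ?gt0_muleNy ?lte_fin //= ?mulr0 // mulrBr //.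
Qed.

(** * Triangular changes of variables *)

Section Triangular.
Variables (R : realType) (T : eqType).
Local Notation RM := (measurableTypeR R).
Local Notation leb := (@lebesgue_measure R).
Variables (th : (T -> R) -> T -> R) (c : T -> R).

(** The head of [s] is the outermost variable. Moving it changes its own image affinely with slope
    [c a], may change the images of later variables arbitrarily, and leaves all others fixed. *)
Fixpoint triangular (s : seq T) : Prop :=
  if s is a :: s' then
    [/\ c a != 0, forall x, exists d, forall t, th (upd x a t) a = c a * t + d,
        forall x t b, b \notin a :: s' -> th (upd x a t) b = th x b & triangular s']
  else True.

(** Inner variables are substituted first. The inner integral then depends only on images of outer
    coordinates, among which only that of [a] moves, affinely; no reordering occurs, so
    measurability of [g] suffices. *)
Lemma iint_triangular s g x : triangular s -> meas g ->
  iint s (g \o th) x = (\prod_(a <- s) `|c a|^-1) * iint s g (th x).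
Proof.
move=> + mg; elim: s x => [|a s IH] x /=; first by rewrite big_nil mul1r.
move=> [ca0 aff out tr]; have [d dE] := aff x.
rewrite big_cons [_ * \prod_(_ <- _) _]mulrC -mulrA.
have mi : measurable_fun setT (fun t : RM => iint s g (upd (th x) a t) : RM).
  exact: (measurableT_comp (meas_iint s mg) (measurable_upd1 _ _)).
rewrite -(Rintegral_affine d ca0 mi).
have e t : iint s (g \o th) (upd x a t) =
    (\prod_(a <- s) `|c a|^-1) * iint s g (upd (th x) a (c a * t + d)).
  rewrite IH //; congr (_ * _); apply: iint_local => b bs; rewrite updE.
  case: eqVneq => [->|ba]; first exact: dE.
  by rewrite out // inE negb_or ba.
transitivity (Rintegral leb setT (fun t : RM =>
    (\prod_(a <- s) `|c a|^-1) * iint s g (upd (th x) a (c a * t + d)))).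
  by apply: eq_Rintegral => t _; exact: e.
have k0 : 0 < \prod_(a <- s) `|c a|^-1.
  elim: s tr {IH out mi e} => [|b s IH]; first by rewrite big_nil.
  by move=> /= [cb _ _ /IH]; rewrite big_cons => h; rewrite mulr_gt0 ?invr_gt0 ?normr_gt0.
rewrite (Rintegral_scale k0) //.
by apply: (measurableT_comp mi); apply: measurable_funD => //; exact: mulrl_measurable.
Qed.

End Triangular.

(** * Integration over symmetric matrices *)

Lemma iint_dep (R : realType) (T : eqType) (Q : pred T) (s : seq T) (g : (T -> R) -> R) x x' :
  (forall y y', (forall b, Q b -> y b = y' b) -> g y = g y') ->
  (forall b, Q b -> b \notin s -> x b = x' b) -> iint s g x = iint s g x'.
Proof.
move=> gQ; elim: s x x' => [|a s IH] x x' e /=; first by apply: gQ => b Qb; apply: e.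
apply: eq_Rintegral => t _; apply: IH => b Qb bs; rewrite !updE.
by case: eqVneq => // ba; apply: e => //; rewrite inE negb_or ba.
Qed.

Section SymmetricIntegral.
Variables (R : realType) (p : nat).
Local Notation RM := (measurableTypeR R).
Local Notation leb := (@lebesgue_measure R).
Local Notation T0 := ('I_p * 'I_p)%type.
Implicit Types (y : T0 -> R) (a b c : T0).

Definition up (c : T0) := (c.1 <= c.2)%N.
Definition utri : seq T0 := [seq c <- enum {: T0} | up c].
Definition symm0 y : 'M[R]_p := \matrix_(i, j) (if (i <= j)%N then y (i, j) else y (j, i)).
Definition vec (X : 'M[R]_p) : T0 -> R := fun c => X c.1 c.2.
Definition symint (F : 'M[R]_p -> R) := iint utri (fun y => F (symm0 y)) (fun _ => 0).

Lemma mem_utri c : (c \in utri) = up c.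
Proof. by rewrite mem_filter mem_enum andbT. Qed.

Lemma utri_uniq : uniq utri.
Proof. by rewrite filter_uniq // enum_uniq. Qed.

Lemma symm0_sym y : (symm0 y)^T = symm0 y.
Proof.
apply/matrixP => i j; rewrite !mxE; case: (ltngtP i j) => // ij.
by rewrite (val_inj ij).
Qed.

Lemma symm0_vec X : X^T = X -> symm0 (vec X) = X.
Proof.
move=> sX; apply/matrixP => i j; rewrite mxE; case: ifP => // _.
by rewrite -[in RHS]sX mxE.
Qed.

Lemma symm0_dep y y' : (forall b, up b -> y b = y' b) -> symm0 y = symm0 y'.
Proof.
move=> e; apply/matrixP => i j; rewrite !mxE; case: ifP => ij; apply: e => //.
by rewrite /up /= ltnW // ltnNge ij.
Qed.

Lemma symint_base F y : iint utri (fun y => F (symm0 y)) y = symint F.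
Proof.
apply: (iint_dep (Q := up)) => [z z' e|b Qb]; first by rewrite (symm0_dep e).
by rewrite mem_utri Qb.
Qed.

Lemma eq_symint F G : (forall X, X^T = X -> F X = G X) -> symint F = symint G.
Proof. by move=> e; apply: eq_iint => y _; apply: e; exact: symm0_sym. Qed.

Section Congruence.
Variables (M A : 'M[R]_p).
Hypothesis sA : A^T = A.

(** Coordinates below the diagonal are sent to 0, so they are constant and never obstruct
    triangularity. *)
Definition congr_map y : T0 -> R :=
  fun c => if up c then (M *m symm0 y *m M^T + A) c.1 c.2 else 0.

Lemma symm0_congr_map y : symm0 (congr_map y) = M *m symm0 y *m M^T + A.
Proof.
have sX : (M *m symm0 y *m M^T + A)^T = M *m symm0 y *m M^T + A.
  by rewrite linearD /= sA !trmx_mul trmxK symm0_sym mulmxA.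
rewrite -[RHS]symm0_vec //; apply: symm0_dep => b ub.
by rewrite /congr_map ub.
Qed.

(** The partial derivative of coordinate [b] of [congr_map] in coordinate [a]; an off-diagonal
    coordinate enters [symm0] twice, which gives the second term. *)
Definition jac a b := M b.1 a.1 * M b.2 a.2 + (a.1 != a.2)%:R * (M b.1 a.2 * M b.2 a.1).

Lemma congr_map_upd y a t b : up a -> up b ->
  congr_map (upd y a t) b = congr_map (upd y a 0) b + t * jac a b.
Proof.
move=> ua ub; rewrite /congr_map ub.
pose E : 'M[R]_p := delta_mx a.1 a.2 + (a.1 != a.2)%:R *: delta_mx a.2 a.1.
have -> : symm0 (upd y a t) = symm0 (upd y a 0) + t *: E.
  apply/matrixP => i j; rewrite !mxE !updE {}/E; case: a ua => a1 a2; rewrite /up /= => ua.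
  case: ifP => ij.
    case: eqP => [[-> ->]|ne].
      by rewrite !eqxx add0r; case: (eqVneq a1 a2); rewrite /= ?mul0r ?mulr0 ?addr0 mulr1.
    rewrite (_ : (i == a1) && (j == a2) = false); last first.
      by apply/negP => /andP[/eqP i1 /eqP j1]; apply: ne; rewrite i1 j1.
    case: (eqVneq a1 a2) => [_|a12]; first by rewrite mul0r !addr0 mulr0 addr0.
    rewrite (_ : (i == a2) && (j == a1) = false) ?mulr0 ?addr0 ?mulr0 ?addr0 //.
    apply/negP => /andP[/eqP i1 /eqP j1]; case/eqP: a12; apply/val_inj/eqP.
    by rewrite eqn_leq ua /= -i1 -j1.
  have ji : (j < i)%N by rewrite ltnNge ij.
  rewrite (_ : (i == a1) && (j == a2) = false); last first.
    by apply/negP => /andP[/eqP i1 /eqP j1]; move: ji; rewrite i1 j1 ltnNge ua.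
  case: eqP => [[j1 i1]|ne].
    rewrite -j1 -i1 !eqxx (_ : (j != i) = true) ?add0r ?mulr1 //.
    by apply/eqP => e; rewrite e ltnn in ji.
  rewrite (_ : (i == a2) && (j == a1) = false) ?mulr0 ?addr0 ?mulr0 ?addr0 //.
  by apply/negP => /andP[/eqP i1 /eqP j1]; apply: ne; rewrite i1 j1.
rewrite mulmxDr mulmxDl -scalemxAr -scalemxAl addrAC mxE [X in _ + X = _]mxE; congr (_ + _ * _).
have dE i j : (M *m delta_mx i j *m M^T) b.1 b.2 = M b.1 i * M b.2 j.
  rewrite -(mul_delta_mx (0 : 'I_1)) mulmxA -colE -mulmxA -rowE mxE big_ord1 !mxE.
  done.
by rewrite mulmxDr mulmxDl mxE dE -scalemxAr -scalemxAl mxE dE.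
Qed.

Lemma congr_triangular (s : seq T0) (r : rel T0) :
  pairwise r s -> s =i up ->
  (forall a b, up a -> up b -> r b a -> jac a b = 0) ->
  (forall a, up a -> jac a a = M a.1 a.1 * M a.2 a.2) -> (forall i, M i i != 0) ->
  triangular congr_map (fun a => M a.1 a.1 * M a.2 a.2) s.
Proof.
move=> ps sup jr jd M0.
suff gen pre s' : s = pre ++ s' -> triangular congr_map (fun a => M a.1 a.1 * M a.2 a.2) s'.
  exact: (gen [::] s).
elim: s' pre => [//|a s' IH] pre sE /=.
have ua : up a by rewrite -[up a]/(a \in up) -sup sE mem_cat inE eqxx orbT.
split.
- by rewrite mulf_neq0.
- move=> x; exists (congr_map (upd x a 0) a) => t.
  by rewrite congr_map_upd // jd // addrC mulrC.
- move=> x t b bs; have [ub|ub] := boolP (up b); last by rewrite /congr_map (negPf ub).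
  have bpre : b \in pre.
    have : b \in s by rewrite sup.
    by rewrite sE mem_cat (negPf bs) orbF.
  have rba : r b a.
    move: ps; rewrite sE pairwise_cat => /and3P[/allrelP h _ _].
    by apply: h; rewrite ?inE ?eqxx.
  have xE : upd x a (x a) = x.
    by apply/funext => c; rewrite !updE; case: eqVneq => [->|].
  have e u : congr_map (upd x a u) b = congr_map (upd x a 0) b.
    by rewrite congr_map_upd // jr // mulr0 addr0.
  by rewrite e -(e (x a)) xE.
- by apply: (IH (rcons pre a)); rewrite cat_rcons.
Qed.

End Congruence.

Definition lexle : rel T0 := fun c d => ((c.1 < d.1) || ((c.1 == d.1) && (c.2 <= d.2)))%N.

Lemma lexle_trans : transitive lexle.
Proof.
move=> [a1 a2] [b1 b2] [c1 c2]; rewrite /lexle /= -!val_eqE /=; lia.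
Qed.

Lemma lexle_total : total lexle.
Proof. by move=> [a1 a2] [b1 b2]; rewrite /lexle /= -!val_eqE /=; lia. Qed.

Definition lower_seq := sort lexle utri.
Definition upper_seq := sort (fun c d => lexle d c) utri.

Lemma lower_perm : perm_eq utri lower_seq.
Proof. by rewrite perm_sym perm_sort. Qed.

Lemma upper_perm : perm_eq utri upper_seq.
Proof. by rewrite perm_sym perm_sort. Qed.

Lemma pairwise_strict (r : rel T0) s : uniq s -> transitive r -> sorted r s ->
  pairwise (fun c d => (c != d) && r c d) s.
Proof.
move=> us tr ss; rewrite pairwise_relI -uniq_pairwise us /=.
by rewrite -(sorted_pairwise tr).
Qed.

(** A nonzero entry of [L] has its column index at most its row index. A nonzero [jac a b] thus
    forces [b] not to precede [a] lexicographically; in the swapped term this also uses that [a] is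
    off the diagonal. *)
Lemma triangular_lower L A : is_trig_mx L -> (forall i, L i i != 0) ->
  triangular (congr_map L A) (fun a => L a.1 a.1 * L a.2 a.2) lower_seq.
Proof.
move=> /is_trig_mxP Lt L0.
have L0' (i j : 'I_p) : L i j = 0 \/ (j <= i)%N.
  by case: (ltnP i j) => [/Lt|]; [left|right].
apply: (@congr_triangular L A lower_seq (fun c d => (c != d) && lexle c d)) => //.
- apply: pairwise_strict; rewrite ?sort_uniq ?utri_uniq //; first exact: lexle_trans.
  exact: (sort_sorted lexle_total).
- by move=> c; rewrite mem_sort mem_utri.
- move=> [a1 a2] [b1 b2]; rewrite /up /lexle /jac /= xpair_eqE -!val_eqE /= => ua ub lt.
  have -> : L b1 a1 * L b2 a2 = 0.
    case: (L0' b1 a1) => [->|h1]; first by rewrite mul0r.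
    case: (L0' b2 a2) => [->|h2]; first by rewrite mulr0.
    by exfalso; lia.
  rewrite add0r; case: eqP => [_|ne]; first by rewrite mul0r.
  case: (L0' b1 a2) => [->|h1]; first by rewrite mul0r mulr0.
  by exfalso; apply: ne; lia.
- move=> [a1 a2]; rewrite /up /jac /= => ua.
  case: eqP => [_|ne]; first by rewrite mul0r addr0.
  rewrite (Lt a1 a2) ?mul0r ?mulr0 ?addr0 //; have : a1 != a2 :> nat by apply/eqP => e; apply: ne; exact: val_inj.
  by lia.
Qed.

Lemma triangular_upper L : is_trig_mx L -> (forall i, L i i != 0) ->
  triangular (congr_map L^T 0) (fun a => L^T a.1 a.1 * L^T a.2 a.2) upper_seq.
Proof.
move=> /is_trig_mxP Lt L0.
have L0' (i j : 'I_p) : L^T i j = 0 \/ (i <= j)%N.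
  by rewrite mxE; case: (ltnP j i) => [/Lt|]; [left|right].
apply: (@congr_triangular L^T 0 upper_seq (fun c d => (c != d) && lexle d c)) => //.
- apply: pairwise_strict; rewrite ?sort_uniq ?utri_uniq //.
    by move=> a b c h1 h2; exact: lexle_trans h2 h1.
  by apply: sort_sorted => a b; exact: lexle_total.
- by move=> c; rewrite mem_sort mem_utri.
- move=> [a1 a2] [b1 b2]; rewrite /up /lexle /jac /= xpair_eqE -!val_eqE /= => ua ub lt.
  have -> : L^T b1 a1 * L^T b2 a2 = 0.
    case: (L0' b1 a1) => [->|h1]; first by rewrite mul0r.
    case: (L0' b2 a2) => [->|h2]; first by rewrite mulr0.
    by exfalso; lia.
  rewrite add0r; case: eqP => [_|ne]; first by rewrite mul0r.
  case: (L0' b2 a1) => [->|h1]; first by rewrite !mulr0.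
  by exfalso; apply: ne; lia.
- move=> [a1 a2]; rewrite /up /jac /= => ua.
  case: eqP => [_|ne]; first by rewrite mul0r addr0.
  rewrite [L^T a2 a1]mxE (Lt a1 a2) ?mulr0 ?addr0 //; have : a1 != a2 :> nat by apply/eqP => e; apply: ne; exact: val_inj.
  by lia.
- by move=> i; rewrite mxE.
Qed.

(** An index [i] occurs in [p + 1] places of the upper triangle, the diagonal pair counting twice.
    This is the origin of the exponent [p + 1]. *)
Lemma prod_utri (f : 'I_p -> R) : \prod_(a <- utri) (f a.1 * f a.2) = (\prod_i f i) ^+ p.+1.
Proof.
rewrite big_filter big_enum_cond /= big_split /=.
have e1 : \prod_(a | up a) f a.1 = \prod_(i < p) \prod_(j < p | (i <= j)%N) f i.
  by rewrite pair_big_dep; apply: eq_bigl => a; rewrite /up.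
have e2 : \prod_(a | up a) f a.2 = \prod_(i < p) \prod_(j < p | (j <= i)%N) f i.
  rewrite [RHS](exchange_big_dep predT) //= pair_big_dep /=; by apply: eq_bigl => a; rewrite /up.
rewrite e1 e2 -big_split /= -prodrXl; apply: eq_bigr => i _.
rewrite !prodr_const -exprD; congr (_ ^+ _).
rewrite -cardUI -addn1; congr addn.
  rewrite -[RHS]card_ord; apply: eq_card => j; rewrite !inE; exact: leq_total.
rewrite -(card1 i); apply: eq_card => j; rewrite !inE.
by rewrite -[LHS]/((i <= j) && (j <= i))%N -eqn_leq eq_sym.
Qed.

End SymmetricIntegral.

Lemma eq_iint_fun (R : realType) (T : eqType) (s : seq T) (g g' : (T -> R) -> R) x :
  (forall y, g y = g' y) -> iint s g x = iint s g' x.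
Proof. by move=> e; apply: eq_iint => y _. Qed.

(** * The Jacobian of a congruence *)

Section CongruenceIntegral.
Variables (R : realType) (p : nat).
Local Notation RM := (measurableTypeR R).
Local Notation leb := (@lebesgue_measure R).
Variable phi : RM -> R.
Hypothesis mphi : measurable_fun setT phi.
Hypothesis phi0 : forall t, 0 <= phi t.
Hypothesis iphi : leb.-integrable setT (EFin \o phi).
Hypothesis phiL : forall L : R, exists2 m, 0 < m & forall t, `|t| <= L -> m <= phi t.
Implicit Types (F : 'M[R]_p -> R).

(** A class stable under affine congruences and dominated through [dom_box], so coordinates may be
    reordered before and after each triangular substitution. *)
Definition boxfun F := [/\ meas (fun y => F (symm0 y)), exists B, forall X, `|F X| <= B &
  exists L, forall X, X^T = X -> F X != 0 -> forall i j, `|X i j| <= L].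

Lemma boxfun_dom s F : boxfun F -> {subset s <= utri p} ->
  exists C : R, dom phi s (cst C) (fun y => F (symm0 y)).
Proof.
move=> [_ [B FB] [L FL]] sub; apply: (@dom_box _ _ phi phi0 s _ B L phiL) => // y Fy a /sub.
rewrite mem_utri /up => ua; have := FL _ (symm0_sym y) Fy a.1 a.2.
by rewrite mxE ua -surjective_pairing.
Qed.

Lemma meas_congr (P Q : 'M[R]_p) F : Q^T = Q -> meas (fun y => F (symm0 y)) ->
  meas (fun y => F (P *m symm0 y *m P^T + Q)).
Proof.
move=> sQ mF; have -> : (fun y => F (P *m symm0 y *m P^T + Q)) =
    (fun y => F (symm0 y)) \o congr_map P Q.
  by apply/funext => y; rewrite /= symm0_congr_map.
apply: (measurableT_comp mF); apply: measurable_to_Xtype => c; rewrite /congr_map.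
case: (up c); last exact: measurable_cst.
have mS k l : measurable_fun setT (fun y : Xtype R ('I_p * 'I_p) => symm0 y k l : RM).
  have E0 : (fun y : Xtype R ('I_p * 'I_p) => symm0 y k l : RM) =
      (fun y => y (if (k <= l)%N then (k, l) else (l, k))).
    by apply/funext => y; rewrite mxE; case: ifP.
  rewrite E0; exact: measurable_coord.
have E : (fun y : Xtype R ('I_p * 'I_p) => (P *m symm0 y *m P^T + Q) c.1 c.2) =
    (fun y => \sum_l (\sum_k P c.1 k * symm0 y k l) * P c.2 l + Q c.1 c.2).
  apply/funext => y; rewrite mxE; congr (_ + _); rewrite mxE.
  by apply: eq_bigr => l _; rewrite mxE [P^T l _]mxE.
rewrite E; apply: measurable_funD => //; apply: measurable_sum => l; apply: measurable_funM => //.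
by apply: measurable_sum => k; apply: measurable_funM => //; exact: mS.
Qed.

Lemma boxfun_congr (P Q : 'M[R]_p) F : P \in unitmx -> Q^T = Q -> boxfun F ->
  boxfun (fun X => F (P *m X *m P^T + Q)).
Proof.
move=> uP sQ [mF [B FB] [L FL]]; split; first exact: meas_congr.
  by exists B => X; exact: FB.
pose N := invmx P.
(* The bound comes from [X = N (Y - Q) N^T] with the entries of [Y] at most [L]; summing over [i]
   and [j] makes it independent of the entry. *)
exists (\sum_i \sum_j \sum_l \sum_k `|N i k| * (L + `|Q k l|) * `|N j l|) => X sX FX i j.
have sY : (P *m X *m P^T + Q)^T = P *m X *m P^T + Q.
  by rewrite linearD /= sQ !trmx_mul trmxK sX mulmxA.
have := FL _ sY FX; set Y := P *m X *m P^T + Q => YL.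
have L0 : 0 <= L by apply: le_trans (YL i j).
have XE : X = N *m (Y - Q) *m N^T.
  rewrite /Y addrK !mulmxA mulVmx // mul1mx -mulmxA trmx_inv mulmxV ?mulmx1 //.
  by rewrite unitmx_tr.
have term0 i' j' : 0 <= \sum_l \sum_k `|N i' k| * (L + `|Q k l|) * `|N j' l|.
  by apply: sumr_ge0 => l _; apply: sumr_ge0 => k _; rewrite !mulr_ge0 ?addr_ge0.
apply: (@le_trans _ _ (\sum_l \sum_k `|N i k| * (L + `|Q k l|) * `|N j l|)).
  rewrite {1}XE mxE (le_trans (ler_norm_sum _ _ _)) //; apply: ler_sum => l _.
  rewrite mxE mulr_suml (le_trans (ler_norm_sum _ _ _)) //; apply: ler_sum => k _.
  rewrite !normrM [N^T l j]mxE ler_wpM2r // ler_wpM2l // mxBE.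
  by rewrite (le_trans (ler_normB _ _)) // lerD2r.
have sumT (T : 'I_p -> 'I_p -> R) : (forall i' j', 0 <= T i' j') ->
    T i j <= \sum_i' \sum_j' T i' j'.
  move=> T0; rewrite (bigD1 i) //= (bigD1 j) //= -addrA lerDl addr_ge0 //.
    by apply: sumr_ge0 => j' _.
  by apply: sumr_ge0 => i' _; apply: sumr_ge0 => j' _.
exact: (sumT _ term0).
Qed.

Lemma symint_perm F s x : boxfun F -> perm_eq (utri p) s ->
  iint s (fun y => F (symm0 y)) x = symint F.
Proof.
move=> bF pe; have sub : {subset utri p <= utri p} by [].
have [C dF] := boxfun_dom bF sub; have [mF _ _] := bF.
rewrite -(iint_perm mphi phi0 iphi x pe (utri_uniq p) mF dF).
exact: symint_base.
Qed.

(* By Cholesky [M = L *m L^T]; congruence by [L] (resp. [L^T]) is triangular in the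
   upper entries in increasing (resp. decreasing) lexicographic order. *)
Theorem symint_congr F (M A : 'M[R]_p) : boxfun F -> pd M -> A^T = A ->
  symint (fun S => F (invmx M *m (S - A) *m invmx M)) = \det M ^+ p.+1 * symint F.
Proof.
move=> bF pM sA; have [L Lt ME] := cholesky pM.
have uM := pd_unit pM; pose N := invmx M.
have sN : N^T = N by rewrite /N trmx_inv pM.1.
have detM : \det M = (\prod_i L i i) ^+ 2 by rewrite ME det_mulmx det_tr -expr2 det_trig.
have dM0 := pd_det pM.
have L0 i : L i i != 0.
  apply: contraTneq dM0 => Li; rewrite detM (bigD1 i) //= Li mul0r expr0n /=.
  by rewrite ltxx.
have uL : L \in unitmx.
  rewrite unitmxE unitfE det_trig // prodf_seq_neq0; apply/allP => i _ /=; exact: L0.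
pose G S := F (N *m (S - A) *m N).
have bG : boxfun G.
  have -> : G = fun S => F (N *m S *m N^T + - (N *m A *m N)).
    by apply/funext => S; rewrite /G mulmxBr mulmxBl sN.
  by apply: boxfun_congr => //; rewrite ?unitmx_inv // linearN /= !trmx_mul sN sA mulmxA.
pose G1 W := G (L *m W *m L^T + A).
have bG1 : boxfun G1 by exact: boxfun_congr.
have FE V : F V = G1 (L^T *m V *m L^T^T + 0).
  have LV : L *m (L^T *m V *m L) *m L^T = M *m V *m M by rewrite ME !mulmxA.
  by rewrite /G1 /G addrK addr0 trmxK LV /N !mulmxA mulVmx // mul1mx -mulmxA mulmxV // mulmx1.
pose J := ((\prod_i `|L i i|) ^+ p.+1)^-1.
have JE (K : 'M[R]_p) s : (forall i, K i i = L i i) -> perm_eq (utri p) s ->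
    \prod_(a <- s) `|K a.1 a.1 * K a.2 a.2|^-1 = J.
  move=> KL pe; rewrite -(perm_big _ pe) /J -prod_utri -prodfV.
  by apply: eq_bigr => a _; rewrite !KL normrM.
have stepU : symint F = J * symint G1.
  rewrite -(symint_perm (fun _ => 0) bF (upper_perm p)).
  rewrite (@eq_iint_fun _ _ _ _ ((fun y => G1 (symm0 y)) \o congr_map L^T 0)); last first.
    move=> y /=; by rewrite symm0_congr_map ?trmx0 // -FE.
  rewrite (iint_triangular _ (triangular_upper Lt L0)); last by case: bG1.
  rewrite JE ?(symint_perm _ bG1) ?upper_perm // => i; by rewrite mxE.
have stepL : symint G1 = J * symint G.
  rewrite -(symint_perm (fun _ => 0) bG1 (lower_perm p)).
  rewrite (@eq_iint_fun _ _ _ _ ((fun y => G (symm0 y)) \o congr_map L A)); last first.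
    by move=> y /=; rewrite symm0_congr_map.
  rewrite (iint_triangular _ (triangular_lower A Lt L0)); last by case: bG.
  by rewrite JE ?(symint_perm _ bG) ?lower_perm.
have JJ : \det M ^+ p.+1 * (J * J) = 1.
  rewrite detM /J -invfM -exprMn -expr2.
  have -> : (\prod_i `|L i i|) ^+ 2 = (\prod_i L i i) ^+ 2.
    by rewrite -normr_prod real_normK // num_real.
  by rewrite mulfV // expf_neq0 // -detM gt_eqF.
by rewrite stepU stepL !mulrA -[_ * _ * J]mulrA JJ mul1r.
Qed.

End CongruenceIntegral.

(** * The density of the canonical moments *)

Section Weights.
Variables (R : realType) (p : nat).
Implicit Types (X Q : 'M[R]_p) (d : 'rV[R]_p).

(* Up to normalisation, the density of [X] when [U = 2^-1%:M + r *: X] has density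
   proportional to [(det U * det (1 - U)) ^ (N / 2)] on [0 < U < 1]. *)
Definition wt (r : R) (N : nat) X : R :=
  if `[< pd (2^-1%:M + r *: X) /\ pd (2^-1%:M - r *: X) >]
  then Num.sqrt (\det (2^-1%:M + r *: X) * \det (2^-1%:M - r *: X)) ^+ N else 0.

Lemma wt_ge0 r N X : 0 <= wt r N X.
Proof. by rewrite /wt; case: ifP => // _; rewrite exprn_ge0 // sqrtr_ge0. Qed.

Lemma pd_orth_diag Q d : Q *m Q^T = 1%:M ->
  pd (Q^T *m diag_mx d *m Q) <-> forall i, 0 < d 0 i.
Proof.
move=> QQ; split=> [[_ pD] i|d0].
  have v0 : delta_mx 0 i *m Q != 0 :> 'rV_p.
    apply/eqP => /(congr1 (mulmx^~ Q^T)); rewrite -mulmxA QQ mulmx1 mul0mx => /rowP/(_ i)/eqP.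
    by rewrite !mxE !eqxx oner_eq0.
  have := pD _ v0; rewrite qf_congrT -mulmxA QQ mulmx1 qf_diag (bigD1 i) //= big1 => [|j ji].
    by rewrite mxE !eqxx expr1n mulr1 addr0.
  by rewrite mxE eqxx (negPf ji) expr0n mulr0.
rewrite -{2}[Q]trmxK; apply: pd_congr.
  split; first by rewrite tr_diag_mx.
  move=> v v0; rewrite qf_diag lt_neqAle sumr_ge0 ?andbT => [|i _]; last first.
    by rewrite mulr_ge0 ?sqr_ge0 // ltW.
  rewrite eq_sym psumr_neq0 => [|i _]; last by rewrite mulr_ge0 ?sqr_ge0 // ltW.
  have /existsP[i vi] : [exists i, v 0 i != 0].
    rewrite -negb_forall; apply: contra v0 => /forallP h; apply/eqP/rowP => i.
    by rewrite mxE; apply/eqP.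
  apply/hasP; exists i; first exact: mem_index_enum.
  by rewrite /= mulr_gt0 // lt_neqAle sqr_ge0 andbT eq_sym sqrf_eq0.
by apply/row_freeP; exists Q; rewrite (mulmx1C QQ).
Qed.

Lemma det_orth_diag Q d : Q *m Q^T = 1%:M -> \det (Q^T *m diag_mx d *m Q) = \prod_i d 0 i.
Proof.
move=> QQ; rewrite !det_mulmx mulrAC -det_mulmx (mulmx1C QQ) det1 mul1r.
by rewrite det_diag.
Qed.

(** The eigenvalues [d] are chosen before [r] and [N], so the same ones serve along the whole
    sequence of scalings. *)
Lemma wt_spec X : X^T = X -> exists d : 'I_p -> R, \tr (X *m X) = \sum_i d i ^+ 2 /\
  forall r N, wt r N X = if [forall i, (0 < 2^-1 + r * d i) && (0 < 2^-1 - r * d i)]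
    then Num.sqrt (\prod_i (4^-1 - (r * d i) ^+ 2)) ^+ N else 0.
Proof.
move=> sX; have [Q [d [QQ XE]]] := real_spectral sX.
exists (fun i => d 0 i); split.
  rewrite XE !mulmxA -(mulmxA _ Q) QQ mulmx1 mxtrace_mulC !mulmxA QQ mul1mx.
  by rewrite mulmx_diag mxtrace_diag; apply: eq_bigr => i _; rewrite mxE expr2.
move=> r N.
have shE (e : R) : 2^-1%:M + e *: X = Q^T *m diag_mx (\row_i (2^-1 + e * d 0 i)) *m Q.
  have -> : diag_mx (\row_i (2^-1 + e * d 0 i)) = 2^-1%:M + e *: diag_mx d.
    by apply/matrixP => i j; rewrite !mxE; case: eqP; rewrite ?mulr1n ?mulr0n ?mulr0 ?addr0.
  rewrite mulmxDr mulmxDl mul_mx_scalar -scalemxAl (mulmx1C QQ) scalemx1.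
  by rewrite -scalemxAr -scalemxAl -XE.
rewrite /wt -scaleNr !shE.
have -> : `[< pd (Q^T *m diag_mx (\row_i (2^-1 + r * d 0 i)) *m Q) /\
              pd (Q^T *m diag_mx (\row_i (2^-1 + - r * d 0 i)) *m Q) >] =
   [forall i, (0 < 2^-1 + r * d 0 i) && (0 < 2^-1 - r * d 0 i)].
  apply/asboolP/forallP => [[/(pd_orth_diag _ QQ) h1 /(pd_orth_diag _ QQ) h2] i|h].
    by have := h1 i; have := h2 i; rewrite !mxE mulNr => -> ->.
  by split; apply/(pd_orth_diag _ QQ) => i; have /andP[h1 h2] := h i; rewrite mxE ?mulNr.
case: ifP => // _; congr (Num.sqrt _ ^+ _).
rewrite !det_orth_diag // -big_split /=; apply: eq_bigr => i _; rewrite !mxE.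
rewrite mulNr; set u := r * d 0 i; rewrite (_ : 4^-1 = 2^-1 * 2^-1 :> R); first by ring.
by field.
Qed.

(** Each eigenvalue satisfies [1/4 - u^2 <= exp (-4 u^2) / 4] with [u = r d], by
    [1 + x <= exp x]. *)
Lemma wt_le r N X : X^T = X ->
  wt r N X <= (2^-1 ^+ p) ^+ N * expR (- (2 * r ^+ 2 * N%:R * \tr (X *m X))).
Proof.
move=> sX; have [d [trE ->]] := wt_spec sX.
case: ifP => [/forallP h|_]; last by rewrite mulr_ge0 ?exprn_ge0 ?expR_ge0 ?invr_ge0.
have e0 : 0 <= 2^-1 ^+ p * expR (- (2 * r ^+ 2 * \tr (X *m X))).
  by rewrite mulr_ge0 ?exprn_ge0 ?expR_ge0 ?invr_ge0.
have le1 : Num.sqrt (\prod_i (4^-1 - (r * d i) ^+ 2)) <=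
    2^-1 ^+ p * expR (- (2 * r ^+ 2 * \tr (X *m X))).
  rewrite -[leRHS]gtr0_norm; last by rewrite mulr_gt0 ?exprn_gt0 ?expR_gt0 ?invr_gt0.
  rewrite -sqrtr_sqr ler_wsqrtr // exprMn -expRM_natl -exprM mulnC exprM.
  have -> : (2^-1 : R) ^+ 2 ^+ p = \prod_(i < p) 4^-1.
    by rewrite prodr_const card_ord; congr (_ ^+ _); field.
  have -> : 2%:R * - (2 * r ^+ 2 * \tr (X *m X)) = \sum_i - (4 * (r * d i) ^+ 2).
    rewrite trE sumrN mulrN; congr (- _); rewrite !mulr_sumr; apply: eq_bigr => i _; ring.
  rewrite expR_sum -big_split /=; apply: ler_prod => i _.
  have /andP[h1 h2] := h i; apply/andP; split.
    rewrite (_ : _ - _ = (2^-1 + r * d i) * (2^-1 - r * d i)); last by field.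
    by rewrite mulr_ge0 // ltW.
  have := expR_ge1Dx (- (4 * (r * d i) ^+ 2)); lra.
apply: (@le_trans _ _ ((2^-1 ^+ p * expR (- (2 * r ^+ 2 * \tr (X *m X)))) ^+ N)).
  by rewrite lerXn2r // nnegrE sqrtr_ge0.
rewrite exprMn -expRM_natl ler_wpM2l ?exprn_ge0 ?invr_ge0 // ler_expR.
rewrite le_eqVlt; apply/orP; left; apply/eqP; ring.
Qed.

Lemma qf_delta (A : 'M[R]_p) i : qf A (delta_mx 0 i) = A i i.
Proof. by rewrite /qf -rowE trmx_delta -colE !mxE. Qed.

Lemma qf_deltaD (A : 'M[R]_p) i j : A^T = A ->
  qf A (delta_mx 0 i + delta_mx 0 j) = A i i + A j j + 2 * A i j.
Proof.
move=> sA; have h k l : ((delta_mx 0 k : 'rV[R]_p) *m A *m (delta_mx 0 l : 'rV[R]_p)^T) 0 0 = A k l.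
  by rewrite -rowE trmx_delta -colE !mxE.
have Aji : A j i = A i j by rewrite -[in LHS]sA mxE.
rewrite /qf linearD /= !mulmxDl !mulmxDr.
have addE (B C : 'M[R]_1) : (B + C) 0 0 = B 0 0 + C 0 0 by rewrite mxE.
by rewrite !addE !h Aji; ring.
Qed.

(** The forms of [1/2 + r X] and [1/2 - r X] are tested on the basis vectors and on sums of two of
    them. *)
Lemma wt_box r N X : 0 < r -> X^T = X -> wt r N X != 0 -> forall i j, `|X i j| <= r^-1.
Proof.
move=> r0 sX; rewrite /wt; case: asboolP => [[p1 p2] _ i j|]; last by rewrite eqxx.
have [s1 pp1] := pd_psd p1; have [s2 pp2] := pd_psd p2.
have := pp1 (delta_mx 0 i); have := pp2 (delta_mx 0 i).
have := pp1 (delta_mx 0 j); have := pp2 (delta_mx 0 j).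
have := pp1 (delta_mx 0 i + delta_mx 0 j); have := pp2 (delta_mx 0 i + delta_mx 0 j).
rewrite -!/(qf _ _) !qf_deltaD // !qf_delta !mxE !eqxx !mulr1n.
have [->|ij] := eqVneq i j => h1 h2 h3 h4 h5 h6.
  rewrite -(ler_pM2l r0) mulfV ?gt_eqF // -{1}(gtr0_norm r0) -normrM ler_norml.
  by apply/andP; split; lra.
rewrite -(ler_pM2l r0) mulfV ?gt_eqF // -{1}(gtr0_norm r0) -normrM ler_norml.
rewrite mulr0n in h1 h2; apply/andP; split; lra.
Qed.

Lemma pd_open (B : 'M[R]_p) : pd B -> exists2 e, 0 < e &
  forall B', B'^T = B' -> (forall i j, `|B' i j - B i j| < e) -> pd B'.
Proof.
move=> pB; have [Q [d [QQ BE]]] := real_spectral pB.1.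
have d0 : forall i, 0 < d 0 i by apply/(pd_orth_diag _ QQ); rewrite -BE.
pose m := \big[Order.min/1]_i d 0 i.
have m0 : 0 < m.
  by rewrite /m; elim/big_ind: _ => // x y x0 y0; rewrite lt_min x0 y0.
have md i : m <= d 0 i by exact: bigmin_le_cond.
have lb v : m * (v *m v^T) 0 0 <= qf B v.
  rewrite BE qf_congrT qf_diag -[v in X in X <= _]mulmx1 -(mulmx1C QQ).
  have -> : (v *m (Q^T *m Q) *m (v *m (Q^T *m Q))^T) = (v *m Q^T) *m (v *m Q^T)^T.
    by rewrite !trmx_mul !trmxK -!mulmxA (mulmxA Q) (mulmxA (Q *m Q^T)) QQ mul1mx.
  rewrite mxE mulr_sumr; apply: ler_sum => i _.
  by rewrite [(v *m Q^T)^T i 0]mxE -expr2 ler_wpM2r // sqr_ge0.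
(* [m] bounds the eigenvalues of [B] from below. Entries smaller than [m / (p+1)] change the form by
   at most [m p / (p+1)] times the squared norm, which is strictly less than [m] times it. *)
exists (m / p.+1%:R); first by rewrite divr_gt0.
move=> B' sB' BB'; split=> // v v0.
have -> : B' = B + (B' - B) by rewrite addrC subrK.
have [E EE] : exists E, E = B' - B by exists (B' - B).
rewrite -EE qfD.
have Eb : `|qf E v| <= m / p.+1%:R * (p%:R * (v *m v^T) 0 0).
  have -> : qf E v = \sum_j \sum_i v 0 i * E i j * v 0 j.
    rewrite /qf mxE; apply: eq_bigr => j _; rewrite [v^T j 0]mxE mxE mulr_suml.
    by apply: eq_bigr.
  rewrite (le_trans (ler_norm_sum _ _ _)) //.
  apply: (@le_trans _ _ (\sum_j \sum_i m / p.+1%:R * (2^-1 * (v 0 i ^+ 2 + v 0 j ^+ 2)))).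
    apply: ler_sum => j _; rewrite (le_trans (ler_norm_sum _ _ _)) //.
    apply: ler_sum => i _; rewrite !normrM mulrAC mulrC.
    apply: ler_pM; rewrite ?mulr_ge0 //; first by have := BB' i j; rewrite EE mxBE => /ltW.
    have := sqr_ge0 (`|v 0 i| - `|v 0 j|); rewrite -[v 0 i ^+ 2]real_normK ?num_real //.
    by rewrite -[v 0 j ^+ 2]real_normK ?num_real // sqrrB; lra.
  rewrite le_eqVlt; apply/orP; left; apply/eqP.
  transitivity (m / p.+1%:R * (2^-1 * \sum_j \sum_i (v 0 i ^+ 2 + v 0 j ^+ 2))).
    rewrite !mulr_sumr; apply: eq_bigr => j _; rewrite !mulr_sumr.
    by apply: eq_bigr.
  congr (_ * _).
  have -> : (v *m v^T) 0 0 = \sum_i v 0 i ^+ 2.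
    by rewrite mxE; apply: eq_bigr => i _; rewrite mxE expr2.
  under eq_bigr do rewrite big_split /= sumr_const card_ord.
  rewrite big_split /= sumr_const card_ord sumrMnl.
  by move: (\sum_(i < p) _) => W; rewrite -[W *+ p]mulr_natl; field.
have lbv := lb v; have vv := row_sqr_gt0 v0; set V := (v *m v^T) 0 0 in vv Eb lbv *.
have mV : m / p.+1%:R * (p%:R * V) < m * V.
  by rewrite mulrA ltr_pM2r // mulrAC ltr_pdivrMr // ltr_pM2l // ltr_nat.
move: Eb; rewrite ler_norml => /andP[Eb1 Eb2].
by apply: lt_le_trans (lerD lbv Eb1); rewrite subr_gt0.
Qed.

Lemma wt_meas r N : meas (fun y => wt r N (symm0 y)).
Proof.
have symE (y : 'I_p * 'I_p -> R) e : (2^-1%:M + e *: symm0 y)^T = 2^-1%:M + e *: symm0 y.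
  by rewrite linearD /= linearZ /= tr_scalar_mx symm0_sym.
pose O e : set (Xtype R ('I_p * 'I_p)) := [set y | pd (2^-1%:M + e *: symm0 y)].
have mO e : measurable (O e).
  apply: open_meas => y Oy; have [d d0 hd] := pd_open Oy.
  exists (d / (`|e| + 1)); first by rewrite divr_gt0 // ltr_wpDl.
  move=> z zy; apply: hd => // i j.
  have -> : (2^-1%:M + e *: symm0 z) i j - (2^-1%:M + e *: symm0 y) i j =
      e * (symm0 z i j - symm0 y i j) by rewrite !mxE; ring.
  have : `|symm0 z i j - symm0 y i j| < d / (`|e| + 1).
    by rewrite !mxE; case: ifP => _; exact: zy.
  rewrite normrM ltr_pdivlMr ?ltr_wpDl // mulrC; apply: le_lt_trans.
  by rewrite ler_wpM2r // lerDl.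
have mdet e : meas (fun y : 'I_p * 'I_p -> R => \det (2^-1%:M + e *: symm0 y)).
  have mprod (f : 'I_p -> 'I_p) : measurable_fun setT (fun y : Xtype R ('I_p * 'I_p) =>
      \prod_(i < p) (2^-1%:M + e *: symm0 y) i (f i) : measurableTypeR R).
    elim: (index_enum _) => [|i l IH].
      by rewrite (_ : (fun _ => _) = cst 1) //; apply/funext => y; rewrite big_nil.
    have -> : (fun y : Xtype R ('I_p * 'I_p) =>
        \prod_(j <- i :: l) (2^-1%:M + e *: symm0 y) j (f j) : measurableTypeR R) =
      (fun y => ((2^-1%:M : 'M[R]_p) i (f i) + e * y (if (i <= f i)%N then (i, f i) else (f i, i))) *
        \prod_(j <- l) (2^-1%:M + e *: symm0 y) j (f j)).
      by apply/funext => y; rewrite big_cons !mxE; case: ifP.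
    apply: measurable_funM => //; apply: measurable_funD => //; apply: measurable_funM => //.
    exact: measurable_coord.
  rewrite /meas /determinant; apply: measurable_sum => s; apply: measurable_funM => //.
  exact: mprod.
have E : (fun y => wt r N (symm0 y)) = (fun y : Xtype R ('I_p * 'I_p) =>
    \1_(O r `&` O (- r)) y * Num.sqrt (\det (2^-1%:M + r *: symm0 y) *
      \det (2^-1%:M + (- r) *: symm0 y)) ^+ N).
  apply/funext => y; rewrite /wt indicE -scaleNr; case: asboolP => h.
    by rewrite mem_set ?mul1r.
  by rewrite memNset ?mul0r.
rewrite /meas E; apply: measurable_funM; first by apply: measurable_indic; exact: measurableI.
apply: measurable_funX; apply: (measurableT_comp (continuous_measurable_fun (@sqrt_continuous R))).
by apply: measurable_funM; exact: mdet.
Qed.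

End Weights.

(** * Levels as blocks of coordinates *)

Section Blocks.
Variables (R : realType) (p : nat).
Local Notation T := (nat * 'I_p * 'I_p)%type.
Implicit Types (y : T -> R) (l m j : nat) (X : 'M[R]_p).

(* [y (l, i, j)], for [i <= j], is the [(i, j)] entry of the [l]-th moment; levels
   are numbered from 1, and one index type serves all [n]. *)
Definition sm y l : 'M[R]_p := symm0 (fun c : 'I_p * 'I_p => y (l, c.1, c.2)).
Definition blk l : seq T := [seq (l, c.1, c.2) | c <- utri p].
Definition blks l m : seq T := flatten [seq blk j | j <- iota l m].
Definition setl l y X : T -> R :=
  fun b => if (b.1.1 == l) && up (b.1.2, b.2) then X b.1.2 b.2 else y b.

Lemma mem_blk l (b : T) : (b \in blk l) = (b.1.1 == l) && up (b.1.2, b.2).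
Proof.
case: b => [[j u] v] /=; apply/mapP/andP => [[c]|[/eqP -> ub]].
  by rewrite mem_utri => uc [-> -> ->]; split=> //; case: c uc.
by exists (u, v) => //; rewrite mem_utri.
Qed.

Lemma mem_blks l m (b : T) : (b \in blks l m) = (l <= b.1.1 < l + m)%N && up (b.1.2, b.2).
Proof.
apply/flattenP/andP => [[_ /mapP[j jl ->]]|[bl ub]].
  by rewrite mem_blk => /andP[/eqP -> ->]; rewrite mem_iota in jl.
by exists (blk b.1.1); [apply: map_f; rewrite mem_iota|rewrite mem_blk eqxx].
Qed.

Lemma inj_blk l : injective (fun c : 'I_p * 'I_p => (l, c.1, c.2)).
Proof. by move=> [a b] [c d] [-> ->]. Qed.

Lemma blk_uniq l : uniq (blk l).
Proof. by rewrite map_inj_uniq ?utri_uniq //; exact: inj_blk. Qed.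

Lemma blksS l m : blks l m.+1 = blk l ++ blks l.+1 m.
Proof. by []. Qed.

Lemma blks_cat l m m' : blks l (m + m') = blks l m ++ blks (l + m) m'.
Proof. by rewrite /blks iotaD map_cat flatten_cat. Qed.

Lemma blks_uniq l m : uniq (blks l m).
Proof.
elim: m l => // m IH l; rewrite blksS cat_uniq blk_uniq IH andbT /=.
by apply/hasPn => b; rewrite mem_blks mem_blk => /andP[h _]; case: eqP => // e; move: h; rewrite e; lia.
Qed.

Lemma sm_sym y l : (sm y l)^T = sm y l.
Proof. exact: symm0_sym. Qed.

Lemma sm_dep y y' l : (forall b, b \in blk l -> y b = y' b) -> sm y l = sm y' l.
Proof. by move=> e; apply: symm0_dep => c uc; apply: e; rewrite mem_blk eqxx -surjective_pairing. Qed.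

Lemma sm_upd y a t l : a \notin blk l -> sm (upd y a t) l = sm y l.
Proof. by move=> al; apply: sm_dep => b bl; rewrite upd_neq //; apply: contraNneq al => <-. Qed.

Lemma sm_setl l y X j : X^T = X -> sm (setl l y X) j = if j == l then X else sm y j.
Proof.
move=> sX; case: eqVneq => [->|jl].
  rewrite -[RHS]symm0_vec //; apply: symm0_dep => c uc.
  by rewrite /setl /= eqxx -surjective_pairing uc.
by apply: sm_dep => b; rewrite mem_blk /setl => /andP[/eqP -> _]; rewrite (negPf jl).
Qed.

Lemma setl_off l y X b : b \notin blk l -> setl l y X b = y b.
Proof. by rewrite mem_blk /setl => /negPf ->. Qed.

Lemma blk_symint l (h : (T -> R) -> R) y :
  (forall z z', (forall j, sm z j = sm z' j) -> h z = h z') ->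
  iint (blk l) h y = symint (fun X => h (setl l y X)).
Proof.
move=> hd; pose e (c : 'I_p * 'I_p) : T := (l, c.1, c.2).
rewrite (eq_iint (g' := fun z => h (setl l y (symm0 (z \o e))))); last first.
  move=> z ze; apply: hd => j; rewrite sm_setl ?symm0_sym //; case: eqP => [->//|jl].
  by apply: sm_dep => b bj; apply: ze; move: bj; rewrite !mem_blk => /andP[/eqP -> _]; case: eqP.
rewrite (iint_map _ (fun z => h (setl l y (symm0 z)))); last exact: inj_blk.
exact: symint_base.
Qed.

Lemma meas_sm l r N : meas (fun y => wt r N (sm y l)).
Proof.
pose e (y : Xtype R T) : Xtype R ('I_p * 'I_p) := fun c => y (l, c.1, c.2).
have me : measurable_fun setT e by apply: measurable_to_Xtype => c; exact: measurable_coord.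
have mw : meas (fun z : 'I_p * 'I_p -> R => wt r N (symm0 z)) by exact: wt_meas.
exact: (measurableT_comp mw me).
Qed.

Lemma meas_setl l y h : meas h -> meas (fun z => h (setl l y (symm0 z))).
Proof.
move=> mh; pose e (z : Xtype R ('I_p * 'I_p)) : Xtype R T := setl l y (symm0 z).
suff me : measurable_fun setT e by exact: (measurableT_comp mh me).
apply: measurable_to_Xtype => b; rewrite /e /setl.
case bl : ((b.1.1 == l) && up (b.1.2, b.2)); last exact: measurable_cst.
move/andP: bl => [_ ub].
have -> : (fun z : Xtype R ('I_p * 'I_p) => symm0 z b.1.2 b.2) = fun z => z (b.1.2, b.2).
  by apply/funext => z; rewrite mxE; move: ub; rewrite /up /= => ->.
exact: measurable_coord.
Qed.

End Blocks.

(** * One level of the passage to canonical moments *)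

Section Level.
Variables (R : realType) (p : nat).
Hypothesis p0 : (0 < p)%N.
Implicit Types (S : nat -> 'M[R]_p) (A B V X : 'M[R]_p) (r : R).

(* For [r = (4 (p + 1) n)^(-1/2)] these are the matrices of the theorem. *)
Definition canX r S l : 'M[R]_p := r^-1 *: (canU S l - 2^-1%:M).

Lemma eq_canX r S S' l : (forall k, (k <= l)%N -> S k = S' k) -> canX r S l = canX r S' l.
Proof.
move=> e; rewrite /canX /canU (e l) // (@eq_Sminus _ _ p0 S S') ?(@eq_Splus _ _ p0 S S') //.
  by move=> k /ltnW; exact: e.
by move=> k /ltnW; exact: e.
Qed.

Lemma pd_conj B V : B^T = B -> B \in unitmx -> pd (B *m V *m B) <-> pd V.
Proof.
move=> sB uB; split=> [h|h]; last by have := pd_congr h (M := B); rewrite sB row_free_unit; exact.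
have := pd_congr h (M := invmx B); rewrite row_free_unit unitmx_inv uB trmx_inv sB => /(_ isT).
by rewrite !mulmxA mulVmx // mul1mx -mulmxA mulmxV // mulmx1.
Qed.

Lemma msqrt_pd A : pd A -> pd (msqrt A) /\ msqrt A *m msqrt A = A.
Proof.
move=> pA; have [B Bh] := psd_sqrt (pd_psd pA).
have [psB BB] : [set B | psd B /\ B *m B = A] (msqrt A) by apply: (xgetPex 0); exists B.
split=> //; apply: psd_det_pd => //; have := pd_det pA.
by rewrite -{1}BB det_mulmx; apply: contraTneq => ->; rewrite mul0r ltxx.
Qed.

Lemma eq_inside S S' l : (forall k, (k <= l)%N -> S k = S' k) -> inside l S -> inside l S'.
Proof.
move=> e h k kl; have := h k kl; case/andP: kl => _ kl.
rewrite (e k kl) (@eq_Sminus _ _ p0 S S') ?(@eq_Splus _ _ p0 S S') // => j jk; apply: e; lia.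
Qed.

Section Step.
Variables (r : R) (S : nat -> 'M[R]_p) (l : nat).
Hypothesis r0 : 0 < r.
Hypothesis sS : forall k, (S k)^T = S k.
Hypothesis S0 : S 0%N = 1%:M.
Hypothesis iS : inside l S.

(** With [D] the gap, [U - 1/2 = D^(-1/2) (S - S^- - D/2) D^(-1/2)]. So [stepA] is the midpoint of
    the admissible interval, and [stepM = r^(1/2) D^(1/2)] absorbs the scaling by [r]. *)
Definition stepM := Num.sqrt r *: msqrt (gap S l.+1).
Definition stepA := Sminus S l.+1 + 2^-1 *: gap S l.+1.

Let pdD : pd (gap S l.+1).
Proof. exact: gap_pd. Qed.

Lemma stepM_pd : pd stepM.
Proof. by apply: pdZ; [rewrite sqrtr_gt0|exact: (msqrt_pd pdD).1]. Qed.

Lemma stepA_sym : stepA^T = stepA.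
Proof.
have := Sminus_sym p0 l.+1 sS; rewrite /stepA; move: (Sminus _ _) => A0 sA0.
by rewrite linearD linearZ /= sA0 pdD.1.
Qed.

Lemma det_stepM : \det stepM = Num.sqrt r ^+ p * Num.sqrt (\det (gap S l.+1)).
Proof.
have [pB BB] := msqrt_pd pdD.
rewrite detZ; congr (_ * _); rewrite -[in RHS]BB det_mulmx -expr2 sqrtr_sqr ger0_norm //.
exact/ltW/pd_det.
Qed.

Variable S' : nat -> 'M[R]_p.
Hypothesis sS' : forall k, (S' k)^T = S' k.
Hypothesis S'S : forall k, (k <= l)%N -> S' k = S k.

Let Sm : Sminus S' l.+1 = Sminus S l.+1.
Proof. by apply: eq_Sminus => // k; rewrite ltnS; exact: S'S. Qed.
Let Sp : Splus S' l.+1 = Splus S l.+1.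
Proof. by apply: eq_Splus => // k; rewrite ltnS; exact: S'S. Qed.
Let gE : gap S' l.+1 = gap S l.+1.
Proof. by rewrite /gap Sm Sp. Qed.

Lemma canX_step : canX r S' l.+1 = invmx stepM *m (S' l.+1 - stepA) *m invmx stepM.
Proof.
have [pB BB] := msqrt_pd pdD; have uB := pd_unit pB.
rewrite /canX /canU -/(gap S' l.+1) gE Sm /stepM /stepA.
move: pB BB uB; set B := msqrt _ => pB BB uB.
have s0 : Num.sqrt r \is a GRing.unit by rewrite unitfE gt_eqF // sqrtr_gt0.
rewrite invmxZ ?unitmxZ // -!scalemxAl -!scalemxAr scalerA -invfM -expr2 sqr_sqrtr ?ltW //.
congr (_ *: _); rewrite opprD addrA [in RHS]mulmxBr [in RHS]mulmxBl; congr (_ - _).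
rewrite -BB -scalemxAr -scalemxAl !mulmxA mulVmx // mul1mx mulmxV //.
by rewrite scalemx1.
Qed.

Let X := canX r S' l.+1.
Let XE : canU S' l.+1 = 2^-1%:M + r *: X.
Proof. by rewrite /X /canX scalerA divff ?gt_eqF // scale1r addrC subrK. Qed.

Let stepE : let B := msqrt (gap S l.+1) in
  S' l.+1 - Sminus S' l.+1 = B *m (2^-1%:M + r *: X) *m B /\
  Splus S' l.+1 - S' l.+1 = B *m (2^-1%:M - r *: X) *m B.
Proof.
move=> B; have [pB BB] := msqrt_pd pdD; have uB := pd_unit pB.
have e1 : S' l.+1 - Sminus S' l.+1 = B *m (2^-1%:M + r *: X) *m B.
  rewrite -XE /canU -/(gap S' l.+1) gE !mulmxA mulmxV // mul1mx -mulmxA mulVmx //.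
  by rewrite mulmx1.
split=> //.
have -> : Splus S' l.+1 - S' l.+1 = gap S l.+1 - (S' l.+1 - Sminus S' l.+1).
  by rewrite -gE /gap opprB addrA subrK.
have -> : 2^-1%:M - r *: X = 1%:M - (2^-1%:M + r *: X).
  rewrite opprD addrA -raddfB /=; congr (_%:M - _); lra.
by rewrite e1 -BB mulmxBr mulmx1 mulmxBl.
Qed.

Lemma inside_step : inside l.+1 S' <-> pd (2^-1%:M + r *: X) /\ pd (2^-1%:M - r *: X).
Proof.
have [pB BB] := msqrt_pd pdD; have uB := pd_unit pB; have [e1 e2] := stepE.
have c1 := pd_conj (2^-1%:M + r *: X) pB.1 uB.
have c2 := pd_conj (2^-1%:M - r *: X) pB.1 uB.
rewrite -e1 in c1; rewrite -e2 in c2.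
split=> [h|[h1 h2]].
  by have [|/c1 ? /c2 ?] := h l.+1; first by rewrite leqnn.
have iS' : inside l S' by apply: (eq_inside _ iS) => k kl; rewrite S'S.
move=> k /andP[k1 k2]; have [->|kl] := eqVneq k l.+1; first by split; [apply/c1|apply/c2].
by apply: iS'; rewrite k1 -ltnS ltn_neqAle kl.
Qed.

Lemma det_gap_step : inside l.+1 S' -> Num.sqrt (\det (gap S' l.+2)) =
  Num.sqrt (\det (gap S l.+1)) *
  Num.sqrt (\det (2^-1%:M + r *: X) * \det (2^-1%:M - r *: X)).
Proof.
move=> iS'; have S'0 : S' 0%N = 1%:M by rewrite S'S.
have [pB BB] := msqrt_pd pdD; have [e1 e2] := stepE.
have := det_gapS p0 sS' S'0 iS'; rewrite e1 e2 gE !det_mulmx.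
have dD := pd_det pdD; have D0 : \det (gap S l.+1) != 0 by rewrite gt_eqF.
rewrite -sqrtrM ?ltW // => h; congr Num.sqrt; apply: (mulIf D0).
have DE : \det (gap S l.+1) = \det (msqrt (gap S l.+1)) ^+ 2 by rewrite -{1}BB det_mulmx.
by rewrite h DE; ring.
Qed.

End Step.
End Level.

Lemma iint0 (R : realType) (T : eqType) (s : seq T) (x : T -> R) : iint s (fun _ => 0) x = 0.
Proof.
elim: s x => //= a s IH x; transitivity (Rintegral (@lebesgue_measure R) setT (fun=> 0)).
  by apply: eq_Rintegral => t _; exact: IH.
by rewrite /Rintegral integral0.
Qed.

Section Weights.
Variables (R : realType) (p : nat).
Local Notation T := (nat * 'I_p * 'I_p)%type.
Implicit Types (y : T -> R) (X : 'M[R]_p) (r : R).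

Lemma wt_le1 r N X : X^T = X -> wt r N X <= 1.
Proof.
move=> sX; apply: (le_trans (wt_le r N sX)); have [d [-> _]] := wt_spec sX.
rewrite mulr_ile1 ?expR_ge0 ?exprn_ge0 ?invr_ge0 //.
  by rewrite !exprn_ile1 ?exprn_ge0 ?invr_ge0 ?invf_le1 ?ler1n.
rewrite -expR0 ler_expR oppr_le0; apply: mulr_ge0; last by apply: sumr_ge0 => i _; exact: sqr_ge0.
by rewrite mulr_ge0 // mulr_ge0 // sqr_ge0.
Qed.

(** Level [l + j] is followed by [m - j.+1] levels, and the determinant of each of their gaps
    contains its factor. At the last level the exponent is 0 and [wt] is the indicator of
    [0 < U < 1]. *)
Definition wprod r l m y := \prod_(j < m) wt r (p.+1 * (m - j.+1)) (sm y (l + j)).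

Lemma wprodS r l m y : wprod r l m.+1 y = wt r (p.+1 * m) (sm y l) * wprod r l.+1 m y.
Proof.
rewrite /wprod big_ord_recl subn1 addn0; congr (_ * _); apply: eq_bigr => j _.
by rewrite /= /bump /= !add1n subSS addnS addSn.
Qed.

Lemma wprod_ge0 r l m y : 0 <= wprod r l m y.
Proof. by apply: prodr_ge0 => j _; exact: wt_ge0. Qed.

Lemma wprod_le1 r l m y : wprod r l m y <= 1.
Proof. by apply: prodr_ile1 => j _; rewrite wt_ge0 wt_le1 ?sm_sym. Qed.

Lemma meas_wprod r l m : meas (wprod r l m).
Proof. by apply: measurable_prod => j _; exact: meas_sm. Qed.

Lemma wprod_box r l m y : 0 < r -> wprod r l m y != 0 ->
  forall b, b \in blks p l m -> `|y b| <= r^-1.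
Proof.
move=> r0 W0 b; rewrite mem_blks => /andP[/andP[lb bl] ub].
have jm : (b.1.1 - l < m)%N by rewrite ltn_subLR.
have : wt r (p.+1 * (m - (b.1.1 - l).+1)) (sm y b.1.1) != 0.
  apply: contraNneq W0 => w0; rewrite /wprod (bigD1 (Ordinal jm)) //= subnKC // w0.
  by rewrite mul0r.
move=> /(wt_box r0 (sm_sym y b.1.1)) /(_ b.1.2 b.2); rewrite mxE.
by case: b ub {lb bl jm} => [[j u] v] /= ; rewrite /up /= => ->.
Qed.

Lemma wprod_dep r l m y y' : (forall j, sm y j = sm y' j) -> wprod r l m y = wprod r l m y'.
Proof. by move=> e; apply: eq_bigr => j _; rewrite e. Qed.

End Weights.

(** * Integrating out the levels *)

Section Reduction.
Variables (R : realType) (p : nat).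
Hypothesis p0 : (0 < p)%N.
Local Notation T := (nat * 'I_p * 'I_p)%type.
Local Notation RM := (measurableTypeR R).
Local Notation leb := (@lebesgue_measure R).
Variable phi : RM -> R.
Hypothesis mphi : measurable_fun setT phi.
Hypothesis phi0 : forall t, 0 <= phi t.
Hypothesis iphi : leb.-integrable setT (EFin \o phi).
Hypothesis phiL : forall L : R, exists2 m, 0 < m & forall t, `|t| <= L -> m <= phi t.
Variables (r : R) (n : nat) (fs : (nat -> 'M[R]_p) -> R).
Hypothesis r0 : 0 < r.
Hypothesis fs_dep : forall s s', (forall j, (0 < j <= n)%N -> s j = s' j) -> fs s = fs s'.
Hypothesis mfs : meas (fun y : T -> R => fs (sm y)).
Hypothesis fsB : exists B, forall s, `|fs s| <= B.
Implicit Types (y x : T -> R).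

Definition wfs l m y := wprod r l m y * fs (sm y).
Definition wint l m y := iint (blks p l m) (wfs l m) y.

Lemma meas_wfs l m : meas (wfs l m).
Proof. by apply: measurable_funM => //; exact: meas_wprod. Qed.

Lemma wfs_dom l m : exists C : R, dom phi (blks p l m) (cst C) (wfs l m).
Proof.
have [B fB] := fsB; apply: (@dom_box _ _ phi phi0 _ _ B r^-1 phiL) => [y|y].
  rewrite normrM ger0_norm ?wprod_ge0 //; apply: le_trans (fB (sm y)).
  by rewrite ler_piMl // wprod_le1.
by rewrite mulf_eq0 negb_or => /andP[W0 _]; exact: wprod_box.
Qed.

Lemma wint_bound l m : exists B, forall y, `|wint l m y| <= B.
Proof.
have [C dC] := wfs_dom l m.
exists (C * Rintegral leb setT phi ^+ size (blks p l m)) => y.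
exact: (iint_bound phi0 iphi y (blks_uniq p l m) (meas_wfs l m) dC).
Qed.

Lemma meas_wint l m : meas (wint l m).
Proof. by apply: meas_iint; exact: meas_wfs. Qed.

Lemma wint_dep l m y y' : (forall j, sm y j = sm y' j) -> wint l m y = wint l m y'.
Proof.
move=> e; apply: (iint_dep (Q := fun b : T => up (b.1.2, b.2))) => [z z' ze|[[j u] v] ub _].
  have ee j : sm z j = sm z' j.
    by apply: sm_dep => b; rewrite mem_blk => /andP[_]; exact: ze.
  by rewrite /wfs (wprod_dep _ _ _ ee); congr (_ * _); apply: fs_dep => j _; exact: ee.
have := congr1 (fun X : 'M[R]_p => X u v) (e j); rewrite !mxE.
by move: ub; rewrite /up /= => ->.
Qed.

Lemma wintS l m y : wint l m.+1 y =
  iint (blk p l) (fun z => wt r (p.+1 * m) (sm z l) * wint l.+1 m z) y.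
Proof.
rewrite /wint blksS iint_cat; apply: eq_iint_fun => z.
have [C dC] := wfs_dom l.+1 m.
rewrite -(iintM phi0 iphi _ (blks_uniq p l.+1 m) (meas_wfs l.+1 m) dC (h := fun z => wt r (p.+1 * m) (sm z l))).
  by apply: eq_iint_fun => u; rewrite /wfs wprodS mulrA.
move=> a u t; rewrite mem_blks => /andP[al _]; rewrite sm_upd // mem_blk.
by apply/negP => /andP[/eqP e _]; move: al; rewrite e; lia.
Qed.

Definition levelF l m x X := wt r (p.+1 * m) X * wint l.+1 m (setl l x X).

Lemma levelF_box l m x : boxfun (levelF l m x).
Proof.
split.
- apply: measurable_funM; first exact: wt_meas.
  exact: (meas_setl l x (meas_wint l.+1 m)).
- have [B hB] := wint_bound l.+1 m; exists B => X; rewrite normrM ger0_norm ?wt_ge0 //.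
  have [sX|] := pselect (X^T = X).
    by rewrite (le_trans _ (hB (setl l x X))) // ler_piMl // wt_le1.
  (* The bound of [boxfun] concerns every matrix; if [X] is not symmetric, neither is [1/2 + r X],
     so [pd] fails and the weight is 0. *)
  move=> nX; rewrite /wt; case: asboolP => [[[+ _] _]|_]; last by rewrite mul0r (le_trans _ (hB x)).
  rewrite linearD linearZ /= tr_scalar_mx => /addrI/(scalerI (lt0r_neq0 r0)) //.
exists r^-1 => X sX; rewrite mulf_eq0 negb_or => /andP[w0 _]; exact: wt_box w0.
Qed.

Lemma symint_levelF l m x : symint (levelF l m x) = wint l m.+1 x.
Proof.
rewrite wintS blk_symint.
  by apply: eq_symint => X sX; rewrite sm_setl // eqxx.
by move=> z z' e; rewrite e (wint_dep _ _ e).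
Qed.

Definition Sq y j : 'M[R]_p := if j is _.+1 then sm y j else 1%:M.
Definition toc y : coordT p n -> R := fun c => y (c.1.1.+1, c.1.2, c.2).
Definition unifs y := \1_(@moment_space R p n) (toc y) * fs (canX r (Sseq (toc y))).

Lemma Sq_sym y j : (Sq y j)^T = Sq y j.
Proof. by case: j => [|j]; [rewrite trmx1|rewrite sm_sym]. Qed.

Lemma Sseq_toc y j : (j <= n)%N -> Sseq (toc y) j = Sq y j.
Proof.
case: j => // j jn; rewrite (SseqE _ jn); apply/matrixP => u v.
by rewrite !mxE.
Qed.

Lemma horner_sm y l a : exists P : 'M[{poly R}]_p, forall t, sm (upd y a t) l = map_mx (horner_eval t) P.
Proof.
pose c (b : T) : {poly R} := if b == a then 'X else (y b)%:P.
exists (\matrix_(u, v) c (if (u <= v)%N then (l, u, v) else (l, v, u))) => t.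
apply/matrixP => u v; rewrite !mxE /horner_eval /c.
by case: ifP => _; rewrite updE; case: eqP => _; rewrite ?hornerX ?hornerC.
Qed.

Lemma det_horner (P : 'M[{poly R}]_p) (A : 'M[R]_p) t :
  \det (map_mx (horner_eval t) P - A) = (\det (P - map_mx polyC A)).[t].
Proof.
rewrite -[RHS]/(horner_eval t _) -det_map_mx map_mxB; congr (\det (_ - _)).
by apply/matrixP => u v; rewrite !mxE /= /horner_eval hornerC.
Qed.

(** Along a coordinate line the entries are polynomials, and the determinant commutes with
    evaluation; this feeds [iint_off_null]. The sign [(-1) ^+ p] comes from reversing [B - S]. *)
Lemma nonboundary_poly l (A B : 'M[R]_p) y a : exists P : {poly R}, forall t,
  \det (sm (upd y a t) l - A) * \det (B - sm (upd y a t) l) = P.[t].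
Proof.
have [P PE] := horner_sm y l a.
exists (\det (P - map_mx polyC A) * ((-1) ^+ p * \det (P - map_mx polyC B))) => t.
rewrite hornerM hornerM -!det_horner -PE; congr (_ * _).
rewrite -opprB -scaleN1r detZ; congr (_ * _).
by rewrite -[RHS]/(horner_eval t _) rmorphXn rmorphN1.
Qed.

Lemma inside_toc l y : (l <= n)%N -> inside l (Sq y) <-> inside l (Sseq (toc y)).
Proof.
move=> ln; split; apply: (eq_inside p0) => j jl; rewrite Sseq_toc //; exact: leq_trans ln.
Qed.

(** A point of the moment space satisfies the weak inequalities; with nonzero determinants they
    would be strict and the point [inside]. *)
Lemma unifs0 l y : (l < n)%N -> inside l (Sq y) ->
  \det (Sq y l.+1 - Sminus (Sq y) l.+1) * \det (Splus (Sq y) l.+1 - Sq y l.+1) != 0 ->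
  ~ inside l.+1 (Sq y) -> unifs y = 0.
Proof.
move=> ln il; rewrite mulf_eq0 negb_or => /andP[d1 d2] nil.
rewrite /unifs indicE; have [/set_mem yM|_] := boolP (toc y \in _); last by rewrite mul0r.
exfalso; apply: nil.
have eS j : (j <= l.+1)%N -> Sseq (toc y) j = Sq y j by move=> jl; rewrite Sseq_toc //; exact: leq_trans ln.
have := moment_space_next p0 yM ln ((inside_toc y (ltnW ln)).1 il).
rewrite (@eq_Sminus _ _ p0 _ _ _ (fun j jl => eS j (ltnW jl))) (@eq_Splus _ _ p0 _ _ _ (fun j jl => eS j (ltnW jl))) eS //.
move=> [/psd_det_pd/(_ d1) h1 /psd_det_pd/(_ d2) h2] j /andP[j1 j2].
have [->//|jl] := eqVneq j l.+1.
by apply: il; rewrite j1 -ltnS ltn_neqAle jl.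
Qed.

Lemma boxfunZ (c : R) (F : 'M[R]_p -> R) : boxfun F -> boxfun (fun X => c * F X).
Proof.
move=> [mF [B FB] [L FL]]; split.
- by apply: measurable_funM => //; exact: measurable_cst.
- by exists (`|c| * B) => X; rewrite normrM ler_wpM2l.
by exists L => X sX; rewrite mulf_eq0 negb_or => /andP[_]; exact: FL.
Qed.

Lemma symintZ (c : R) (F : 'M[R]_p -> R) : boxfun F -> symint (fun X => c * F X) = c * symint F.
Proof.
move=> bF; have [mF _ _] := bF.
have [C dF] := boxfun_dom phi0 phiL bF (fun a (h : a \in utri p) => h).
exact: (iintM phi0 iphi _ (utri_uniq p) mF dF (h := fun=> c)).
Qed.

Lemma canX_sym (S : nat -> 'M[R]_p) l : (forall k, (S k)^T = S k) -> (canX r S l)^T = canX r S l.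
Proof.
move=> sS; have [sB|sB] := pselect ((msqrt (Splus S l - Sminus S l))^T = msqrt (Splus S l - Sminus S l)).
  rewrite /canX /canU; have := Sminus_sym p0 l sS.
  move: sB; move: (msqrt _) => B sB; move: (Sminus S l) => A sA.
  have h : (invmx B *m (S l - A) *m invmx B)^T = invmx B *m (S l - A) *m invmx B.
    by rewrite !trmx_mul linearB /= trmx_inv sB sS sA mulmxA.
  rewrite linearZ /=; congr (_ *: _); move: h; move: (_ *m _) => V h.
  by rewrite linearB /= h tr_scalar_mx.
(* When no square root exists, [xget] returns 0, which is symmetric too. *)
exfalso; apply: sB; rewrite /msqrt; case: xgetP => [B _ [[]]//|_]; exact: trmx0.
Qed.

Definition levelC := (Num.sqrt r ^+ p) ^+ p.+1.

(* Integrating out level [l + 1] contributes [det (gap (Sq y) l.+1) ^ ((p + 1) / 2)] for the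
   change of variables, and the remaining levels a power of the determinant of
   gap [l + 2], which factors by [det_gap_step]. *)
Lemma reduction m l y x : (l + m)%N = n -> inside l (Sq y) ->
  (forall j, (0 < j <= l)%N -> sm x j = canX r (Sq y) j) ->
  iint (blks p l.+1 m) unifs y =
    levelC ^+ m * Num.sqrt (\det (gap (Sq y) l.+1)) ^+ (p.+1 * m) * wint l.+1 m x.
Proof.
elim: m l y x => [|m IH] l y x lm iy xE.
  rewrite muln0 !expr0 !mul1r /wint /= /wfs /wprod big_ord0 mul1r /unifs.
  rewrite addn0 in lm; rewrite indicE mem_set ?mul1r; last first.
    by apply: moment_space_inside => //; apply/inside_toc; rewrite ?lm // -lm.
  apply: fs_dep => j /andP[j0 jn]; rewrite xE ?j0 ?lm //; apply: (eq_canX p0) => k kj.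
  by rewrite Sseq_toc // (leq_trans kj).
have ln : (l < n)%N by rewrite -lm; lia.
have sy := Sq_sym y; have S0 : Sq y 0 = 1%:M by [].
set M := stepM r (Sq y) l; set A := stepA (Sq y) l.
set d := Num.sqrt (\det (gap (Sq y) l.+1)).
have pdM : pd M by exact: stepM_pd.
have pdD : pd (gap (Sq y) l.+1) by exact: gap_pd.
pose c := levelC ^+ m * d ^+ (p.+1 * m).
pose F X := c * levelF l.+1 m x X.
have bF : boxfun F by apply: boxfunZ; exact: levelF_box.
rewrite blksS iint_cat.
(* The bounds are frozen at [y], so [q] is a polynomial in the variables of level [l.+1] alone. *)
pose q z := \det (sm z l.+1 - Sminus (Sq y) l.+1) * \det (Splus (Sq y) l.+1 - sm z l.+1).
rewrite (@iint_off_null _ _ _ _ (fun z => F (invmx M *m (sm z l.+1 - A) *m invmx M)) q); first last.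
- move=> z zy qz.
  have zE j : (j <= l)%N -> Sq z j = Sq y j.
    case: j => // j jl; apply: sm_dep => b; rewrite mem_blk => /andP[/eqP bj _].
    by apply: zy; rewrite mem_blk bj; apply/negP => /andP[/eqP e _]; move: jl; rewrite e ltnn.
  have iz : inside l (Sq z) by apply: (eq_inside p0 _ iy) => j jl; rewrite zE.
  have XE : invmx M *m (sm z l.+1 - A) *m invmx M = canX r (Sq z) l.+1.
    exact: esym (@canX_step _ _ p0 r (Sq y) l r0 sy S0 iy (Sq z) zE).
  (* If [z] leaves the admissible interval, so does every point sharing its first [l.+1] levels; the
     inner integral is 0, and so is the weight on the right. *)
  have [iz1|niz] := pselect (inside l.+1 (Sq z)); last first.
    rewrite (@eq_iint _ _ _ _ (fun=> 0)); last first.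
      move=> u uz; have uE j : (j <= l.+1)%N -> Sq u j = Sq z j.
        case: j => // j jl; apply: sm_dep => b; rewrite mem_blk => /andP[/eqP bj _].
        by apply: uz; rewrite mem_blks bj; apply/negP => /andP[/andP[e _] _]; move: jl; lia.
      apply: (unifs0 ln).
      - by apply: (eq_inside p0 _ iz) => j jl; rewrite uE // leqW.
      - have e j (jl : (j < l.+1)%N) : Sq u j = Sq y j by rewrite uE ?zE // ltnW.
        by rewrite (uE _ (leqnn _)) (eq_Sminus p0 e) (eq_Splus p0 e).
      - by move=> h; apply: niz; apply: (eq_inside p0 _ h) => j jl; rewrite uE.
    rewrite iint0 /F /levelF /wt; case: asboolP => [h|_]; last by rewrite mul0r mulr0.
    exfalso; apply: niz; refine ((@inside_step _ _ p0 r (Sq y) l r0 sy S0 iy (Sq z) zE).2 _).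
    by rewrite -XE.
  rewrite XE (IH l.+1 z (setl l.+1 x (canX r (Sq z) l.+1))) //; last first.
  + move=> j /andP[j0 jl]; rewrite sm_setl; last exact: canX_sym (Sq_sym z).
    case: eqVneq => [->//|jl1]; have {}jl : (j <= l)%N by rewrite -ltnS ltn_neqAle jl1.
    rewrite xE; last by rewrite j0.
    by apply: (eq_canX p0) => i ij; rewrite zE //; exact: leq_trans jl.
  + by rewrite -lm addSnnS.
  rewrite (@det_gap_step _ _ p0 r (Sq y) l r0 sy S0 iy (Sq z) (Sq_sym z) zE iz1) -/d /F /levelF /wt.
  have /asboolP -> := (@inside_step _ _ p0 r (Sq y) l r0 sy S0 iy (Sq z) zE).1 iz1.
  by rewrite exprMn /c -!mulrA.
(* At the midpoint both factors of [q] are the determinant of half the gap, so [q] is not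
   identically zero. *)
- exists (setl l.+1 y (Sminus (Sq y) l.+1 + 2^-1 *: gap (Sq y) l.+1)).
    by move=> b /setl_off ->.
  have sP : (Sminus (Sq y) l.+1 + 2^-1 *: gap (Sq y) l.+1)^T =
      Sminus (Sq y) l.+1 + 2^-1 *: gap (Sq y) l.+1 by exact: (stepA_sym p0 sy S0 iy).
  rewrite /q sm_setl // eqxx addrC addKr.
  have -> : Splus (Sq y) l.+1 - (Sminus (Sq y) l.+1 + 2^-1 *: gap (Sq y) l.+1) =
      2^-1 *: gap (Sq y) l.+1.
    rewrite opprD addrA -/(gap _ _) -{1}[gap _ _]scale1r -scalerBl; congr (_ *: _); lra.
  by rewrite mulf_neq0 // detZ mulf_neq0 ?gt_eqF ?pd_det // expf_neq0 // invr_neq0 // pnatr_eq0.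
- move=> z a; exact: nonboundary_poly.
rewrite blk_symint; last by move=> z z' e; rewrite e.
rewrite (eq_symint (G := fun X => F (invmx M *m (X - A) *m invmx M))); last first.
  by move=> X sX; rewrite sm_setl // eqxx.
rewrite (symint_congr mphi phi0 iphi phiL) //; last exact: stepA_sym.
have -> : symint F = c * wint l.+1 m.+1 x.
  by rewrite symintZ ?symint_levelF //; exact: levelF_box.
rewrite det_stepM // exprMn -/d -/levelC /c [levelC ^+ m.+1]exprS mulnS exprD.
by move: levelC (d ^+ p.+1) (d ^+ _) (wint _ _ _) (levelC ^+ m) => a b e f g; ring.
Qed.

End Reduction.

(** * Uniform expectations in canonical coordinates *)

Section Coordinates.
Variables (R : realType) (p : nat).
Local Notation T := (nat * 'I_p * 'I_p)%type.

Definition shift_coord n (c : coordT p n) : T := (c.1.1.+1, c.1.2, c.2).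

Lemma inj_shift_coord n : injective (@shift_coord n).
Proof. by move=> [[a b] c] [[a' b'] c'] [/val_inj -> -> ->]. Qed.

Lemma enum_pairs (A B : finType) :
  enum [pred _ : A * B | true] = [seq (a, b) | a <- enum A, b <- enum B].
Proof.
transitivity (enum {: A * B}); first by apply: eq_enum.
by rewrite [LHS]enumT [in LHS]unlock.
Qed.

(** An equality of lists rather than a permutation: the uniform integrand must be met in exactly the
    order of [lebint]. *)
Lemma map_coords n : [seq shift_coord c | c <- coords p n] = blks p 1 n.
Proof.
have -> : blks p 1 n = flatten [seq blk p j.+1 | j <- [seq \val i | i <- enum 'I_n]].
  by rewrite val_enum_ord /blks -[1%N]addn0 iotaDl -map_comp.
rewrite /coords enum_pairs.
have -> : enum ({: 'I_n * 'I_p}) = [seq (a, b) | a <- enum 'I_n, b <- enum 'I_p].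
  by rewrite -enum_pairs; apply: eq_enum.
elim: (enum 'I_n) => //= a s IH.
rewrite allpairs_cat filter_cat map_cat IH; congr (_ ++ _).
rewrite /blk /utri.
have -> : enum ({: 'I_p * 'I_p}) = [seq (b, c) | b <- enum 'I_p, c <- enum 'I_p].
  by rewrite -enum_pairs; apply: eq_enum.
suff gen (B C : seq 'I_p) : [seq shift_coord c | c <- [seq (x, y) | x <- [seq (a, b) | b <- B], y <- C]
      & (nat_of_ord c.1.2 <= nat_of_ord c.2)%N] =
    [seq (a.+1, c.1, c.2) | c <- [seq (b, c) | b <- B, c <- C] & up c] by exact: gen.
elim: B => //= b B IHB; rewrite !filter_cat !map_cat {}IHB; congr (_ ++ _).
by rewrite !filter_map -!map_comp.
Qed.

End Coordinates.

(** * The Gaussian limit *)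

Section WeightLimit.
Variables (R : realType) (p : nat).
Implicit Types (X : 'M[R]_p).

Definition scl (n : nat) : R := (Num.sqrt (4 * (p%:R + 1) * n%:R))^-1.

Lemma scl_gt0 n : (0 < n)%N -> 0 < scl n.
Proof. by move=> n0; rewrite invr_gt0 sqrtr_gt0 !mulr_gt0 ?ltr0n // addr_gt0 ?ltr0Sn ?ler0n //; rewrite ltr_wpDl. Qed.

Lemma scl_sqr n : scl n ^+ 2 = (4 * (p%:R + 1) * n%:R)^-1.
Proof. by rewrite /scl exprVn sqr_sqrtr // !mulr_ge0 // addr_ge0. Qed.

(** The reverse companion of [1 - u <= exp (-u)], from [1 + x <= exp x] at [x = u / (1 - u)]. *)
Lemma expR_sub1 (u : R) : u < 1 -> expR (- (u / (1 - u))) <= 1 - u.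
Proof.
move=> u1; have h : 0 < 1 - u by rewrite subr_gt0.
rewrite expRN -[leRHS]invrK lef_pV2 ?posrE ?invr_gt0 ?expR_gt0 //.
apply: le_trans (expR_ge1Dx _); rewrite le_eqVlt; apply/orP; left; apply/eqP.
by field; rewrite gt_eqF.
Qed.

(** The divisor is the value of the weight at [X = 0]. *)
Definition wtn (n j : nat) X := wt (scl n) (p.+1 * (n - j)) X / (2^-1 ^+ p) ^+ (p.+1 * (n - j)).

Lemma wtn_ge0 n j X : 0 <= wtn n j X.
Proof. by rewrite divr_ge0 ?wt_ge0 // ltW. Qed.

Lemma wtn_le n j X : (0 < n)%N -> X^T = X ->
  wtn n j X <= expR (- ((n - j)%:R / n%:R * \tr (X *m X) / 2)).
Proof.
move=> n0 sX; rewrite ler_pdivrMr // mulrC; apply: (le_trans (wt_le _ _ sX)).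
rewrite le_eqVlt; apply/orP; left; apply/eqP; congr (_ * expR (- _)).
rewrite scl_sqr natrM -addn1 natrD; field.
by rewrite pnatr_eq0 -lt0n n0 /= -[1]/(1%:R) -natrD pnatr_eq0 addn1.
Qed.

(** [expR_sub1] is applied to [u = 4 (scl n * d)^2 = d^2 / ((p+1) n)] for each eigenvalue [d]. *)
Lemma wtn_ge n j X (d : 'I_p -> R) : (0 < n)%N ->
  (wt (scl n) (p.+1 * (n - j)) X = if [forall i, (0 < 2^-1 + scl n * d i) && (0 < 2^-1 - scl n * d i)]
    then Num.sqrt (\prod_i (4^-1 - (scl n * d i) ^+ 2)) ^+ (p.+1 * (n - j)) else 0) ->
  (forall i, d i ^+ 2 < n%:R) ->
  expR (- (\sum_i d i ^+ 2 / (n%:R - d i ^+ 2 / (p%:R + 1)) * (n - j)%:R / 2)) <= wtn n j X.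
Proof.
move=> n0 wE dn; have p1 : (0 : R) < p%:R + 1 by rewrite ltr_wpDl.
have nR : (0 : R) < n%:R by rewrite ltr0n.
pose u i := d i ^+ 2 / ((p%:R + 1) * n%:R).
have uE i : (scl n * d i) ^+ 2 = u i / 4.
  by rewrite exprMn scl_sqr /u; field; rewrite !gt_eqF.
have u1 i : u i < 1.
  rewrite /u ltr_pdivrMr ?mulr_gt0 // mul1r (lt_le_trans (dn i)) // ler_peMl ?lerDr //.
have cond i : (0 < 2^-1 + scl n * d i) && (0 < 2^-1 - scl n * d i).
  have : `|scl n * d i| < 2^-1.
    rewrite -(@ltr_pXn2r _ 2) ?nnegrE ?invr_ge0 // real_normK ?num_real // uE.
    have := u1 i; lra.
  rewrite ltr_norml => /andP[h1 h2]; apply/andP; split; lra.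
rewrite /wtn ler_pdivlMr // wE (introT forallP cond).
set N := (p.+1 * (n - j))%N.
have NE : N%:R = (p%:R + 1) * (n - j)%:R :> R by rewrite /N natrM -addn1 natrD.
have -> : \sum_i d i ^+ 2 / (n%:R - d i ^+ 2 / (p%:R + 1)) * (n - j)%:R / 2 =
    N%:R * (\sum_i u i / (1 - u i) / 2).
  rewrite mulr_sumr; apply: eq_bigr => i _; rewrite NE /u; field.
  have dp : d i ^+ 2 < (p%:R + 1) * n%:R by rewrite (lt_le_trans (dn i)) // ler_peMl ?lerDr.
  have h : (p%:R + 1) * n%:R - d i ^+ 2 != 0 by rewrite gt_eqF // subr_gt0.
  by rewrite (gt_eqF p1) (gt_eqF nR) h.
rewrite -mulrN expRM_natl -exprMn lerXn2r ?nnegrE ?mulr_ge0 ?expR_ge0 ?sqrtr_ge0 ?exprn_ge0 ?invr_ge0 //.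
rewrite -(@ler_pXn2r _ 2) ?nnegrE ?mulr_ge0 ?expR_ge0 ?sqrtr_ge0 ?exprn_ge0 ?invr_ge0 //.
rewrite sqr_sqrtr; last first.
  by apply: prodr_ge0 => i _; rewrite uE; have := u1 i; lra.
rewrite exprMn -expRM_natl mulrN mulr_sumr -sumrN expR_sum -exprM mulnC exprM.
have -> : (2^-1 ^+ 2) ^+ p = \prod_(i < p) 4^-1 :> R.
  by rewrite prodr_const card_ord; congr (_ ^+ _); field.
rewrite -big_split /=; apply: ler_prod => i _; rewrite mulr_ge0 ?expR_ge0 ?invr_ge0 //=.
rewrite uE (_ : 4^-1 - u i / 4 = (1 - u i) * 4^-1); last by field.
rewrite ler_wpM2r // ?invr_ge0 // (le_trans _ (expR_sub1 (u1 i))) // ler_expR.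
by rewrite mulrC divfK ?pnatr_eq0.
Qed.

Lemma wtn_cvg j X : X^T = X -> wtn n j X @[n --> \oo] --> expR (- (\tr (X *m X)) / 2).
Proof.
move=> sX; have [d [trE wE]] := wt_spec sX.
(* Both sides of the squeeze have exponents built from such ratios. *)
have rat (c : R) : (n - j)%:R / (n%:R - c) @[n --> \oo] --> (1 : R).
  apply/cvgrPdist_lt => e e0; near=> n.
  have nc : c < n%:R by near: n; exact: nbhs_infty_gtr.
  have nj : (j <= n)%N by near: n; exact: nbhs_infty_ge.
  have ne : c + `|j%:R - c| / e < n%:R by near: n; exact: nbhs_infty_gtr.
  have nc' : 0 < n%:R - c by rewrite subr_gt0.
  rewrite (_ : 1 - _ = (j%:R - c) / (n%:R - c)); last first.
    by rewrite natrB //; field; rewrite gt_eqF.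
  rewrite normrM normfV (gtr0_norm nc') ltr_pdivrMr // mulrC -ltr_pdivrMr //; lra.
apply: (@squeeze_cvgr _ _ _ _
  (fun n => expR (- (\sum_i d i ^+ 2 / (n%:R - d i ^+ 2 / (p%:R + 1)) * (n - j)%:R / 2)))
  (fun n => expR (- ((n - j)%:R / n%:R * \tr (X *m X) / 2)))).
- near=> n; apply/andP; split; last by apply: wtn_le => //; near: n; exact: nbhs_infty_gt.
  apply: wtn_ge => [||i]; first by near: n; exact: nbhs_infty_gt.
    exact: wE.
  have : \sum_i d i ^+ 2 < n%:R by near: n; exact: nbhs_infty_gtr.
  by apply: le_lt_trans; rewrite (bigD1 i) //= lerDl sumr_ge0 // => i' _; exact: sqr_ge0.
- apply: continuous_cvg; first exact: continuous_expR.
  rewrite mulNr; apply: cvgN; rewrite trE mulr_suml.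
  apply: (cvg_big add_continuous) => i _.
  rewrite (_ : (fun n => _) = fun n => (n - j)%:R / (n%:R - d i ^+ 2 / (p%:R + 1)) * (d i ^+ 2 / 2)).
    by rewrite -[X in _ --> X]mul1r; apply: cvgMr_tmp; exact: rat.
  by apply/funext => n; ring.
apply: continuous_cvg; first exact: continuous_expR.
rewrite mulNr; apply: cvgN; rewrite (_ : (fun n => _) = fun n => (n - j)%:R / (n%:R - 0) * (\tr (X *m X) / 2)).
  by rewrite -[X in _ --> X]mul1r; apply: cvgMr_tmp; exact: rat.
by apply/funext => n; rewrite subr0 mulrA.
Unshelve. all: by end_near.
Qed.

End WeightLimit.

(** * Gaussian envelope and the normalisation of the GOE *)

Section Gauss.
Variables (R : realType) (p : nat).
Local Notation T := (nat * 'I_p * 'I_p)%type.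
Local Notation RM := (measurableTypeR R).
Local Notation leb := (@lebesgue_measure R).
Implicit Types (y : T -> R) (X : 'M[R]_p).

(** [exp (-t^2/4)] is weaker than the limit density on purpose: for [j <= k] and [2k < n] the ratio
    [(n - j)/n] is at least 1/2, so this envelope serves all such [n] at once. *)
Definition gphi (t : RM) : R := expR (- (2^-1 * t) ^+ 2).

Lemma gphi_ge0 t : 0 <= gphi t.
Proof. exact: expR_ge0. Qed.

Lemma measurable_gauss_scale (a : R) : measurable_fun setT (fun t : RM => expR (- (a * t) ^+ 2) : RM).
Proof.
apply: (measurableT_comp (@measurable_gauss_fun R)); exact: mulrl_measurable.
Qed.

Lemma measurable_gphi : measurable_fun setT gphi.
Proof. exact: measurable_gauss_scale. Qed.

Lemma integral_gauss_scale (a : R) : 0 < a ->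
  (\int[leb]_t (expR (- (a * t) ^+ 2))%:E)%E = (Num.sqrt pi / a)%:E.
Proof.
move=> a0; have a0' : a != 0 by rewrite gt_eqF.
have mg : measurable_fun setT (EFin \o @gauss_fun R).
  by apply/measurable_EFinP; exact: measurable_gauss_fun.
have := integral_affine 0 a0' mg; rewrite integralT_gauss gtr0_norm // -EFinM mulrC => <-.
by apply: eq_integral => t _; rewrite /= addr0.
Qed.

Lemma Rintegral_gauss_scale (a : R) : 0 < a ->
  Rintegral leb setT (fun t => expR (- (a * t) ^+ 2)) = Num.sqrt pi / a.
Proof. by move=> a0; rewrite /Rintegral integral_gauss_scale. Qed.

Lemma integrable_gphi : leb.-integrable setT (EFin \o gphi).
Proof.
apply/integrableP; split; first by apply/measurable_EFinP; exact: measurable_gphi.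
rewrite (eq_integral (EFin \o gphi)); last first.
  by move=> t _; rewrite /= ger0_norm // gphi_ge0.
by rewrite integral_gauss_scale ?invr_gt0 // ltry.
Qed.

Lemma gphi_lb (L : R) : exists2 m, 0 < m & forall t, `|t| <= L -> m <= gphi t.
Proof.
exists (expR (- (2^-1 * L) ^+ 2)) => [|t tL]; first exact: expR_gt0.
rewrite ler_expR lerN2 -real_normK ?num_real // lerXn2r ?nnegrE ?normr_ge0 //.
  by rewrite mulr_ge0 // (le_trans _ tL).
by rewrite normrM ger0_norm ?invr_ge0 // ler_wpM2l.
Qed.

Lemma tr_symm0 (y : 'I_p * 'I_p -> R) : \tr (symm0 y *m symm0 y) =
  \sum_(c <- utri p) (if c.1 == c.2 then 1 else 2) * y c ^+ 2.
Proof.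
have -> : \tr (symm0 y *m symm0 y) = \sum_(c : 'I_p * 'I_p) symm0 y c.1 c.2 ^+ 2.
  rewrite -(pair_bigA _ (fun i j => symm0 y i j ^+ 2)) /mxtrace; apply: eq_bigr => i _; rewrite mxE; apply: eq_bigr => j _.
  by rewrite expr2; congr (_ * _); rewrite -{1}(symm0_sym y) mxE.
rewrite (bigID (fun c : 'I_p * 'I_p => up c)) /= big_filter big_enum_cond /=.
have -> : \sum_(c : 'I_p * 'I_p | ~~ up c) symm0 y c.1 c.2 ^+ 2 =
    \sum_(c : 'I_p * 'I_p | up c && (c.1 != c.2)) y c ^+ 2.
  pose sw (c : 'I_p * 'I_p) := (c.2, c.1).
  rewrite (reindex sw) /=; last by exists sw => -[].
  apply: eq_big => [[i j]|[i j]]; rewrite /up /= -ltnNge; first by rewrite ltn_neqAle andbC.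
  by move=> ij; rewrite mxE leqNgt ij.
have -> : \sum_(c : 'I_p * 'I_p | up c && (c.1 != c.2)) y c ^+ 2 =
    \sum_(c : 'I_p * 'I_p | up c) (c.1 != c.2)%:R * y c ^+ 2.
  rewrite big_mkcondr; apply: eq_bigr => c _.
  by case: (c.1 == c.2); rewrite ?mul0r ?mul1r.
rewrite -big_split /=; apply: eq_bigr => -[i j] /= ij; rewrite mxE.
move: ij; rewrite /up /= => ->; case: eqP => _ /=; ring.
Qed.

Lemma prod_blks (h : T -> R) l m :
  \prod_(b <- blks p l m) h b = \prod_(j < m) \prod_(c <- utri p) h (l + j, c.1, c.2)%N.
Proof.
elim: m l => [|m IH] l; first by rewrite big_nil big_ord0.
rewrite blksS big_cat IH big_ord_recl big_map addn0; congr (_ * _).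
by apply: eq_bigr => j _; apply: eq_bigr => c _; rewrite addSnnS.
Qed.

Definition gausswt l m y := \prod_(j < m) expR (- (\tr (sm y (l + j) *m sm y (l + j))) / 2).

(** In [tr X^2 / 2] a diagonal entry contributes half its square, an off-diagonal coordinate its
    full square. *)
Definition gscale (b : T) : R := if b.1.2 == b.2 then Num.sqrt 2^-1 else 1.

Lemma gausswtE l m y : gausswt l m y = \prod_(b <- blks p l m) expR (- (gscale b * y b) ^+ 2).
Proof.
rewrite prod_blks; apply: eq_bigr => j _; rewrite tr_symm0 mulNr mulr_suml -expR_sum -sumrN.
congr expR; apply: eq_bigr => c _; congr (- _); rewrite exprMn /gscale /=.
by case: eqP => _; rewrite ?sqr_sqrtr ?invr_ge0 //; field.
Qed.

Lemma meas_gausswt l m : meas (gausswt l m).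
Proof.
have -> : gausswt l m = fun y => \prod_(b <- blks p l m) expR (- (gscale b * y b) ^+ 2).
  by apply/funext => y; exact: gausswtE.
apply: measurable_prod => b _.
exact: (measurableT_comp (measurable_gauss_scale (gscale b)) (measurable_coord b)).
Qed.

Definition goe_const : R := powR (2 * pi) (- (p%:R / 2)) * powR pi (- (p%:R * (p%:R - 1) / 4)).

Lemma prod_utri_diag (a b : R) : \prod_(c <- utri p) (if c.1 == c.2 then a else b) = a ^+ p * b ^+ 'C(p, 2).
Proof.
rewrite big_filter big_enum_cond /=.
transitivity (\prod_(j < p) \prod_(i < p | (i <= j)%N) (if i == j then a else b)).
  rewrite (exchange_big_dep predT) //= pair_big_dep /=.
  by apply: eq_bigl => c; rewrite /up.
transitivity (\prod_(j < p) (a * b ^+ j)).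
  apply: eq_bigr => j _; rewrite (bigD1 j) //= eqxx; congr (_ * _).
  transitivity (\prod_(i < p | (i < j)%N) b).
    by apply: eq_big => [i|i /andP[_ /negPf ->//]]; rewrite ltn_neqAle andbC.
  by rewrite -(big_ord_widen _ (fun=> b) (ltnW (ltn_ord j))) prodr_const card_ord.
by rewrite big_split /= prodr_const card_ord prodrXr -bin2_sum big_mkord.
Qed.

Lemma sqrtX_powR (a : R) n : 0 <= a -> Num.sqrt a ^+ n = powR a (n%:R / 2).
Proof.
by move=> a0; rewrite -powR12_sqrt // -powR_mulrn ?powR_ge0 // -powRrM mulrC.
Qed.

(** The [p] diagonal coordinates integrate to [sqrt (2 pi)] each, the [p (p-1) / 2] others to
    [sqrt pi]. *)
Lemma goe_const_prod : goe_const * \prod_(c <- utri p) (if c.1 == c.2 then Num.sqrt (2 * pi) else Num.sqrt pi) = 1.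
Proof.
have pi0 := @pi_gt0 R; have pi2 : 0 < 2 * pi :> R by rewrite mulr_gt0.
rewrite prod_utri_diag !sqrtX_powR ?ltW // /goe_const !powRN.
have -> : 'C(p, 2)%:R / 2 = p%:R * (p%:R - 1) / 4 :> R.
  have h : 'C(p, 2)%:R * 2 = p%:R * (p%:R - 1) :> R.
    rewrite -natrM mulnC -mul_bin_diag; case: p => [|q]; first by rewrite !mul0r.
    by rewrite bin1 natrM -natr1 addrK.
  by rewrite -h; field.
rewrite mulrACA mulVf ?mulVf ?mulr1 //; by rewrite gt_eqF // powR_gt0.
Qed.

Lemma iint_gausswt l m x : goe_const ^+ m * iint (blks p l m) (gausswt l m) x = 1.
Proof.
rewrite (eq_iint_fun _ _ (fun y => gausswtE l m y)).
rewrite (@iint_prod _ _ _ gphi_ge0 integrable_gphi _ (fun b t => expR (- (gscale b * t) ^+ 2)) _ (fun=> 1)); first last.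
- move=> b t; rewrite mul1r ger0_norm ?expR_ge0 // ler_expR lerN2 !exprMn.
  rewrite ler_wpM2r ?sqr_ge0 // /gscale; case: eqP => _; rewrite ?sqr_sqrtr ?invr_ge0 //; lra.
- by move=> b; exact: measurable_gauss_scale.
- exact: blks_uniq.
rewrite prod_blks -[LHS]/(_ * _) -[m in goe_const ^+ m]card_ord -prodr_const -big_split big1 //= => j _.
rewrite -[RHS]goe_const_prod; congr (_ * _); apply: eq_bigr => c _.
rewrite Rintegral_gauss_scale; last by rewrite /gscale; case: eqP; rewrite ?sqrtr_gt0 ?invr_gt0.
rewrite /gscale /=; case: eqP => _; last by rewrite divr1.
by rewrite sqrtrV // invrK sqrtrM // mulrC.
Qed.

End Gauss.

Section Transfer.
Variables (R : realType) (p : nat).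
Hypothesis p0 : (0 < p)%N.
Local Notation T := (nat * 'I_p * 'I_p)%type.
Implicit Types (y : T -> R).

Lemma lebint_blks n (g : (coordT p n -> R) -> R) :
  lebint g = iint (blks p 1 n) (fun y => g (@toc R p n y)) (fun=> 0).
Proof.
by rewrite -map_coords (iint_map _ g (fun=> 0) (@inj_shift_coord p n)).
Qed.

Lemma symm_toc n y (l : 'I_n) : symm (@toc R p n y) l = sm y l.+1.
Proof. by apply/matrixP => u v; rewrite !mxE. Qed.

Section Test.
Variables (k : nat) (f : ('I_k -> 'M[R]_p) -> R).
Hypothesis bcf : bounded_continuous f.

Definition test (s : nat -> 'M[R]_p) : R := f (fun l : 'I_k => s l.+1).

Lemma test_bound : exists B, forall s, `|test s| <= B.
Proof. by have [[B fB] _] := bcf; exists B => s; exact: fB. Qed.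

Lemma test_dep n s s' : (k <= n)%N -> (forall j, (0 < j <= n)%N -> s j = s' j) -> test s = test s'.
Proof.
move=> kn e; congr f; apply/funext => l; apply: e.
by rewrite /= (leq_trans (ltn_ord l)).
Qed.

Lemma meas_test : meas (fun y => test (sm y)).
Proof.
pose g (x : coordT p k -> R) := f (fun l => symm x l).
have mg : meas g.
  apply: continuous_meas => x e e0; have [d d0 fd] := bcf.2 (fun l => symm x l) e e0.
  by exists d => // z zd; apply: fd => l i j; rewrite !mxE; case: ifP => _; exact: zd.
pose h (y : Xtype R T) : Xtype R (coordT p k) := toc y.
have mh : measurable_fun setT h by apply: measurable_to_Xtype => c; exact: measurable_coord.
have -> : (fun y => test (sm y)) = g \o h.
  by apply/funext => y; congr f; apply/funext => l; rewrite symm_toc.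
exact: (measurableT_comp mg mh).
Qed.

End Test.

Lemma lebint_reduction n fs : (0 < n)%N ->
  (forall s s', (forall j, (0 < j <= n)%N -> s j = s' j) -> fs s = fs s') ->
  meas (fun y : T -> R => fs (sm y)) -> (exists B, forall s, `|fs s| <= B) ->
  lebint (fun x => \1_(@moment_space R p n) x * fs (canX (scl R p n) (Sseq x))) =
  levelC p (scl R p n) ^+ n * wint (scl R p n) fs 1 n (fun=> 0).
Proof.
move=> n0 fd mf fB; rewrite lebint_blks.
have i0 : inside 0 (Sq (fun=> 0) : nat -> 'M[R]_p) by move=> j; case: j.
rewrite -[LHS]/(iint (blks p 1 n) (unifs (scl R p n) n fs) (fun=> 0)).
rewrite (@reduction R p p0 _ (@measurable_gphi R) (@gphi_ge0 R) (@integrable_gphi R) (@gphi_lb R)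
  (scl R p n) n fs (scl_gt0 R p n0) fd mf fB n 0 (fun=> 0) (fun=> 0) (add0n n) i0) //.
  (* The first gap is the identity, so the reduction starts with determinant 1. *)
  by rewrite /gap subr0 det1 sqrtr1 expr1n mulr1.
by move=> j; case: j.
Qed.

Lemma unif_expect_wint k n (f : ('I_k -> 'M[R]_p) -> R) : bounded_continuous f -> (0 < n)%N -> (k <= n)%N ->
  unif_expect n f = wint (scl R p n) (test f) 1 n (fun _ : T => 0) /
    wint (scl R p n) (fun _ : nat -> 'M[R]_p => 1) 1 n (fun _ : T => 0).
Proof.
move=> bcf n0 kn; have C0 : levelC p (scl R p n) ^+ n != 0.
  by rewrite !expf_neq0 // gt_eqF // sqrtr_gt0 scl_gt0.
have B1 : exists B : R, forall s : nat -> 'M[R]_p, `|1 : R| <= B by exists 1 => s; rewrite normr1.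
have m1 : meas (fun y : T -> R => 1 : R) by exact: measurable_cst.
have d1 : forall s s' : nat -> 'M[R]_p, (forall j, (0 < j <= n)%N -> s j = s' j) -> 1 = 1 :> R by [].
have e1 := @lebint_reduction n (test f) n0 (fun s s' => @test_dep k f n s s' kn) (meas_test bcf) (test_bound bcf).
have e2 := @lebint_reduction n (fun=> 1) n0 d1 m1 B1.
rewrite -(mulKf C0 (wint _ (test f) _ _ _)) -(mulKf C0 (wint _ (fun=> 1) _ _ _)) -e1 -e2.
rewrite invfM invrK mulrACA mulVf // mul1r /unif_expect; congr (_ / _); apply: eq_iint_fun => x.
  congr (_ * f _); apply/funext => l.
  by rewrite /canX /scl invrK.
by rewrite mulr1.
Qed.

End Transfer.

(** * Separating the first [k] levels *)

Section Limit.
Variables (R : realType) (p : nat).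
Local Notation T := (nat * 'I_p * 'I_p)%type.
Implicit Types (y : T -> R).
Local Notation phi0 := (@gphi_ge0 R).
Local Notation iphi := (@integrable_gphi R).

(** The factor of the levels beyond [k], common to numerator and denominator; its value never
    matters, only that it is nonzero. *)
Definition wtail n k m : R := iint (blks p k.+1 m) (wprod (scl R p n) k.+1 m) (fun=> 0).

Definition headscale n k : R := \prod_(j < k) (2^-1 ^+ p) ^+ (p.+1 * (n - j.+1)).
Definition headwt n k y : R := \prod_(j < k) wtn n j.+1 (sm y j.+1).

Lemma wprod_split n k m y : n = (k + m)%N ->
  wprod (scl R p n) 1 n y = headscale n k * headwt n k y * wprod (scl R p n) k.+1 m y.
Proof.
move=> ->; rewrite /wprod big_split_ord /=; congr (_ * _).
  rewrite /headscale /headwt -big_split; apply: eq_bigr => j _.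
  by rewrite /= /wtn add1n mulrCA divff ?mulr1 // !expf_neq0 // invr_neq0.
by apply: eq_bigr => j _; rewrite add1n -addnS subnDl addSnnS.
Qed.

Lemma headwt_ge0 n k y : 0 <= headwt n k y.
Proof. by apply: prodr_ge0 => j _; exact: wtn_ge0. Qed.

Lemma meas_headwt n k : meas (headwt n k).
Proof.
apply: measurable_prod => j _; rewrite /wtn; apply: measurable_funM; last exact: measurable_cst.
exact: meas_sm.
Qed.

Lemma headwt_upd n k y a t : (k < a.1.1)%N -> headwt n k (upd y a t) = headwt n k y.
Proof.
move=> ka; apply: eq_bigr => j _; rewrite sm_upd // mem_blk; apply/negP => /andP[/eqP e _].
by move: ka; rewrite e ltnNge ltn_ord.
Qed.

Lemma headwt_dom n k (g : (T -> R) -> R) B : (k.*2 < n)%N -> (forall y, `|g y| <= B) ->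
  dom (@gphi R) (blks p 1 k) (cst B) (fun y => headwt n k y * g y).
Proof.
move=> kn gB; split=> // [y|y]; last exact: le_trans (gB y).
rewrite normrM mulrC ler_pM // ger0_norm ?headwt_ge0 // /headwt /env prod_blks.
apply: ler_prod => j _; rewrite wtn_ge0 /=; apply: (le_trans (wtn_le _ _ (sm_sym _ _))); first by lia.
rewrite -expR_sum ler_expR add1n tr_symm0 sumrN lerN2.
set Q := \sum_(c <- _) _; set S := \sum_(c <- _) _.
have QS : Q <= S / 4.
  rewrite mulr_suml; apply: ler_sum => c _; rewrite exprMn.
  have := sqr_ge0 (y (j.+1, c.1, c.2)); case: eqP => _ /=; lra.
have h : 2^-1 <= (n - j.+1)%:R / n%:R :> R.
  rewrite ler_pdivlMr ?ltr0n; last by lia.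
  rewrite ler_pdivrMl // -natrM ler_nat; have := ltn_ord j; lia.
have S0 : 0 <= S by apply: sumr_ge0 => c _; rewrite mulr_ge0 ?sqr_ge0 //; case: eqP.
apply: (le_trans QS); nra.
Qed.

Lemma wtail_const n k m x : iint (blks p k.+1 m) (wprod (scl R p n) k.+1 m) x = wtail n k m.
Proof.
apply: (iint_dep (Q := mem (blks p k.+1 m))) => [z z' e|b /= ->//].
apply: eq_bigr => j _; rewrite (sm_dep (y' := z')) // => b bj; apply: e; move: bj.
rewrite /= mem_blks mem_blk => /andP[/eqP -> ->]; rewrite andbT; have := ltn_ord j; lia.
Qed.

Lemma wint_split n k m (fs : (nat -> 'M[R]_p) -> R) : n = (k + m)%N -> (k.*2 < n)%N ->
  (forall s s', (forall j, (0 < j <= k)%N -> s j = s' j) -> fs s = fs s') ->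
  meas (fun y : T -> R => fs (sm y)) -> (exists B, forall s, `|fs s| <= B) ->
  wint (scl R p n) fs 1 n (fun=> 0) =
    headscale n k * wtail n k m * iint (blks p 1 k) (fun y => headwt n k y * fs (sm y)) (fun=> 0).
Proof.
move=> nE kn fd mf [B fB].
have bE : blks p 1 n = blks p 1 k ++ blks p k.+1 m by rewrite nE blks_cat.
rewrite /wint bE.
have n0 : (0 < n)%N by lia.
have [C dW] : exists C : R, dom (@gphi R) (blks p k.+1 m) (cst C) (wprod (scl R p n) k.+1 m).
  apply: (@dom_box _ _ (@gphi R) phi0 _ _ 1 (scl R p n)^-1 (@gphi_lb R)) => y.
    by rewrite ger0_norm ?wprod_ge0 // wprod_le1.
  by apply: wprod_box; exact: scl_gt0.
have mH : meas (fun y => headwt n k y * fs (sm y)).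
  by apply: measurable_funM => //; exact: meas_headwt.
have dH := headwt_dom kn (fun y => fB (sm y)).
rewrite iint_cat -(iintM phi0 iphi _ (blks_uniq p 1 k) mH dH (h := fun=> headscale n k * wtail n k m)) //.
apply: eq_iint_fun => y.
pose h z := headscale n k * (headwt n k z * fs (sm z)).
transitivity (h y * iint (blks p k.+1 m) (wprod (scl R p n) k.+1 m) y); last first.
  by rewrite wtail_const /h; ring.
rewrite -(iintM phi0 iphi _ (blks_uniq p k.+1 m) (@meas_wprod _ _ _ _ _) dW).
  by apply: eq_iint_fun => z; rewrite /wfs (wprod_split z nE) /h; ring.
move=> a z t; rewrite /h; rewrite mem_blks => /andP[/andP[ka _] _]; rewrite headwt_upd //; congr (_ * (_ * _)).
apply: fd => j /andP[_ jk]; rewrite sm_upd // mem_blk; apply/negP => /andP[/eqP e _].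
by move: ka; rewrite e ltnNge jk.
Qed.

(** A crude bound near 0, uniform in [j], that serves only the positivity of [wtail]. *)
Lemma wtn_lb n j (X : 'M[R]_p) : (0 < n)%N -> X^T = X -> \tr (X *m X) <= 2^-1 ->
  expR (- n%:R) <= wtn n j X.
Proof.
move=> n0 sX tX; have [d [trE wE]] := wt_spec sX.
have n1 : (1 : R) <= n%:R by rewrite ler1n.
have d2 i : d i ^+ 2 <= 2^-1.
  by apply: le_trans tX; rewrite trE (bigD1 i) //= lerDl sumr_ge0 // => i' _; exact: sqr_ge0.
have dn i : d i ^+ 2 < n%:R by have := d2 i; lra.
apply: le_trans (wtn_ge n0 (wE _ _) dn); rewrite ler_expR lerN2.
apply: (@le_trans _ _ (\sum_i n%:R * d i ^+ 2)); last first.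
  by rewrite -mulr_sumr -trE; have : 0 <= n%:R :> R by []; nra.
apply: ler_sum => i _; have h2 := d2 i; have h0 := sqr_ge0 (d i).
have p1 : (1 : R) <= p%:R + 1 by rewrite lerDr.
have q1 : d i ^+ 2 / (p%:R + 1) <= 2^-1.
  by rewrite ler_pdivrMr; [nra|exact: lt_le_trans p1].
set D := n%:R - _; have D1 : 2^-1 <= D by rewrite /D; lra.
have D0 : 0 < D by exact: lt_le_trans D1.
have DI : D^-1 <= 2 by rewrite -[leRHS]invrK lef_pV2 // posrE invr_gt0.
have D00 : 0 <= D^-1 by rewrite invr_ge0 ltW.
have nj : (n - j)%:R <= n%:R :> R by rewrite ler_nat leq_subr.
have nj0 : 0 <= (n - j)%:R :> R by [].
have a1 : d i ^+ 2 / D <= 2 * d i ^+ 2 by nra.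
have a0 : 0 <= d i ^+ 2 / D by rewrite mulr_ge0.
move: a1 a0; move: (d i ^+ 2 / D) => a a1 a0; nra.
Qed.

Lemma wtail_gt0 n k m : n = (k + m)%N -> (0 < n)%N -> 0 < wtail n k m.
Proof.
move=> nE n0.
have [C dW] : exists C : R, dom (@gphi R) (blks p k.+1 m) (cst C) (wprod (scl R p n) k.+1 m).
  apply: (@dom_box _ _ (@gphi R) phi0 _ _ 1 (scl R p n)^-1 (@gphi_lb R)) => y.
    by rewrite ger0_norm ?wprod_ge0 // wprod_le1.
  by apply: wprod_box; exact: scl_gt0.
(* On the cube of half-width [e], [tr X^2] is at most [2 e^2 size (utri p)], which this choice keeps
   below 1/2. *)
pose e : R := (2 * (size (utri p)).+1%:R)^-1.
have e0 : 0 < e by rewrite invr_gt0 mulr_gt0.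
pose c : R := \prod_(j < m) (expR (- n%:R) * (2^-1 ^+ p) ^+ (p.+1 * (m - j.+1))).
have c0 : 0 < c by apply: prodr_gt0 => j _; rewrite mulr_gt0 ?expR_gt0 // !exprn_gt0 // invr_gt0.
apply: (@lt_le_trans _ _ (c * e ^+ size (blks p k.+1 m))); first by rewrite mulr_gt0 ?exprn_gt0.
apply: (iint_gt0 phi0 iphi (z := fun=> 0) (blks_uniq p k.+1 m) (@meas_wprod _ _ _ _ _) dW) => //.
  by move=> y; exact: wprod_ge0.
move=> y _ ye; apply: ler_prod => j _.
rewrite mulr_ge0 ?expR_ge0 ?exprn_ge0 ?invr_ge0 //= -ler_pdivlMr ?exprn_gt0 ?invr_gt0 //.
have := @wtn_lb n (k + j.+1) (sm y (k.+1 + j)) n0 (sm_sym _ _).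
rewrite /wtn [in (_ - _)%N]nE subnDl; apply.
rewrite tr_symm0; apply: (@le_trans _ _ (\sum_(a <- utri p) 2 * e ^+ 2)).
  rewrite big_seq [leRHS]big_seq; apply: ler_sum => a au.
  have : `|y ((k.+1 + j)%N, a.1, a.2) - 0| < e.
    apply: ye; rewrite mem_blks /= -surjective_pairing -mem_utri au andbT.
    by rewrite leq_addr ltn_add2l ltn_ord.
  rewrite subr0 => /ltW h; have h2 : y ((k.+1 + j)%N, a.1, a.2) ^+ 2 <= e ^+ 2.
    by rewrite -real_normK ?num_real // lerXn2r // nnegrE // ltW.
  have := sqr_ge0 (y ((k.+1 + j)%N, a.1, a.2)); case: eqP => _; nra.
rewrite big_const_seq count_predT iter_addr_0 -[_ *+ size _]mulr_natr.
have e1 : e * (2 * ((size (utri p))%:R + 1)) = 1 by rewrite natr1 mulVf // mulf_neq0.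
have : 0 <= (size (utri p))%:R :> R by [].
clearbody e; move: ((size (utri p))%:R : R) e1 => s e1 s0.
have es0 : 0 <= e * s by rewrite mulr_ge0 // ltW.
have es : e * s <= 2^-1 by lra.
have e2 : e <= 2^-1 by lra.
have := ler_pM (ltW e0) es0 e2 es; lra.
Qed.
End Limit.

Section Conclusion.
Variables (R : realType) (p k : nat).
Hypothesis p0 : (0 < p)%N.
Local Notation T := (nat * 'I_p * 'I_p)%type.
Implicit Types (y : T -> R) (fs : (nat -> 'M[R]_p) -> R).

Lemma headwt_cvg y : headwt n k y @[n --> \oo] --> gausswt 1 k y.
Proof.
apply: (cvg_big mul_continuous) => j _; rewrite add1n; apply: wtn_cvg; exact: sm_sym.
Qed.

Definition headint n fs : R := iint (blks p 1 k) (fun y => headwt n k y * fs (sm y)) (fun=> 0).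
Definition gaussint fs : R := iint (blks p 1 k) (fun y => gausswt 1 k y * fs (sm y)) (fun=> 0).

Lemma headint_cvg fs : meas (fun y : T -> R => fs (sm y)) -> (exists B, forall s, `|fs s| <= B) ->
  headint n fs @[n --> \oo] --> gaussint fs.
Proof.
(* The shift by [2k + 1] puts every index in the range where [headwt_dom] holds. *)
move=> mf [B fB]; rewrite -(cvg_shiftn k.*2.+1).
apply: (iint_cvg (@gphi_ge0 R) (@integrable_gphi R) (C := cst B)
  (g_ := fun n y => headwt (n + k.*2.+1) k y * fs (sm y)) (g := fun y => gausswt 1 k y * fs (sm y))
  (blks_uniq p 1 k)).
- by move=> n; apply: measurable_funM => //; exact: meas_headwt.
- by apply: measurable_funM => //; exact: meas_gausswt.
- by move=> n; apply: headwt_dom => //; rewrite addnS ltnS leq_addl.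
move=> y; apply: cvgMr_tmp.
by move: (headwt_cvg (y := y)); rewrite -(cvg_shiftn k.*2.+1).
Qed.

Lemma unif_expect_headint n (f : ('I_k -> 'M[R]_p) -> R) : bounded_continuous f -> (k.*2 < n)%N ->
  unif_expect n f = headint n (test f) / headint n (fun=> 1).
Proof.
move=> bcf kn; have n0 : (0 < n)%N by exact: leq_trans kn.
have nE : n = (k + (n - k))%N by lia.
have B1 : exists B : R, forall s : nat -> 'M[R]_p, `|1 : R| <= B by exists 1 => s; rewrite normr1.
have m1 : meas (fun y : T -> R => 1 : R) by exact: measurable_cst.
rewrite unif_expect_wint //; last by lia.
rewrite (wint_split nE kn (fun s s' => @test_dep R p k f k s s' (leqnn k)) (meas_test bcf) (test_bound bcf)).
rewrite (@wint_split R p n k _ (fun=> 1) nE kn (fun _ _ _ => erefl) m1 B1).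
rewrite invfM mulrACA divff ?mul1r // mulf_neq0 ?gt_eqF ?wtail_gt0 //.
by apply: prodr_gt0 => j _; rewrite !exprn_gt0 // invr_gt0.
Qed.

Lemma goe_expect_gaussint (f : ('I_k -> 'M[R]_p) -> R) : bounded_continuous f ->
  goe_expect f = goe_const R p ^+ k * gaussint (test f).
Proof.
move=> bcf; rewrite /goe_expect lebint_blks.
have [B fB] := test_bound bcf.
(* The envelope of the Gaussian integrand is inherited from the prelimit weights by [dom_cvg]. *)
have dG : dom (@gphi R) (blks p 1 k) (cst B) (fun y => gausswt 1 k y * test f (sm y)).
  apply: (dom_cvg (g_ := fun n y => headwt (n + k.*2.+1) k y * test f (sm y))).
    by move=> n; apply: headwt_dom => //; rewrite addnS ltnS leq_addl.
  move=> y; apply: cvgMr_tmp.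
  by move: (headwt_cvg (y := y)); rewrite -(cvg_shiftn k.*2.+1).
have mG : meas (fun y => gausswt 1 k y * test f (sm y)).
  by apply: measurable_funM; [exact: meas_gausswt|exact: meas_test].
rewrite -(iintM (@gphi_ge0 R) (@integrable_gphi R) _ (blks_uniq p 1 k) mG dG (h := fun=> goe_const R p ^+ k)) //.
apply: eq_iint_fun => y.
have -> : (fun l => symm (toc y) l) = (fun l : 'I_k => sm y l.+1).
  by apply/funext => l; exact: symm_toc.
rewrite mulrC mulrA; congr (_ * _).
rewrite -[k in goe_const R p ^+ k]card_ord -prodr_const -big_split; apply: eq_bigr => l _.
by rewrite symm_toc /goe_density add1n.
Qed.

End Conclusion.

Unset Implicit Arguments.

Theorem theorem4p3 (R : realType) (p k : nat) :
  (1 <= p)%N -> (1 <= k)%N ->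
  forall f : ('I_k -> 'M[R]_p) -> R, bounded_continuous f ->
    (fun n : nat => @unif_expect R p k n f) @ \oo --> @goe_expect R p k f.
Proof.
move=> p0 _ f bcf.
have B1 : exists B : R, forall s : nat -> 'M[R]_p, `|1 : R| <= B by exists 1 => s; rewrite normr1.
have m1 : meas (fun y : nat * 'I_p * 'I_p -> R => 1 : R) by exact: measurable_cst.
(* The GOE density has mass one: this turns the limiting quotient into [goe_expect] and keeps its
   denominator away from 0. *)
have N1 : goe_const R p ^+ k * gaussint k (fun _ : nat -> 'M[R]_p => 1) = 1.
  rewrite -[RHS](iint_gausswt (p := p) 1 k (fun=> 0)); congr (_ * _).
  by apply: eq_iint_fun => y; rewrite mulr1.
have N0 : gaussint k (fun _ : nat -> 'M[R]_p => 1) != 0.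
  by apply: contra_eq_neq N1 => ->; rewrite mulr0 eq_sym oner_eq0.
have -> : goe_expect f = gaussint k (test f) / gaussint k (fun _ : nat -> 'M[R]_p => 1).
  by rewrite goe_expect_gaussint // mulrC; congr (_ * _); apply: (mulIf N0); rewrite N1 mulVf.
have cv : headint k n (test f) / headint k n (fun _ : nat -> 'M[R]_p => 1) @[n --> \oo] -->
    gaussint k (test f) / gaussint k (fun _ : nat -> 'M[R]_p => 1).
  apply: cvgM; first by apply: headint_cvg; [exact: meas_test|exact: test_bound].
  by apply: cvgV => //; exact: headint_cvg.
apply: cvg_trans cv; apply: near_eq_cvg; near=> n.
by rewrite unif_expect_headint //; near: n; exact: nbhs_infty_gt.
Unshelve. all: by end_near.
Qed.
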